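(* Let $n\ge2$ be an integer, and let $(c_\ell)_{\ell\ge1}$ be the coefficients, depending only on $n$, defined in the context. For integers $M\ge1$ and $N\ge2M$ and i.i.d. $X_1,\dots,X_N\sim\mathrm{FvML}(\mu,\kappa)$, with $\mu\in\mathbb{S}^{n-1}$ and $\kappa>0$, the estimator $$\hat\zeta_M=\sum_{\ell=1}^M\frac{c_\ell\,D_{N,\ell}}{(N)_{2\ell}}$$ is an unbiased estimator of the partial sum $$\zeta_M(\kappa)=\sum_{\ell=1}^M c_\ell\,A_n(\kappa)^{2\ell},$$ i.e. $\mathbb{E}[\hat\zeta_M]=\zeta_M(\kappa)$ for all $(\mu,\kappa)\in\mathbb{S}^{n-1}\times(0,\infty)$. Moreover, there exists $\rho_n\in(0,R_n]$, depending only on $n$, such that for every $0<\kappa<\rho_n$, writing $\zeta=\kappa^2$: $\kappa^2=\sum_{\ell\ge1}c_\ell A_n(\kappa)^{2\ell}$, $\zeta_M(\kappa)\to\zeta$ as $M\to\infty$, and for all $M\ge1$ and $N\ge2M$ the truncation error is $$\mathbb{E}[\hat\zeta_M]-\zeta=-\sum_{\ell>M}c_\ell A_n(\kappa)^{2\ell}.$$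
   Context: $\mathbb{S}^{n-1}=\{x\in\mathbb{R}^n:\|x\|=1\}$ and $\sigma$ is its surface measure. For $\mu\in\mathbb{S}^{n-1}$ and $\kappa>0$, $\mathrm{FvML}(\mu,\kappa)$ is the probability measure on $\mathbb{S}^{n-1}$ with $\sigma$-density $f(x;\mu,\kappa)=C_n(\kappa)e^{\kappa\mu^\top x}$, where $C_n(\kappa)=\frac{\kappa^{n/2-1}}{(2\pi)^{n/2}I_{n/2-1}(\kappa)}$ is the normalizing constant and $I_\nu(\kappa)=\sum_{m\ge0}\frac{(\kappa/2)^{\nu+2m}}{m!\,\Gamma(\nu+m+1)}$ is the modified Bessel function of the first kind. $A_n(\kappa)=I_{n/2}(\kappa)/I_{n/2-1}(\kappa)$ for $\kappa>0$; it extends to a real-analytic odd function on $\mathbb{R}$ with $A_n(0)=0$, whose power series at $0$ is $A_n(\kappa)=\sum_{j\ge0}a_j\kappa^{2j+1}$ with $a_0=1/n$ and $a_j=\frac{-1}{n+2j}\sum_{k=0}^{j-1}a_ka_{j-1-k}$ for $j\ge1$. $R_n>0$ is its radius of convergence. The coefficients $c_\ell$: with $b_1=a_0^2=1/n^2$ (the coefficient of $\kappa^2$ in $A_n(\kappa)^2$), $c_1=1/b_1=n^2$ and, for $\ell\ge2$, $c_\ell=-\frac{1}{b_1^\ell}\sum_{j=1}^{\ell-1}c_j\,[A_n(\kappa)^{2j}]_{\kappa^{2\ell}}$, where $[f(\kappa)]_{\kappa^{2\ell}}$ denotes the coefficient of $\kappa^{2\ell}$ in the power series of $f$ at $0$.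 $D_{N,\ell}=\sum (X_{i_1}\cdot X_{i_2})(X_{i_3}\cdot X_{i_4})\cdots(X_{i_{2\ell-1}}\cdot X_{i_{2\ell}})$, the sum running over all ordered $2\ell$-tuples $(i_1,\dots,i_{2\ell})$ of distinct indices in $\{1,\dots,N\}$. $(N)_{2\ell}=N(N-1)\cdots(N-2\ell+1)$ is the falling factorial. *)

(* Defs.v *)
From HB Require Import structures.
From mathcomp Require Import all_boot all_order all_algebra.
From mathcomp Require Import all_classical all_reals all_analysis.
From mathcomp Require Import measurable_realfun.

Set Implicit Arguments.
Unset Strict Implicit.
Unset Printing Implicit Defensive.
Import Order.TTheory GRing.Theory Num.Theory.
Import numFieldNormedType.Exports.

Local Open Scope classical_set_scope.
Local Open Scope ring_scope.

(* R^n is [n.-tuple R], with the library's product sigma-algebra. *)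

Section euclidean.
Context {R : realType}.

Definition dotp n (x y : n.-tuple R) : R := \sum_(i < n) tnth x i * tnth y i.

Definition enorm n (x : n.-tuple R) : R := Num.sqrt (dotp x x).

Definition scalet n (r : R) (x : n.-tuple R) : n.-tuple R :=
  [tuple r * tnth x i | i < n].

Definition unit_sphere n : set (n.-tuple R) := [set x | enorm x = 1].

Lemma dotpZ n (r s : R) (x y : n.-tuple R) :
  dotp (scalet r x) (scalet s y) = r * s * dotp x y.
Proof.
rewrite /dotp mulr_sumr; apply: eq_bigr => i _.
by rewrite !tnth_mktuple mulrACA.
Qed.

Lemma dotp_ge0 n (x : n.-tuple R) : 0 <= dotp x x.
Proof. by apply: sumr_ge0 => i _; rewrite -expr2 sqr_ge0. Qed.

Lemma enormZ n (r : R) (x : n.-tuple R) : enorm (scalet r x) = `|r| * enorm x.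
Proof. by rewrite /enorm dotpZ sqrtrM -?expr2 ?sqr_ge0// sqrtr_sqr. Qed.

Lemma scaletA n (r s : R) (x : n.-tuple R) :
  scalet r (scalet s x) = scalet (r * s) x.
Proof. by apply: eq_from_tnth => i; rewrite !tnth_mktuple mulrA. Qed.

Lemma scalet1 n (x : n.-tuple R) : scalet 1 x = x.
Proof. by apply: eq_from_tnth => i; rewrite tnth_mktuple mul1r. Qed.

Lemma measurable_dotp n : measurable_fun setT (fun x : n.-tuple R => dotp x x).
Proof.
apply: measurable_sum => i.
by apply: measurable_funM; exact: measurable_tnth.
Qed.

Lemma measurable_enorm n : measurable_fun setT (@enorm n).
Proof.
rewrite (_ : @enorm n = (fun x => dotp x x `^ 2^-1)); last first.
  by apply/funext => x; rewrite powR12_sqrt ?dotp_ge0.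
exact: (measurableT_comp (@measurable_powR R 2^-1) (@measurable_dotp n)).
Qed.

Lemma measurable_normalize n :
  measurable_fun setT (fun x : n.-tuple R => scalet (enorm x)^-1 x).
Proof.
apply/measurable_fun_tnthP => i.
rewrite (_ : _ \o _ = fun x : n.-tuple R => (enorm x)^-1 * tnth x i).
  apply: measurable_funM; last exact: measurable_tnth.
  rewrite (_ : (fun x => _) = (fun x => enorm x `^ (-1))); last first.
    by apply/funext => x; rewrite powR_inv1 ?sqrtr_ge0.
  exact: (measurableT_comp (@measurable_powR R (-1)) (@measurable_enorm n)).
by apply/funext => x /=; rewrite tnth_mktuple.
Qed.

End euclidean.

Section lebesgue_tuple.
Context {R : realType}.

Definition tcons n (p : measurableTypeR R * n.-tuple R) : n.+1.-tuple R :=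
  [tuple of p.1 :: p.2].

Lemma measurable_tcons n : measurable_fun setT (@tcons n).
Proof.
by apply: measurable_cons; [exact: measurable_fst|exact: measurable_snd].
Qed.

Section successor.
Local Open Scope ereal_scope.
Variables (n : nat) (m : {sigma_finite_measure set (n.-tuple R) -> \bar R}).

Definition lebesgue_cons : set (n.+1.-tuple R) -> \bar R :=
  pushforward (lebesgue_measure \x m) (@tcons n).

Let lebesgue_cons0 : lebesgue_cons set0 = 0.
Proof. by rewrite /lebesgue_cons /pushforward preimage_set0 measure0. Qed.

Let lebesgue_cons_ge0 A : 0 <= lebesgue_cons A.
Proof. by rewrite /lebesgue_cons /pushforward measure_ge0. Qed.

Let lebesgue_cons_sigma_additive : semi_sigma_additive lebesgue_cons.
Proof.
move=> F mF tF mUF; rewrite /lebesgue_cons /pushforward preimage_bigcup.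
have mp A : measurable A -> measurable (@tcons n @^-1` A).
  by move=> mA; rewrite -[X in measurable X]setTI; exact: measurable_tcons.
apply: measure_semi_sigma_additive.
- by move=> i; exact: mp.
- apply/trivIsetP => /= i j _ _ ij; rewrite -preimage_setI.
  by move/trivIsetP : tF => /(_ _ _ _ _ ij) ->//; rewrite preimage_set0.
- by rewrite -preimage_bigcup; exact: mp.
Qed.

HB.instance Definition _ := isMeasure.Build _ _ _ lebesgue_cons
  lebesgue_cons0 lebesgue_cons_ge0 lebesgue_cons_sigma_additive.

Let lebesgue_cons_sigma_finite : sigma_finite setT lebesgue_cons.
Proof.
have /sigma_finiteP[F [TF ndF Foo]] := sigma_finiteT (@lebesgue_measure R).
have /sigma_finiteP[G [TG ndG Goo]] := sigma_finiteT m.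
exists (fun k => (fun x : n.+1.-tuple R => thead x) @^-1` F k `&`
                 (fun x : n.+1.-tuple R => [tuple of behead x]) @^-1` G k).
  apply/seteqP; split => // x _.
  have : [set: measurableTypeR R] (thead x) by [].
  have : [set: n.-tuple R] [tuple of behead x] by [].
  rewrite TF TG => -[j _ Gj] [i _ Fi]; exists (maxn i j) => //; split => /=.
    by have /subsetPset := ndF _ _ (leq_maxl i j); exact.
  by have /subsetPset := ndG _ _ (leq_maxr i j); exact.
move=> k; have [mFk Fk] := Foo k; have [mGk Gk] := Goo k; split.
  apply: measurableI.
    by rewrite -[X in measurable X]setTI; exact: measurable_tnth.
  by rewrite -[X in measurable X]setTI; exact: measurable_behead.
rewrite /lebesgue_cons /pushforward.
rewrite (_ : _ @^-1` _ = F k `*` G k); last first.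
  apply/seteqP; split => -[x t]; rewrite /preimage/= theadE;
    by rewrite (_ : [tuple of behead (tcons (x, t))] = t)//; exact/val_inj.
by rewrite product_measure1E// lte_mul_pinfty// ge0_fin_numE.
Qed.

HB.instance Definition _ := Measure_isSigmaFinite.Build _ _ _ lebesgue_cons
  lebesgue_cons_sigma_finite.

End successor.

Fixpoint lebesgue_tuple n : {sigma_finite_measure set (n.-tuple R) -> \bar R} :=
  if n is n'.+1 return {sigma_finite_measure set (n.-tuple R) -> \bar R}
  then lebesgue_cons (lebesgue_tuple n')
  else \d_([tuple] : 0.-tuple R).

End lebesgue_tuple.

Section surface_measure.
Context {R : realType} (n : nat).
Local Open Scope ereal_scope.

Definition cone (E : set (n.-tuple R)) : set (n.-tuple R) :=
  [set scalet r x | r in `]0%R, 1%R] & x in E `&` @unit_sphere R n].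

(* Surface measure as in the polar coordinates formula:
   sigma(E) = n * lambda_n({r x | 0 < r <= 1, x in E}). It is a measure on R^n
   concentrated on the unit sphere. *)
Definition surface_measure (E : set (n.-tuple R)) : \bar R :=
  n%:R%:E * lebesgue_tuple n (cone E).

Let punctured_ball : set (n.-tuple R) := [set x | (0 < enorm x <= 1)%R].

Let coneE E : cone E =
  (fun x : n.-tuple R => scalet (enorm x)^-1 x) @^-1` E `&` punctured_ball.
Proof.
apply/seteqP; split => [_ [r /= r01] [x [Ex x1]] <-|x [/= Ex /andP[x0 x1]]].
  move: r01; rewrite in_itv/= => /andP[r0 r1].
  rewrite /unit_sphere /= in x1.
  rewrite /punctured_ball /= enormZ x1 mulr1 gtr0_norm// scaletA mulVf ?gt_eqF//.
  by rewrite scalet1 r0.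
exists (enorm x); first by rewrite /= in_itv/= x0.
exists (scalet (enorm x)^-1 x).
  split => //; rewrite /unit_sphere /= enormZ gtr0_norm ?invr_gt0//.
  by rewrite mulVf// gt_eqF.
by rewrite scaletA divff ?gt_eqF// scalet1.
Qed.

Let measurable_cone E : measurable E -> measurable (cone E).
Proof.
move=> mE; rewrite coneE; apply: measurableI.
  by rewrite -[X in measurable X]setTI; exact: measurable_normalize.
rewrite (_ : punctured_ball = @enorm R n @^-1` `]0%R, 1%R]).
  by rewrite -[X in measurable X]setTI; exact: measurable_enorm.
by apply/seteqP; split => x /=; rewrite in_itv.
Qed.

Let surface_measure0 : surface_measure set0 = 0.
Proof. by rewrite /surface_measure coneE preimage_set0 set0I measure0 mule0. Qed.

Let surface_measure_ge0 E : 0 <= surface_measure E.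
Proof. by rewrite mule_ge0// lee_fin. Qed.

Let surface_measure_sigma_additive : semi_sigma_additive surface_measure.
Proof.
move=> F mF tF mUF; rewrite /surface_measure.
under eq_fun do rewrite -ge0_sume_distrr//.
apply: cvgeZl => //.
rewrite coneE preimage_bigcup setI_bigcupl.
under eq_bigcupr do rewrite -coneE.
apply: measure_semi_sigma_additive.
- by move=> i; exact: measurable_cone.
- apply/trivIsetP => /= i j _ _ ij.
  rewrite !coneE setIACA setIid -preimage_setI.
  by move/trivIsetP : tF => /(_ _ _ _ _ ij) ->//; rewrite preimage_set0 set0I.
- by apply: bigcup_measurable => i _; exact: measurable_cone.
Qed.

HB.instance Definition _ := isMeasure.Build _ _ _ surface_measure
  surface_measure0 surface_measure_ge0 surface_measure_sigma_additive.

End surface_measure.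

Section special_functions.
Context {R : realType}.

(* Gamma is only used at s >= 1, where the integral converges. *)
Definition Gamma (s : R) : R :=
  \int[@lebesgue_measure R]_(t in `]0%R, +oo[) (t `^ (s - 1) * expR (- t)).

Definition besselI (nu x : R) : R :=
  limn (series (fun m : nat =>
    (x / 2) `^ (nu + (2 * m)%:R) / (m`!%:R * Gamma (nu + m%:R + 1)))).

Definition bessel_ratio (n : nat) (kappa : R) : R :=
  besselI (n%:R / 2) kappa / besselI (n%:R / 2 - 1) kappa.

End special_functions.

Section power_series.
Context {R : realType}.

Definition cauchy_prod (u v : R^nat) : R^nat :=
  fun k => \sum_(i < k.+1) u i * v (k - i)%N.

Definition cauchy_exp (u : R^nat) (m : nat) : R^nat :=
  iter m (cauchy_prod u) (fun k => (k == 0%N)%:R).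

Definition convergence_radius (u : R^nat) : \bar R :=
  ereal_sup [set `|x|%:E | x in [set x : R | cvgn (pseries u x)]].

End power_series.

Section course_of_values.
Context {R : realType} (F : nat -> R^nat -> R).

Fixpoint cov_values (m : nat) : seq R :=
  if m is m'.+1 then rcons (cov_values m') (F m' (nth 0 (cov_values m')))
  else [::].

(* The sequence u with u k = F k u, when F k u only depends on u 0, ...,
   u (k - 1). *)
Definition cov_rec : R^nat := fun k => (cov_values k.+1)`_k.

Lemma size_cov_values m : size (cov_values m) = m.
Proof. by elim: m => //= m IHm; rewrite size_rcons IHm. Qed.

Lemma nth_cov_values m k : (k < m)%N -> (cov_values m)`_k = cov_rec k.
Proof.
elim: m => // m IHm; rewrite ltnS leq_eqVlt => /predU1P[->//|km].
by rewrite /= nth_rcons size_cov_values km IHm.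
Qed.

Lemma cov_recE : (forall k (u v : R^nat),
    (forall i, (i < k)%N -> u i = v i) -> F k u = F k v) ->
  forall k, cov_rec k = F k cov_rec.
Proof.
move=> FE k; rewrite {1}/cov_rec /= nth_rcons size_cov_values ltnn eqxx.
by apply: FE => i ik; rewrite nth_cov_values.
Qed.

End course_of_values.

Section coefficients.
Context (R : realType) (n : nat).

Definition acoef : R^nat := cov_rec (fun j a =>
  if j is 0%N then n%:R^-1
  else - 1 / (n + 2 * j)%:R * \sum_(0 <= k < j) a k * a (j - 1 - k)%N).

Lemma acoef0 : acoef 0 = n%:R^-1. Proof. by []. Qed.

Lemma acoefE j : (1 <= j)%N ->
  acoef j =
  - 1 / (n + 2 * j)%:R * \sum_(0 <= k < j) acoef k * acoef (j - 1 - k)%N.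
Proof.
case: j => // j _; rewrite /acoef cov_recE // => -[//|k] u v uv.
congr (_ * _); apply: eq_big_nat => i /andP[_ ik]; rewrite !uv//.
by rewrite subn1 /= ltnS leq_subr.
Qed.

(* Coefficients of the power series \sum_j acoef j * kappa^(2j+1) of
   [bessel_ratio n] at 0. *)
Definition ratio_series : R^nat := fun k => if odd k then acoef k./2 else 0.

Definition ratio_radius : \bar R := convergence_radius ratio_series.

Definition b1 : R := acoef 0 ^+ 2.

(* The value at l = 0 is a dummy. *)
Definition ccoef : R^nat := cov_rec (fun l c =>
  if l is 0%N then 0
  else if l is 1%N then b1^-1
  else - (b1 ^+ l)^-1 *
       \sum_(1 <= j < l) c j * cauchy_exp ratio_series (2 * j) (2 * l)).

Lemma ccoef1 : ccoef 1 = b1^-1. Proof. by []. Qed.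

Lemma ccoefE l : (2 <= l)%N ->
  ccoef l = - (b1 ^+ l)^-1 *
    \sum_(1 <= j < l) ccoef j * cauchy_exp ratio_series (2 * j) (2 * l).
Proof.
case: l => [|[|l]] // _; rewrite /ccoef cov_recE // => -[|[|k]] // u v uv.
by congr (_ * _); apply: eq_big_nat => i /andP[_ ik]; rewrite uv.
Qed.

Definition zeta (M : nat) (kappa : R) : R :=
  \sum_(1 <= l < M.+1) ccoef l * bessel_ratio n kappa ^+ (2 * l).

End coefficients.

Section estimator.
Context {R : realType} (n N : nat).

Lemma pair_fst_subproof l (k : 'I_l) : (2 * k < 2 * l)%N.
Proof. by rewrite ltn_pmul2l. Qed.

Lemma pair_snd_subproof l (k : 'I_l) : ((2 * k).+1 < 2 * l)%N.
Proof. by rewrite (@leq_trans (2 * k.+1)) ?leq_pmul2l// mulnS. Qed.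

Definition pair_fst l (k : 'I_l) : 'I_(2 * l) := Ordinal (pair_fst_subproof k).
Definition pair_snd l (k : 'I_l) : 'I_(2 * l) := Ordinal (pair_snd_subproof k).

Definition Dstat (l : nat) (x : 'I_N -> n.-tuple R) : R :=
  \sum_(i : (2 * l).-tuple 'I_N | uniq i)
    \prod_(k < l) dotp (x (tnth i (pair_fst k))) (x (tnth i (pair_snd k))).

Definition zeta_hat (M : nat) (x : 'I_N -> n.-tuple R) : R :=
  \sum_(1 <= l < M.+1) ccoef R n l * Dstat l x / (N ^_ (2 * l))%:R.

End estimator.

Section fvml.
Context {R : realType} (n : nat).
Local Open Scope ereal_scope.

Definition fvml_const (kappa : R) : R :=
  (kappa `^ (n%:R / 2 - 1) /
    ((2 * pi) `^ (n%:R / 2) * besselI (n%:R / 2 - 1) kappa))%R.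

Definition fvml_density (mu : n.-tuple R) (kappa : R) (x : n.-tuple R) : R :=
  (fvml_const kappa * expR (kappa * dotp mu x))%R.

Definition fvml (mu : n.-tuple R) (kappa : R) (E : set (n.-tuple R)) : \bar R :=
  \int[@surface_measure R n]_(x in E) (fvml_density mu kappa x)%:E.

End fvml.

Section iid.
Context d (T : measurableType d) {R : realType} (P : probability T R).
Context (n N : nat).
Local Open Scope ereal_scope.

Definition mutually_independent (X : 'I_N -> {RV P >-> n.-tuple R}) : Prop :=
  forall (J : {set 'I_N}) (E : 'I_N -> set (n.-tuple R)),
    (forall i, measurable (E i)) ->
    P (\bigcap_(i in [set` J]) (X i @^-1` E i)) =
    \prod_(i in J) P (X i @^-1` E i).

Definition iid_fvml (X : 'I_N -> {RV P >-> n.-tuple R})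
    (mu : n.-tuple R) (kappa : R) : Prop :=
  mutually_independent X /\
  forall i E, measurable E -> distribution P (X i) E = fvml mu kappa E.

End iid.

(* Main.v *)
From HB Require Import structures.
Require Import Defs.
From mathcomp Require Import all_boot all_order all_algebra.
From mathcomp Require Import all_classical all_reals all_analysis.
From mathcomp Require Import measurable_realfun ring lra zify.
Set Implicit Arguments.
Unset Strict Implicit.
Unset Printing Implicit Defensive.
Import Order.TTheory GRing.Theory Num.Theory.
Import numFieldNormedType.Exports.
Local Open Scope classical_set_scope.
Local Open Scope ring_scope.

(* Unbiasedness. On the sphere [int (t . x)^(2m) = moment m * |t|^(2m)], where
   [(n + 2m) moment (m+1) = (2m+1) moment m]: this follows from the Gaussian
   integral in polar coordinates. Polarizing and expanding the exponential gives
   [E[nu . X] = (nu . mu) A_n(kappa)], both sides being the same Bessel series.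
   By independence each product of [l] scalar products over distinct indices then
   has mean [A_n(kappa)^(2l)].

   Inversion. Write [A_n(kappa) = kappa y(t)] with [t = kappa^2]. The recursion of
   the [a_j] says that [y] solves a Riccati equation; so does [v = 1 / y], and both
   have coefficients bounded by 1 (up to [v 0 = n]). The [c_l] are the coefficients
   of the compositional inverse of [S = t y^2], hence
   [l c_l = [t^(l-1)] v^(2l)] by Lagrange inversion, and [c_l] grows at most
   geometrically. The truncation error [sum_(l <= L) c_l S^l - t] has no terms of
   degree at most [L] and a weighted l^1 norm which is geometric in [L], so it
   vanishes in the limit for small [t]. Finally the Bessel quotient coincides with
   [kappa y(kappa^2)] because the Bessel series [B] satisfies [2 B' = y B]. *)

(** * Integration and independence *)

(** The surface measure is given only through cones, so all that is known of it comes from Tonelli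
    and the scaling of Lebesgue measure. The Gaussian is chosen because its moment generating
    function factors over the coordinates into a function of |t|^2: this supplies the symmetry of
    the sphere moments. Two frictions shape the probabilistic half: independence is stated for
    events, hence the passage through indicators and densities; and each X_i lies on the sphere only
    almost surely, hence a cutoff before scalar products are expanded into coordinates. In the
    inversion no double series is rearranged: the algebra takes place in the ring of formal series,
    and analysis enters only at radius 1/2, where y and v have weighted norm at most 2 and n + 1.
    Evaluating at t a series without terms below degree L gains (2t)^L; the truncation error has
    norm at most 3 (2Q)^L with Q = 2 (n + 1)^2, so its value is at most 3 (4Qt)^L. Hence the radius
    1 / (4Q), imposed on kappa itself because kappa^2 < kappa there. The inverse v is needed because
    Lagrange inversion produces powers of 1 / y, whose coefficients must be bounded. *)

Section density.
Local Open Scope ereal_scope.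
Context d1 d2 (X : measurableType d1) (Y : measurableType d2) (R : realType).
Variables (phi : X -> Y) (mphi : measurable_fun setT phi).
Variables (mu : {measure set X -> \bar R}) (nu : {measure set Y -> \bar R}).
Variables (f : X -> R) (mf : measurable_fun setT f) (c : R).
Hypothesis f0 : forall x, (0 <= f x)%R.
Hypothesis nuE : forall A, measurable A ->
  c%:E * nu A = \int[mu]_(x in phi @^-1` A) (f x)%:E.

Import HBNNSimple.

(** By [nuE], [c] times [nu] is the image under [phi] of the measure with density [f]. The formula
    passes from indicators to simple functions, then to [g] by monotone convergence. It serves for
    scaling, for the surface measure, for the FvML law and for independence. *)
Lemma ge0_integral_density (g : Y -> \bar R) :
  measurable_fun setT g -> (forall y, 0 <= g y) ->
  c%:E * \int[nu]_y g y = \int[mu]_x (g (phi x) * (f x)%:E).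
Proof.
move=> mg g0; have mEf : measurable_fun setT (EFin \o f) by exact/measurable_EFinP.
pose g_ := nnsfun_approx measurableT mg.
have mpre A : measurable A -> measurable (phi @^-1` A).
  by move=> mA; rewrite -[X in measurable X]setTI; exact: mphi.
have g_cvg y : (g_ n y)%:E @[n --> \oo] --> g y.
  by apply: cvg_nnsfun_approx => // ? _; exact: g0.
have mgphi n : measurable_fun setT (fun x => (g_ n (phi x))%:E).
  exact/measurable_EFinP/measurableT_comp.
have simple n : c%:E * \int[nu]_y (g_ n y)%:E =
    \int[mu]_x ((g_ n (phi x))%:E * (f x)%:E).
  under eq_integral do rewrite fimfunE -fsumEFin//.
  rewrite ge0_integral_fsum//; last 2 first.
    by move=> r; exact/measurable_EFinP/measurable_funM.
    by move=> r y _; rewrite nnfun_muleindic_ge0.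
  rewrite ge0_mule_fsumr; last by move=> r; apply: integral_ge0 => y _;
    exact: nnfun_muleindic_ge0.
  transitivity (\int[mu]_x (\sum_(r \in range (g_ n))
      ((r * \1_(g_ n @^-1` [set r]) (phi x))%:E * (f x)%:E))); last first.
    apply: eq_integral => x _; rewrite fimfunE -fsumEFin// ge0_mule_fsuml//.
    by move=> r; rewrite nnfun_muleindic_ge0.
  rewrite ge0_integral_fsum//; last 2 first.
    move=> r; apply: emeasurable_funM => //.
    apply/measurable_EFinP/measurable_funM => //.
    exact: measurableT_comp.
    by move=> r x _; rewrite mule_ge0 ?lee_fin//; exact: nnfun_muleindic_ge0.
  apply: eq_fsbigr => r /set_mem rr.
  have r0 : (0 <= r)%R by case: rr => y _ <-.
  rewrite integralZl_indic_nnsfun// integral_indic// setIT.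
  rewrite muleCA nuE//.
  under [RHS]eq_integral do rewrite EFinM -muleA.
  rewrite ge0_integralZl//; first last.
  - by move=> x _; rewrite mule_ge0// lee_fin.
  - apply: emeasurable_funM => //; apply/measurable_EFinP.
    exact: measurableT_comp.
  congr (_ * _); rewrite integral_mkcond; apply: eq_integral => x _.
  rewrite patchE indicE /=.
  have -> : (x \in phi @^-1` (g_ n @^-1` [set r])) = (phi x \in g_ n @^-1` [set r]).
    by apply/idP/idP; rewrite !inE.
  by case: ifPn; rewrite ?mul1e ?mul0e.
have nd n m : (n <= m)%N -> forall y, (g_ n y <= g_ m y)%R.
  by move=> nm; exact/lefP/nd_nnsfun_approx.
transitivity (c%:E * limn (fun n => \int[nu]_y (g_ n y)%:E)).
  rewrite -monotone_convergence//.
  - congr (_ * _); apply: eq_integral => y _; apply/esym/cvg_lim => //.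
  - by move=> n; exact/measurable_EFinP.
  - by move=> n y _; rewrite lee_fin.
  - by move=> y _ m n mn; rewrite lee_fin; exact: nd.
transitivity (limn (fun n => \int[mu]_x ((g_ n (phi x))%:E * (f x)%:E))).
  rewrite -limeMl//; first by under eq_fun do rewrite simple.
  apply: ereal_nondecreasing_is_cvgn => a b ab.
  apply: ge0_le_integral => //.
  - by move=> y _; rewrite lee_fin.
  - by apply/measurable_EFinP.
  - by apply/measurable_EFinP.
  - by move=> y _; rewrite lee_fin; exact: nd.
rewrite -monotone_convergence//.
- apply: eq_integral => x _; apply/cvg_lim => //.
  apply: cvgeMr => //.
- by move=> n; exact: emeasurable_funM.
- by move=> n x _; rewrite mule_ge0// lee_fin.
- by move=> x _ m n mn; rewrite lee_wpmul2r ?lee_fin//; exact: nd.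
Qed.

End density.

Lemma Rintegral_sum d (T : measurableType d) (R : realType)
    (mu : {measure set T -> \bar R}) (D : set T) (I : Type) (s : seq I)
    (F : I -> T -> R) : measurable D ->
  (forall i, mu.-integrable D (EFin \o F i)) ->
  \int[mu]_(x in D) (\sum_(i <- s) F i x) =
  \sum_(i <- s) \int[mu]_(x in D) F i x.
Proof.
move=> mD iF; rewrite /Rintegral.
under eq_integral do rewrite -sumEFin.
by rewrite integral_sum //= -sum_fine// => i _; apply: integrable_fin_num (iF i).
Qed.

(** * Expectation of a product of independent factors *)

Section independence.
Context d (T : measurableType d) {R : realType} (P : probability T R).
Context (n N : nat) (X : 'I_N -> {RV P >-> n.-tuple R}).
Hypothesis indX : mutually_independent X.

Lemma bounded_RV_integrable (f : T -> R) (C : R) :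
  measurable_fun setT f -> (forall w, `|f w| <= C) ->
  P.-integrable setT (EFin \o f).
Proof.
move=> mf fC; apply: measurable_bounded_integrable => //.
  by rewrite -ge0_fin_numE// fin_num_measure.
exists C; split; first exact: num_real.
by move=> M CM x _ /=; exact: (le_trans (fC x) (ltW CM)).
Qed.

(** [s] lists the indices whose factor may fail to be an indicator. For empty [s] the claim is the
    independence of events; the induction frees one factor at a time. *)
Lemma ge0_indep_prod_seq (s : seq 'I_N) (G : 'I_N -> n.-tuple R -> R) :
  (forall i, measurable_fun setT (G i)) ->
  (forall i x, 0 <= G i x) -> (forall i, exists C, forall x, G i x <= C) ->
  (forall i, i \notin s -> exists2 E, measurable E & G i = \1_E) ->
  (\int[P]_w (\prod_i G i (X i w))%:E = \prod_i \int[P]_w (G i (X i w))%:E)%E.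
Proof.
elim: s G => [|j s IH] G mG G0 Gb Gs.
  have /choice[E HE] : forall i, exists E, measurable E /\ G i = \1_E.
    by move=> i; have [//|E ? ?] := Gs i; exists E.
  have mE i : measurable (E i) by have [] := HE i.
  have GE i : G i = \1_(E i) by have [] := HE i.
  have mXE i : measurable (X i @^-1` E i).
    by rewrite -[Y in measurable Y]setTI; exact: measurable_funPT.
  have PE : P (\bigcap_(i in [set` [set: 'I_N]%SET]) (X i @^-1` E i)) =
      (\prod_i P (X i @^-1` E i))%E.
    by rewrite (indX [set: 'I_N]%SET mE); apply: eq_bigl => i; rewrite inE.
  transitivity (P (\bigcap_(i in [set` [set: 'I_N]%SET]) (X i @^-1` E i))).
    rewrite -[in RHS](setIT (\bigcap_(i in _) _)) -integral_indic//; last first.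
      by apply: fin_bigcap_measurable => //; exact: finite_finset.
    apply: eq_integral => w _; congr EFin.
    have [h|] := pselect (forall i, E i (X i w)).
      rewrite indicE mem_set; last by move=> i _; exact: h.
      by apply: big1 => i _; rewrite GE indicE mem_set.
    move=> /existsNP[i iE]; rewrite indicE memNset; last first.
      by move=> /(_ i); rewrite /= inE => /(_ isT).
    by rewrite (bigD1 i)//= GE indicE memNset// mul0r.
  rewrite PE; apply: eq_bigr => i _.
  by rewrite GE -[in LHS](setIT (X i @^-1` E i)); apply/esym; exact: (integral_indic P measurableT (mXE i)).
(* The other factors act as a density on [T], with total mass [c] once the induction hypothesis is
   applied. *)
pose f w := \prod_(i | i != j) G i (X i w).
have f0 w : 0 <= f w by apply: prodr_ge0.
have mf : measurable_fun setT f.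
  rewrite /f; under eq_fun do rewrite -big_filter.
  apply: measurable_prod => i _; apply: measurableT_comp => //.
have Efin i : (\int[P]_w (G i (X i w))%:E \is a fin_num)%E.
  apply: integrable_fin_num => //; have [C GC] := Gb i.
  apply: (@bounded_RV_integrable _ C); first exact: measurableT_comp.
  by move=> w; rewrite ger0_norm.
pose c := \prod_(i | i != j) fine (\int[P]_w (G i (X i w))%:E)%E.
have cE : c%:E = (\prod_(i | i != j) \int[P]_w (G i (X i w))%:E)%E.
  by rewrite -prodEFin; apply: eq_bigr => i _; rewrite fineK.
(* The induction hypothesis with [G j] replaced by the indicator of [A]: this is the hypothesis
   [nuE] of [ge0_integral_density] for [phi = X j]. *)
have step A : measurable A ->
    (c%:E * distribution P (X j) A = \int[P]_(w in X j @^-1` A) (f w)%:E)%E.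
  move=> mA; pose G' i := if i == j then \1_A else G i.
  have := IH G'; rewrite /G' => IHG'.
  have G'j i : i != j -> (if i == j then \1_A else G i) = G i.
    by move=> /negbTE ->.
  transitivity (\int[P]_w (\prod_i (if i == j then \1_A else G i) (X i w))%:E)%E.
    rewrite IHG'.
    - rewrite (bigD1 j)//= eqxx muleC; congr (_ * _)%E; last first.
        by rewrite cE; apply: eq_bigr => i /G'j ->.
      rewrite /distribution /pushforward.
      rewrite -[in LHS](setIT (X j @^-1` A)); apply/esym.
      apply: (integral_indic P measurableT (A:=X j @^-1` A)).
      by rewrite -[Y in measurable Y]setTI; exact: measurable_funPT.
    - by move=> i; case: eqP => // _; exact: measurable_indic.
    - by move=> i x; case: eqP => // _.
    - move=> i; case: eqP => // _; exists 1 => x.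
      by rewrite indicE lern1 leq_b1.
    - move=> i si; have [ij|ij] := eqVneq i j; first by exists A.
      by apply: Gs; rewrite inE negb_or ij.
  rewrite [RHS]integral_mkcond; apply: eq_integral => w _.
  rewrite patchE (bigD1 j)//= eqxx indicE.
  have -> : \prod_(i | i != j) (if i == j then \1_A else G i) (X i w) = f w.
    by apply: eq_bigr => i /G'j ->.
  have -> : (w \in X j @^-1` A) = (X j w \in A) by apply/idP/idP; rewrite !inE.
  by case: ifPn; rewrite ?mul1r ?mul0r.
have mXj : measurable_fun setT (X j) by [].
rewrite [RHS](bigD1 j)//= -cE.
transitivity (c%:E * \int[distribution P (X j)]_x (G j x)%:E)%E.
  rewrite (ge0_integral_density mXj mf f0 step).
  - by apply: eq_integral => w _; rewrite (bigD1 j)//= EFinM.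
  - exact/measurable_EFinP.
  - by move=> y; rewrite lee_fin.
rewrite muleC ge0_integral_distribution//.
- exact/measurable_EFinP.
- by move=> y; rewrite lee_fin.
Qed.

(** Signed factors are reduced to nonnegative ones by writing each as [(G i + C) - C] and expanding
    the product over the subsets [J] of indices at which [G i + C] is chosen. *)
Lemma indep_prod (G : 'I_N -> n.-tuple R -> R) (C : R) :
  (forall i, measurable_fun setT (G i)) ->
  (forall i x, `|G i x| <= C) ->
  \int[P]_w (\prod_i G i (X i w)) = \prod_i \int[P]_w G i (X i w).
Proof.
move=> mG GC.
have mGX i : measurable_fun setT (fun w => G i (X i w)).
  exact: measurableT_comp.
pose H (J : {set 'I_N}) i x := if i \in J then G i x + C else 1.
have H0 J i x : 0 <= H J i x.
  rewrite /H; case: ifP => // _; move: (GC i x); rewrite ler_norml => /andP[+ _].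
  by rewrite -subr_ge0 opprK addrC.
have HC J i x : H J i x <= Num.max 1 (C + C).
  rewrite /H le_max; case: ifP => _; last by rewrite lexx.
  by rewrite lerD2r (le_trans (ler_norm _) (GC i x)) orbT.
have mH J i : measurable_fun setT (H J i).
  rewrite /H; case: (i \in J) => //; exact: measurable_funD.
have mHX J : measurable_fun setT (fun w => \prod_i H J i (X i w)).
  by apply: measurable_prod => i _; exact: measurableT_comp.
have HJ (J : {set 'I_N}) :
    \int[P]_w (\prod_i H J i (X i w)) = \prod_i \int[P]_w H J i (X i w).
  rewrite /Rintegral (@ge0_indep_prod_seq (enum 'I_N))//.
  - transitivity (fine (\prod_i (\int[P]_w H J i (X i w))%:E)%E).
      congr fine; apply: eq_bigr => i _; rewrite /Rintegral fineK//.
      apply: integrable_fin_num => //.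
      apply: (@bounded_RV_integrable _ (Num.max 1 (C + C))).
        exact: measurableT_comp.
      by move=> w; rewrite ger0_norm.
    by rewrite prodEFin.
  - by move=> i; exists (Num.max 1 (C + C)).
  - by move=> i; rewrite mem_enum.
pose K (J : {set 'I_N}) := \prod_(i < N) (if i \in J then 1 else - C).
have KH (J : {set 'I_N}) (u : 'I_N -> R) :
    \prod_i (if i \in J then u i + C else - C) =
    K J * \prod_i (if i \in J then u i + C else 1).
  rewrite -big_split; apply: eq_bigr => i _ /=.
  by case: ifP => _; rewrite ?mul1r ?mulr1.
have expand (u : 'I_N -> R) : \prod_i u i =
    \sum_(J : {set 'I_N}) K J * \prod_i (if i \in J then u i + C else 1).
  transitivity (\prod_i ((u i + C) + - C)).
    by apply: eq_bigr => i _; ring.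
  by rewrite bigA_distr; apply: eq_bigr => J _; rewrite KH.
have bHX J w : `|\prod_i H J i (X i w)| <= Num.max 1 (C + C) ^+ N.
  rewrite ger0_norm; last exact: prodr_ge0.
  rewrite -[X in _ ^+ X]card_ord -prodr_const.
  by apply: ler_prod => i _; rewrite H0 HC.
transitivity (\int[P]_w \sum_(J : {set 'I_N}) K J * \prod_i H J i (X i w)).
  by congr fine; apply: eq_integral => w _; rewrite expand.
rewrite Rintegral_sum//; last first.
  move=> J; apply: (@bounded_RV_integrable _ (`|K J| * Num.max 1 (C + C) ^+ N)).
    exact: measurable_funM.
  by move=> w; rewrite normrM ler_wpM2l.
rewrite expand; apply: eq_bigr => J _.
rewrite RintegralZl//; last exact: (bounded_RV_integrable (mHX J) (bHX J)).
rewrite HJ; congr (_ * _); apply: eq_bigr => i _.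
have [iJ|iJ] := boolP (i \in J).
  under eq_Rintegral do rewrite /H iJ.
  rewrite RintegralD//; last 2 first.
    exact: (bounded_RV_integrable (mGX i) (fun w => GC i (X i w))).
    exact: (@bounded_RV_integrable _ `|C|).
  by rewrite Rintegral_cst// [X in fine X](@probability_setT _ _ _ P) /= mulr1.
under eq_Rintegral do rewrite /H (negbTE iJ).
by rewrite Rintegral_cst// [X in fine X](@probability_setT _ _ _ P) /= mulr1.
Qed.

End independence.

(** * Gamma and chi integrals *)

Section half_line.
Context {R : realType}.
Local Notation lambda := (@lebesgue_measure R).

(** The shift by 2 keeps the left end strictly below the right one for every [k]. *)
Let itvn (k : nat) : set R := `[(k.+2)%:R^-1, (k.+2)%:R].

Let itvn_bigcup : \bigcup_k itvn k = `]0%R, +oo[%classic.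
Proof.
apply/seteqP; split => [x [k _]|x].
  by rewrite /itvn /= !in_itv /= andbT => /andP[+ _]; apply: lt_le_trans.
rewrite /= in_itv/= andbT => x0.
have y0 : 0 <= x + x^-1 by rewrite addr_ge0// ?invr_ge0 ltW.
exists (Num.truncn (x + x^-1)) => //; rewrite /itvn /= in_itv/=.
have := truncnS_gt (x + x^-1); set m := Num.truncn _ => xm.
have xm' : x + x^-1 <= (m.+2)%:R.
  by rewrite (le_trans (ltW xm))// ler_nat.
apply/andP; split.
  rewrite -[leRHS]invrK lef_pV2 ?posrE ?invr_gt0//.
  by rewrite (le_trans _ xm')// lerDr ltW.
by rewrite (le_trans _ xm')// lerDl invr_ge0 ltW.
Qed.

(** On each compact [itvn k] the two integrals differ by a boundary term of [F], which tends to
    [l - l]. The equality is in the extended reals, so it can be used before finiteness is known. *)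
Lemma integral_parts_oy (f g F : R -> R) (l : R) :
  {in `]0, +oo[, continuous f} -> {in `]0, +oo[, continuous g} ->
  (forall x, 0 < x -> 0 <= f x) -> (forall x, 0 < x -> 0 <= g x) ->
  (forall x : R, 0 < x -> is_derive x 1 F (f x - g x)) ->
  F x @[x --> (0:R)^'+] --> l -> F x @[x --> +oo%R] --> l ->
  (\int[lambda]_(x in `]0%R, +oo[) (f x)%:E =
   \int[lambda]_(x in `]0%R, +oo[) (g x)%:E)%E.
Proof.
move=> cf cg f0 g0 dF F0 Foo.
have itv_gt0 k x : itvn k x -> 0 < x.
  by rewrite /itvn /= in_itv/= => /andP[+ _]; apply: lt_le_trans.
have ltk k : (k.+2)%:R^-1 < (k.+2)%:R :> R.
  by rewrite (@lt_trans _ _ 1)// ?invf_lt1// ltr1n.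
have nd : {homo itvn : n m / (n <= m)%N >-> (n <= m)%O}.
  move=> n m nm; apply/subsetPset => x; rewrite /itvn /= !in_itv/=.
  move=> /andP[nx xn]; rewrite (le_trans _ nx) ?(le_trans xn) ?ler_nat//.
  by rewrite lef_pV2 ?posrE// ler_nat.
have cont (h : R -> R) : {in `]0, +oo[, continuous h} ->
    forall k, {within itvn k, continuous h}.
  move=> ch k; apply: continuous_in_subspaceT => x; rewrite inE => /itv_gt0 x0.
  by apply: ch; rewrite in_itv/= x0.
have int (h : R -> R) : {in `]0, +oo[, continuous h} ->
    forall k, lambda.-integrable (itvn k) (EFin \o h).
  move=> ch k; apply: continuous_compact_integrable; last exact: cont.
  exact: segment_compact.
have lim (h : R -> R) : {in `]0, +oo[, continuous h} ->
    (forall x, 0 < x -> 0 <= h x) ->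
    (\int[lambda]_(x in itvn k) (h x)%:E @[k --> \oo] -->
     \int[lambda]_(x in `]0%R, +oo[) (h x)%:E)%E.
  move=> ch h0; rewrite -itvn_bigcup.
  apply: ge0_nondecreasing_set_cvg_integral => //.
  - by move=> k; exact: measurable_itv.
  - by move=> k; exact: (measurable_int lambda (int _ ch k)).
  - by move=> k x /itv_gt0 x0; rewrite lee_fin h0.
have Fk k : (\int[lambda]_(x in itvn k) (f x)%:E =
    \int[lambda]_(x in itvn k) (g x)%:E +
    (F (k.+2)%:R - F (k.+2)%:R^-1)%:E)%E.
  have cfg : {within itvn k, continuous (fun x => f x - g x)}.
    apply: cont => x x0; apply: cvgB; [exact: cf|exact: cg].
  have derF x : 0 < x -> derivable F x 1 by move=> /dF [].
  have contF x : 0 < x -> {for x, continuous F}.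
    by move=> /derF ?; apply: differentiable_continuous; exact/derivable1_diffP.
  have := @continuous_FTC2 R _ F _ _ (ltk k) cfg.
  rewrite EFinB => <-.
  - rewrite integralB_EFin//; [|exact: int..].
    rewrite addeC subeK//.
    by apply: integrable_fin_num => //; exact: int.
  - split.
    + move=> x; rewrite in_itv/= => /andP[x0 _]; apply: derF.
      by rewrite (lt_trans _ x0).
    + by apply: cvg_at_right_filter; apply: contF.
    + by apply: cvg_at_left_filter; apply: contF.
  - move=> x; rewrite in_itv/= => /andP[x0 _]; rewrite derive1E.
    have x0' : 0 < x by rewrite (lt_trans _ x0).
    by have [_ ->] := dF _ x0'.
have limF : (F (k.+2)%:R - F (k.+2)%:R^-1) @[k --> \oo] --> (0 : R).
  rewrite -(subrr l); apply: cvgB.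
  - apply: (cvg_comp _ _ _ Foo).
    apply/cvgryPge => r; near=> k; rewrite (@le_trans _ _ k%:R) ?ler_nat ?leqW//.
    by near: k; exact: nbhs_infty_ger.
  - move/cvg_at_rightP : F0; apply; split => //.
    apply/cvgrPdist_le => e e0; near=> k.
    rewrite sub0r normrN ger0_norm//.
    rewrite -[leRHS]invrK lef_pV2 ?posrE ?invr_gt0//.
    rewrite (@le_trans _ _ k%:R) ?ler_nat ?leqW//.
    by near: k; exact: nbhs_infty_ger.
have := lim _ cg g0; have := lim _ cf f0.
under eq_cvg do rewrite Fk.
move=> limf limg; rewrite -(cvg_lim _ limf)//; apply/cvg_lim => //.
rewrite -[X in _ --> X]adde0; apply: cvgeD => //.
  by rewrite fin_num_adde_defl.
by apply: cvg_EFin => //; exact: nearW.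
Unshelve. all: by end_near. Qed.

(** The exponential dominates its Taylor term of degree [k.+1], which leaves a factor of order 1 /
    x. *)
Lemma cvg_exprn_expRN (k : nat) : x ^+ k * expR (- x) @[x --> +oo%R] --> (0 : R).
Proof.
apply/cvgrPdist_le => e e0; near=> x.
have x0 : 0 < x by near: x; exact: nbhs_pinfty_gt.
rewrite sub0r normrN ger0_norm; last by rewrite mulr_ge0 ?exprn_ge0 ?expR_ge0// ltW.
have := @expR_ge1Dxn R x k (ltW x0).
rewrite expRN ler_pdivrMr ?expR_gt0// => h.
apply: (@le_trans _ _ (e * (x ^+ k.+1 / k.+1`!%:R))); last first.
  by rewrite ler_pM2l// (le_trans _ h)// lerDr.
have -> : e * (x ^+ k.+1 / k.+1`!%:R) = x ^+ k * (x * (e / k.+1`!%:R)).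
  by rewrite exprS; ring.
rewrite ler_peMr ?exprn_ge0 ?(ltW x0)// -ler_pdivrMr; last first.
  by rewrite divr_gt0// ltr0n fact_gt0.
by near: x; apply: nbhs_pinfty_ge; exact: num_real.
Unshelve. all: end_near. Qed.

Lemma cvg_powR_expRN (s : R) : t `^ s * expR (- t) @[t --> +oo%R] --> (0 : R).
Proof.
apply: (squeeze_cvgr _ (@cvg_cst _ _ _ _ _) (cvg_exprn_expRN (Num.truncn `|s|).+1)).
near=> t; have t1 : 1 <= t by near: t; exact: nbhs_pinfty_ge.
rewrite mulr_ge0 ?powR_ge0 ?expR_ge0//= ler_wpM2r ?expR_ge0//.
rewrite -powR_mulrn ?(le_trans ler01)// ler_powR//.
by rewrite (le_trans (ler_norm s))// ltW// truncnS_gt.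
Unshelve. all: end_near. Qed.

(** The integrand of [Gamma (s + 1)], indexed so that differentiation lowers [s] by one. *)
Definition gamma_fun (s t : R) : R := t `^ s * expR (- t).

Lemma is_derive_gamma_fun (s t : R) : 0 < t ->
  is_derive t 1 (gamma_fun s) (s * gamma_fun (s - 1) t - gamma_fun s t).
Proof.
move=> t0.
have h1 := is_derive1_powR s t0.
have h2 : is_derive t 1 (fun u : R => expR (- u)) (- expR (- t)).
  have := @is_derive1_comp R expR -%R t _ _ (is_derive_expR _) (is_deriveNid _ _).
  by rewrite mulrN1.
have h := is_deriveM h1 h2; apply: (is_derive_eq h).
by rewrite /gamma_fun /GRing.scale /=; ring.
Qed.

Lemma gamma_fun_ge0 s t : 0 <= gamma_fun s t.
Proof. by rewrite mulr_ge0 ?powR_ge0 ?expR_ge0. Qed.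

Lemma continuous_gamma_fun s : {in `]0, +oo[, continuous (gamma_fun s)}.
Proof.
move=> t; rewrite in_itv/= andbT => t0.
by apply: differentiable_continuous; apply/derivable1_diffP; case: (is_derive_gamma_fun s t0).
Qed.

Lemma measurable_gamma_fun s : measurable_fun setT (gamma_fun s).
Proof.
apply: measurable_funM; first exact: measurable_powR.
by apply: measurableT_comp => //; exact: measurableT_comp.
Qed.

Lemma integral_gamma_funS (s : R) : 0 < s ->
  (\int[lambda]_(t in `]0%R, +oo[) (gamma_fun s t)%:E =
   s%:E * \int[lambda]_(t in `]0%R, +oo[) (gamma_fun (s - 1) t)%:E)%E.
Proof.
move=> s0; apply/esym; rewrite -ge0_integralZl//; last 3 first.
- by apply/measurable_EFinP/measurable_funTS; exact: measurable_gamma_fun.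
- by move=> t _; rewrite lee_fin gamma_fun_ge0.
- by rewrite lee_fin ltW.
apply: (@integral_parts_oy (fun t => s * gamma_fun (s - 1) t) _ (gamma_fun s) 0).
- move=> t t0; apply: cvgMr; exact: continuous_gamma_fun.
- exact: continuous_gamma_fun.
- by move=> t _; rewrite mulr_ge0 ?gamma_fun_ge0// ltW.
- by move=> t _; rewrite gamma_fun_ge0.
- by move=> t t0; exact: is_derive_gamma_fun.
- rewrite -[X in _ --> X](mul0r (expR (- 0))); apply: cvgM; first exact: powR_cvg0.
  apply: cvg_at_right_filter; apply: continuous_comp; first exact: opp_continuous.
  exact: continuous_expR.
- exact: cvg_powR_expRN.
Qed.

Lemma integral_gamma_fun0 :
  (\int[lambda]_(t in `]0%R, +oo[) (gamma_fun 0 t)%:E = 1)%E.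
Proof.
have g0E : gamma_fun 0 = fun t => expR (- t).
  by apply/funext => t; rewrite /gamma_fun powRr0 mul1r.
have cexp : continuous (fun t : R => expR (- t)).
  move=> t; apply: continuous_comp; first exact: opp_continuous.
  exact: continuous_expR.
have dF (x : R) : is_derive x 1 (fun t => - expR (- t)) (expR (- x)).
  rewrite -[X in is_derive _ _ _ X]opprK; apply: is_deriveN.
  have := @is_derive1_comp R expR -%R x _ _ (is_derive_expR _) (is_deriveNid _ _).
  by rewrite mulrN1.
rewrite integral_itv_obnd_cbnd; last first.
  by apply/measurable_EFinP/measurable_funTS; exact: measurable_gamma_fun.
rewrite (@ge0_continuous_FTC2y _ _ (fun t => - expR (- t)) 0 0).
- by rewrite oppr0 expR0 add0e -EFinN opprK.
- by move=> t _; exact: gamma_fun_ge0.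
- by rewrite g0E; apply: continuous_subspaceT; exact: cexp.
- by rewrite -oppr0; apply: cvgN; exact: cvgr_expR.
- by move=> x _; have [] := dF x.
- apply: cvg_at_right_filter; apply: cvgN; exact: cexp.
- by move=> x _; rewrite derive1E g0E; have [_ ->] := dF x.
Qed.

Lemma GammaS (s : R) : 1 <= s -> Gamma (s + 1) = s * Gamma s.
Proof.
move=> s1; have s0 : 0 < s by rewrite (lt_le_trans _ s1).
rewrite /Gamma addrK /Rintegral (integral_gamma_funS s0).
set I := (X in fine (s%:E * X)%E); rewrite -[RHS]/(s * fine I).
(* If the integral is infinite, [fine] sends it to 0 on both sides. *)
case: I => [//||].
- by rewrite mulry gtr0_sg// mul1e mulr0.
- by rewrite mulrNy gtr0_sg// mul1e mulr0.
Qed.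

Lemma integral_gamma_fun_nat (m : nat) :
  (\int[lambda]_(t in `]0%R, +oo[) (gamma_fun m%:R t)%:E < +oo)%E.
Proof.
elim: m => [|m IH]; first by rewrite integral_gamma_fun0 ltry.
rewrite integral_gamma_funS// -natr1 addrK natr1.
by rewrite lte_mul_pinfty// lee_fin.
Qed.

(** [fine] of an infinite integral would be 0, so finiteness must be shown as well as positivity.
    The lower bound comes from the interval [1, 2]; for the upper one, t^(s - 1) is at most 1 for t
    <= 1 and at most t^m beyond, with [m] an integer above [s]. *)
Lemma Gamma_gt0 (s : R) : 1 <= s -> 0 < Gamma s.
Proof.
move=> s1; pose m := (Num.truncn s).+1.
have mE a D : measurable_fun D (fun t => (gamma_fun a t)%:E).
  by apply/measurable_EFinP/measurable_funTS; exact: measurable_gamma_fun.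
apply: fine_gt0; apply/andP; split.
  apply: (@lt_le_trans _ _ (\int[lambda]_(t in `[1%R, 2%R]) cst (expR (- 2))%:E t)%E).
    rewrite [ltRHS](integral_cst lambda)//= lebesgue_measure_itv/= lte_fin ltr1n.
    by rewrite -EFinB -EFinM lte_fin mulr_gt0 ?expR_gt0//; lra.
  apply: (@le_trans _ _ (\int[lambda]_(t in `[1%R, 2%R]) (gamma_fun (s - 1) t)%:E)%E).
    apply: ge0_le_integral => //.
    - by move=> t _; rewrite lee_fin expR_ge0.
    - exact: mE.
    - move=> t /=; rewrite in_itv/= => /andP[t1 t2]; rewrite lee_fin.
      rewrite -[leLHS]mul1r ler_pM ?expR_ge0// ?ler_expR ?lerN2//.
      by rewrite -[leLHS](powRr0 t) ler_powR// subr_ge0.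
  apply: ge0_subset_integral => //.
  - exact: mE.
  - by move=> t _; rewrite lee_fin gamma_fun_ge0.
  - by move=> t /=; rewrite !in_itv/= andbT => /andP[+ _]; apply: lt_le_trans.
apply: (@le_lt_trans _ _ (\int[lambda]_(t in `]0%R, +oo[)
    ((gamma_fun 0 t)%:E + (gamma_fun m%:R t)%:E))%E).
  apply: ge0_le_integral => //.
  - by move=> t _; rewrite lee_fin gamma_fun_ge0.
  - exact: mE.
  - by apply: emeasurable_funD; exact: mE.
  - move=> t /=; rewrite in_itv/= andbT => t0; rewrite -EFinD lee_fin.
    rewrite /gamma_fun -mulrDl ler_wpM2r ?expR_ge0// powRr0.
    have [t1|t1] := leP t 1.
      rewrite (@le_trans _ _ 1) ?lerDl ?powR_ge0//.
      rewrite -[leRHS]/((fun=> 1) (s - 1)) -powR1.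
      by rewrite ge0_ler_powR ?nnegrE ?subr_ge0// ltW.
    rewrite (@le_trans _ _ (t `^ m%:R)) ?lerDr// ler_powR ?(ltW t1)//.
    by rewrite (@le_trans _ _ s) ?gerBl// ltW// truncnS_gt.
rewrite ge0_integralD//; last 4 first.
- by move=> t _; rewrite lee_fin gamma_fun_ge0.
- exact: mE.
- by move=> t _; rewrite lee_fin gamma_fun_ge0.
- exact: mE.
apply: lte_add_pinfty; last exact: integral_gamma_fun_nat.
by rewrite integral_gamma_fun0 ltry.
Qed.

Lemma is_derive_exprn (n : nat) (x : R) :
  is_derive x 1 (fun r : R => r ^+ n) (n%:R * x ^+ n.-1).
Proof.
apply: DeriveDef; first exact: exprn_derivable.
by rewrite exp_derive /GRing.scale /= mulr1.
Qed.

Lemma is_derive_expRNsqr (x : R) :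
  is_derive x 1 (fun r => expR (- r ^+ 2 / 2)) (- x * expR (- x ^+ 2 / 2)).
Proof.
have h : is_derive x 1 (fun r : R => - r ^+ 2 / 2) (- x).
  have := is_deriveZ (- 2^-1) (is_derive_exprn 2 x).
  rewrite (_ : _ \*: _ = (fun r : R => - r ^+ 2 / 2)); last first.
    by apply/funext => r /=; rewrite /GRing.scale /=; field.
  by move=> h; apply: (is_derive_eq h); rewrite /GRing.scale /= expr1; field.
apply: is_derive_eq (is_derive1_comp (is_derive_expR _) h) _.
by rewrite mulrC.
Qed.

Lemma cvg_exprn_expRNsqr (k : nat) :
  r ^+ k * expR (- r ^+ 2 / 2) @[r --> +oo%R] --> (0 : R).
Proof.
apply: (squeeze_cvgr _ (@cvg_cst _ _ _ _ _) (cvg_exprn_expRN k)).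
near=> r; have r2 : 2 <= r by near: r; exact: nbhs_pinfty_ge.
have r0 : 0 <= r by rewrite (le_trans _ r2).
rewrite mulr_ge0 ?exprn_ge0 ?expR_ge0//= ler_wpM2l ?exprn_ge0// ler_expR.
by nra.
Unshelve. all: end_near. Qed.

(** Integration by parts with primitive r^(k+1) exp(-r^2/2), which vanishes at 0 and at infinity.
    This recursion is the source of the factor n + 2m in [sphere_momentS]. *)
Lemma integral_chi_funS (k : nat) :
  (\int[lambda]_(r in `]0%R, +oo[) (r ^+ k.+2 * expR (- r ^+ 2 / 2))%:E =
   k.+1%:R%:E * \int[lambda]_(r in `]0%R, +oo[) (r ^+ k * expR (- r ^+ 2 / 2))%:E)%E.
Proof.
have dchi j (x : R) : is_derive x 1 (fun r => r ^+ j.+1 * expR (- r ^+ 2 / 2))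
    (j.+1%:R * (x ^+ j * expR (- x ^+ 2 / 2)) - x ^+ j.+2 * expR (- x ^+ 2 / 2)).
  apply: is_derive_eq (is_deriveM (is_derive_exprn j.+1 x) (is_derive_expRNsqr x)) _.
  by rewrite /GRing.scale /= !exprS; ring.
have cchi j : continuous (fun r : R => r ^+ j * expR (- r ^+ 2 / 2)).
  move=> x; have cexp : {for x, continuous (fun r : R => expR (- r ^+ 2 / 2))}.
    apply: differentiable_continuous; apply/derivable1_diffP.
    by case: (is_derive_expRNsqr x).
  by apply: cvgM; [exact: exprn_continuous|exact: cexp].
have chi0 j (x : R) : 0 < x -> 0 <= x ^+ j * expR (- x ^+ 2 / 2).
  by move=> x0; rewrite mulr_ge0 ?expR_ge0// exprn_ge0// ltW.
apply/esym; rewrite -ge0_integralZl//; last 2 first.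
- apply/measurable_EFinP/measurable_funTS; exact: continuous_measurable_fun.
- by move=> t /=; rewrite in_itv/= andbT lee_fin => /chi0; exact.
apply: (@integral_parts_oy (fun r => k.+1%:R * (r ^+ k * expR (- r ^+ 2 / 2))) _
  (fun r => r ^+ k.+1 * expR (- r ^+ 2 / 2)) 0).
- by move=> t _; apply: cvgMr; exact: cchi.
- by move=> t _; exact: cchi.
- by move=> t t0; rewrite mulr_ge0 ?chi0.
- by move=> t t0; exact: chi0.
- apply: cvg_at_right_filter.
  by have := cchi k.+1 0; rewrite /continuous_at expr0n mul0r.
- exact: cvg_exprn_expRNsqr.
Qed.

(** For a = |x|, this is the 1 that becomes the extra radial integral in [polar_coordinates]. *)
Lemma integral_powN (n : nat) (a : R) : (0 < n)%N -> 0 < a ->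
  (\int[lambda]_(s in `[a, +oo[) (n%:R * a ^+ n * s ^- n.+1)%:E = 1)%E.
Proof.
move=> n0 a0.
have dF (x : R) : 0 < x ->
    is_derive x 1 (fun s : R => - a ^+ n * s ^- n) (n%:R * a ^+ n * x ^- n.+1).
  move=> x0; have x_neq0 : x ^+ n != 0 by rewrite expf_neq0// gt_eqF.
  have := is_deriveZ (- a ^+ n) (is_deriveV (f := fun s : R => s ^+ n) x_neq0 (is_derive_exprn n x)).
  move=> h; apply: (is_derive_eq h); rewrite /GRing.scale /=.
  have x_neq0' : x != 0 by rewrite gt_eqF.
  move: n0; case: n x_neq0 h => // m x_neq0 _ _ /=.
  rewrite !exprS; field.
  by rewrite x_neq0' expf_neq0.
have contF (x : R) : 0 < x -> {for x, continuous (fun s : R => - a ^+ n * s ^- n)}.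
  by move=> /dF[? _]; apply: differentiable_continuous; exact/derivable1_diffP.
have conts (k : nat) (x : R) : 0 < x -> {for x, continuous (fun s : R => s ^- k)}.
  move=> x0; apply: cvgV; first by rewrite expf_neq0// gt_eqF.
  exact: exprn_continuous.
rewrite (@ge0_continuous_FTC2y _ (fun s => n%:R * a ^+ n * s ^- n.+1)
  (fun s => - a ^+ n * s ^- n) _ 0).
- by rewrite add0e -EFinN mulNr opprK divff// expf_neq0// gt_eqF.
- move=> x ax; rewrite !mulr_ge0 ?invr_ge0 ?exprn_ge0// ltW//.
  by rewrite (lt_le_trans a0 ax).
- apply/continuous_within_itvcyP; split.
    move=> x; rewrite in_itv/= andbT => ax; apply: cvgMr; apply: conts.
    by rewrite (lt_trans a0 ax).
  apply: cvg_at_right_filter; apply: cvgMr; exact: conts.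
- rewrite -(mulr0 (- a ^+ n)); apply: cvgMr.
  apply/gtr0_cvgV0.
    by near=> x; rewrite exprn_gt0//; near: x; exact: nbhs_pinfty_gt.
  apply: ger_cvgy cvg_id; near=> x; have x1 : 1 <= x.
    by near: x; exact: nbhs_pinfty_ge.
  by rewrite -[leLHS]expr1 ler_weXn2l.
- by move=> x ax; have [] := dF x (lt_trans a0 ax).
- by apply: cvg_at_right_filter; exact: contF.
- move=> x; rewrite in_itv/= andbT => ax; rewrite derive1E.
  by have [_ ->] := dF x (lt_trans a0 ax).
Unshelve. all: end_near. Qed.

End half_line.

(** * Polar coordinates *)

Section lebesgue_scaling.
Context {R : realType}.
Local Open Scope ereal_scope.

Local Notation lambda := (@lebesgue_measure R).

(** Uniqueness of Lebesgue measure reduces this to half-open intervals. For negative [r] the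
    preimage is closed on the other side, with the same length. *)
Lemma lebesgue_measureM (r : R) (A : set (measurableTypeR R)) : r != 0%R ->
  measurable A ->
  `|r|%:E * lambda (( *%R r : _ -> measurableTypeR R) @^-1` A) = lambda A.
Proof.
move=> r0 mA; apply/esym.
have mr : measurable_fun setT ( *%R r : measurableTypeR R -> measurableTypeR R).
  exact: mulrl_measurable.
pose F : measurableTypeR R -> measurableTypeR R := *%R r.
pose m : {measure set (measurableTypeR R) -> \bar R} :=
  mscale (NngNum (normr_ge0 r)) (pushforward lambda F).
transitivity (m mr A); last by [].
apply: lebesgue_measure_unique => //= _ [[a b]] /= ab <-.
rewrite /mscale /= /pushforward /F.
have [rgt0|rlt0|rE0] := ltrgt0P r.
- have -> : *%R r @^-1` `]a, b] = `](a / r)%R, (b / r)%R]%classic.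
    apply/seteqP; split => x /=;
      by rewrite !in_itv/= ltr_pdivrMr// ler_pdivlMr// mulrC.
  rewrite !lebesgue_measure_itv/= !lte_fin ltr_pM2r ?invr_gt0//.
  case: ifPn => _; last by rewrite mule0.
  by rewrite -!EFinD -EFinM -mulrBl mulrC divfK.
- have -> : *%R r @^-1` `]a, b] = `[(b / r)%R, (a / r)%R[%classic.
    apply/seteqP; split => x /=;
      by rewrite !in_itv/= ltr_ndivlMr// ler_ndivrMr// mulrC andbC.
  rewrite !lebesgue_measure_itv/= !lte_fin ltr_nM2r ?invr_lt0//.
  case: ifPn => _; last by rewrite mule0.
  by rewrite -!EFinD -EFinM -mulrBl; congr EFin; field.
- by rewrite rE0 eqxx in r0.
Qed.

Lemma ge0_integral_lebesgueM (r : R) (f : R -> \bar R) : r != 0%R ->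
  measurable_fun setT f -> (forall x, 0 <= f x) ->
  `|r|%:E * \int[lambda]_x f (r * x)%R = \int[lambda]_x f x.
Proof.
move=> r0 mf f0.
have mr : measurable_fun setT ( *%R r : measurableTypeR R -> measurableTypeR R).
  exact: mulrl_measurable.
have nuE (A : set (measurableTypeR R)) : measurable A ->
    `|r|^-1%:E * lambda A = \int[lambda]_(x in *%R r @^-1` A) (cst 1%R x)%:E.
  move=> mA; rewrite -(lebesgue_measureM r0 mA) muleA -EFinM.
  rewrite mulVf ?normr_eq0// mul1e; apply/esym.
  rewrite -[LHS]/(\int[lambda]_(x in *%R r @^-1` A) cst 1 x).
  rewrite integral_cst ?mul1e//.
  by rewrite -[Y in measurable Y]setTI; exact: mr.
have := ge0_integral_density mr (measurable_cst _) (fun=> ler01) nuE mf f0.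
under [X in _ = X -> _]eq_integral do rewrite mule1.
by move=> <-; rewrite muleA -EFinM divff ?normr_eq0// mul1e.
Qed.

Lemma ge0_integral_lebesgue_tupleS n (f : n.+1.-tuple R -> \bar R) :
  measurable_fun setT f -> (forall x, 0 <= f x) ->
  \int[lebesgue_tuple n.+1]_x f x =
  \int[lambda]_x \int[lebesgue_tuple n]_y f (tcons (x, y)).
Proof.
move=> mf f0.
rewrite [LHS](ge0_integral_pushforward (@measurable_tcons R n))//.
rewrite preimage_setT (fubini_tonelli1 (f \o @tcons R n))//.
  apply: measurableT_comp => //; exact: measurable_tcons.
by move=> x; exact: f0.
Qed.

Lemma measurable_fun_integral_tcons n (f : n.+1.-tuple R -> \bar R) :
  measurable_fun setT f -> (forall x, 0 <= f x) ->
  measurable_fun setT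
    (fun x : measurableTypeR R => \int[lebesgue_tuple n]_y f (tcons (x, y))).
Proof.
move=> mf f0.
apply: (measurable_fun_fubini_tonelli_F (f \o @tcons R n)).
  apply: measurableT_comp => //; exact: measurable_tcons.
by move=> x; exact: f0.
Qed.

Lemma scalet_tcons n (r : R) p :
  scalet r (@tcons R n p) = tcons ((r * p.1)%R, scalet r p.2).
Proof.
apply: eq_from_tnth => i; rewrite tnth_mktuple.
by case: (unliftP ord0 i) => [j|] ->; rewrite ?tnthS ?tnth0// tnth_mktuple.
Qed.

Lemma measurable_scalet n (r : R) :
  measurable_fun setT (@scalet R n r).
Proof.
apply/measurable_fun_tnthP => i.
rewrite (_ : _ \o _ = fun x : n.-tuple R => r * tnth x i)%R.
  by apply: measurable_funM => //; exact: measurable_tnth.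
by apply/funext => x /=; rewrite tnth_mktuple.
Qed.

(** By Tonelli each coordinate contributes one factor |r|. *)
Lemma ge0_integral_scalet n (r : R) (f : n.-tuple R -> \bar R) : r != 0%R ->
  measurable_fun setT f -> (forall x, 0 <= f x) ->
  (`|r| ^+ n)%:E * \int[lebesgue_tuple n]_x f (scalet r x) =
  \int[lebesgue_tuple n]_x f x.
Proof.
move=> r0; elim: n f => [|n IH] f mf f0.
  by rewrite expr0 mul1e; apply: eq_integral => x _; congr f; apply: eq_from_tnth => -[].
have mfr : measurable_fun setT (f \o scalet r).
  by apply: measurableT_comp => //; exact: measurable_scalet.
rewrite [RHS]ge0_integral_lebesgue_tupleS//.
rewrite ge0_integral_lebesgue_tupleS//.
have mft x : measurable_fun setT (fun y : n.-tuple R => f (tcons (x, y))).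
  apply: measurableT_comp => //; apply: measurableT_comp => //.
  exact: measurable_tcons.
have mF := measurable_fun_integral_tcons mf f0.
have F0 x : 0 <= \int[lebesgue_tuple n]_y f (tcons (x, y)).
  by apply: integral_ge0.
rewrite exprS EFinM -muleA -ge0_integralZl//; last 2 first.
- exact: (measurable_fun_integral_tcons mfr (fun x => f0 _)).
- by move=> x _; exact: integral_ge0.
under eq_integral do under eq_integral do rewrite scalet_tcons /=.
under eq_integral do rewrite (IH (fun y => f (tcons (_, y))))//.
by rewrite (ge0_integral_lebesgueM r0 mF F0).
Qed.

End lebesgue_scaling.

(** * Integration against the surface measure and the polar formula *)

Section polar.
Context {R : realType}.

Local Open Scope ereal_scope.

Local Notation lambda := (@lebesgue_measure R).

Definition punctured_ball n : set (n.-tuple R) := [set x | (0 < enorm x <= 1)%R].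

Lemma cone_preimage n (E : set (n.-tuple R)) : cone E =
  (fun x : n.-tuple R => scalet (enorm x)^-1 x) @^-1` E `&` @punctured_ball n.
Proof.
apply/seteqP; split => [_ [r /= r01] [x [Ex x1]] <-|x [/= Ex /andP[x0 x1]]].
  move: r01; rewrite in_itv/= => /andP[r0 r1].
  rewrite /unit_sphere /= in x1.
  rewrite /punctured_ball /= enormZ x1 mulr1 gtr0_norm// scaletA mulVf ?gt_eqF//.
  by rewrite scalet1 r0.
exists (enorm x); first by rewrite /= in_itv/= x0.
exists (scalet (enorm x)^-1 x).
  split => //; rewrite /unit_sphere /= enormZ gtr0_norm ?invr_gt0//.
  by rewrite mulVf// gt_eqF.
by rewrite scaletA divff ?gt_eqF// scalet1.
Qed.

Lemma measurable_punctured_ball n : measurable (@punctured_ball n).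
Proof.
rewrite (_ : @punctured_ball n = @enorm R n @^-1` `]0%R, 1%R]).
  by rewrite -[X in measurable X]setTI; exact: measurable_enorm.
by apply/seteqP; split => x /=; rewrite in_itv.
Qed.

(** By [cone_preimage] the surface measure is [n] times the image of Lebesgue measure on the
    punctured ball under x -> x / |x|, so [ge0_integral_density] applies with constant 1 / n. *)
Lemma ge0_integral_surface n (g : n.-tuple R -> \bar R) : (0 < n)%N ->
  measurable_fun setT g -> (forall x, 0 <= g x) ->
  \int[@surface_measure R n]_x g x = n%:R%:E *
  \int[lebesgue_tuple n]_x
    (g (scalet (enorm x)^-1 x) * (\1_(@punctured_ball n) x)%:E).
Proof.
move=> n0 mg g0; have n0' : n%:R != 0%R :> R by rewrite pnatr_eq0 -lt0n.
have nuE (A : set (n.-tuple R)) : measurable A ->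
    n%:R^-1%:E * surface_measure A =
    \int[lebesgue_tuple n]_(x in (fun x => scalet (enorm x)^-1 x) @^-1` A)
      (\1_(@punctured_ball n) x)%:E.
  move=> mA; rewrite /surface_measure muleA -EFinM mulVf// mul1e.
  rewrite integral_indic; first by rewrite cone_preimage setIC.
    by rewrite -[X in measurable X]setTI; exact: measurable_normalize.
  exact: measurable_punctured_ball.
rewrite -(ge0_integral_density (@measurable_normalize R n) _ _ nuE)//.
- by rewrite muleA -EFinM divff// mul1e.
- apply: measurable_indic; exact: measurable_punctured_ball.
Qed.

(** The origin lies in the hyperplane [thead x = 0], a product with a null factor. *)
Lemma lebesgue_tuple_enorm0 n : (0 < n)%N ->
  lebesgue_tuple n [set x : n.-tuple R | enorm x = 0%R] = 0.
Proof.
case: n => // n _; apply/eqP; rewrite eq_le measure_ge0 andbT.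
have mh : measurable [set x : n.+1.-tuple R | thead x = 0%R].
  rewrite -[X in measurable X]setTI.
  exact: (measurable_tnth (@ord0 n)) (measurable_set1 0%R).
have me : measurable [set x : n.+1.-tuple R | enorm x = 0%R].
  rewrite -[X in measurable X]setTI.
  exact: (@measurable_enorm R n.+1) (measurable_set1 0%R).
apply: (@le_trans _ _ (lebesgue_tuple n.+1 [set x | thead x = 0%R])).
  apply: le_measure; rewrite ?inE//.
  move=> x /= /eqP; rewrite sqrtr_eq0 => x0.
  have /eqP : dotp x x = 0%R by apply/eqP; rewrite eq_le x0 dotp_ge0.
  rewrite psumr_eq0; last by move=> i _; rewrite -expr2 sqr_ge0.
  by move=> /allP /(_ ord0); rewrite mem_index_enum mulf_eq0 orbb => /(_ isT)/eqP.
rewrite [leLHS]/= /lebesgue_cons /pushforward.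
rewrite (_ : _ @^-1` _ = [set 0%R] `*` setT); last first.
  by apply/seteqP; split => -[x t] /=; rewrite theadE// => -[].
rewrite product_measure1E//.
rewrite [X in X * _](_ : _ = 0) ?mul0e//.
exact: lebesgue_measure_set1.
Qed.

(* The [`^] factor is [s ^- n.+1] for [s > 0], written with [powR] and [`|s|] to
   be measurable in [s]. *)
Definition radial_kernel n (q s : R) : R :=
  n%:R * q ^+ n * (`|s| ^+ n.+1) `^ (-1) * \1_`[q, +oo[ s.

Lemma radial_kernel_ge0 n q s : (0 <= q)%R -> (0 <= radial_kernel n q s)%R.
Proof.
move=> q0; rewrite /radial_kernel indicE mulr_ge0// mulr_ge0 ?powR_ge0//.
by rewrite mulr_ge0// exprn_ge0.
Qed.

Lemma measurable_radial_kernel n q : measurable_fun setT (radial_kernel n q).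
Proof.
apply: measurable_funM; last by apply: measurable_indic; exact: measurable_itv.
apply: measurable_funM => //.
apply: (measurableT_comp (@measurable_powR R (-1))).
by apply: measurable_funX; exact: normr_measurable.
Qed.

Lemma integral_radial_kernel n (q : R) : (0 < n)%N -> (0 < q)%R ->
  \int[lambda]_s (radial_kernel n q s)%:E = 1.
Proof.
move=> n0 q0; rewrite -(integral_powN n0 q0) [RHS]integral_mkcond.
apply: eq_integral => s _; rewrite patchE /radial_kernel indicE.
case: ifPn => [|_]; last by rewrite mulr0.
rewrite inE /= in_itv/= andbT mulr1 => qs.
by rewrite powR_inv1 ?exprn_ge0// gtr0_norm// (lt_le_trans q0).
Qed.

(** The polar Jacobian, extended by 0 so that the integral runs over the whole line, where scaling
    applies. *)
Definition radial n (s : R) : R := s ^+ n.-1 * \1_`]0%R, +oo[ s.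

Lemma measurable_radial n : measurable_fun setT (radial n).
Proof.
apply: measurable_funM; first exact: exprn_measurable.
by apply: measurable_indic; exact: measurable_itv.
Qed.

Lemma radial_ge0 n s : (0 <= radial n s)%R.
Proof.
rewrite /radial indicE; have [|_] := boolP (_ \in _); last by rewrite mulr0.
by rewrite inE /= in_itv/= andbT mulr1 => s0; rewrite exprn_ge0// ltW.
Qed.

Lemma measurable_scalet2 n :
  measurable_fun setT (fun p : measurableTypeR R * n.-tuple R => scalet p.1 p.2).
Proof.
apply/measurable_fun_tnthP => i.
rewrite (_ : _ \o _ = fun p : measurableTypeR R * n.-tuple R => p.1 * tnth p.2 i)%R.
  apply: measurable_funM; first exact: measurable_fst.
  exact: (measurableT_comp (measurable_tnth i) measurable_snd).
by apply/funext => x /=; rewrite tnth_mktuple.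
Qed.

Lemma radialM n (a s : R) : (0 < n)%N -> (0 < a)%R ->
  (a * radial n (a * s) = a ^+ n * radial n s)%R.
Proof.
case: n => // n _ a0; rewrite /radial /= exprMn exprS.
have -> : \1_`]0%R, +oo[ (a * s)%R = \1_`]0%R, +oo[ s :> R.
  by rewrite !indicE; congr ((nat_of_bool _)%:R); apply/idP/idP;
    rewrite !inE /= !in_itv/= !andbT pmulr_rgt0.
ring.
Qed.

Lemma enorm_ge0 n (x : n.-tuple R) : (0 <= enorm x)%R.
Proof. exact: sqrtr_ge0. Qed.

Lemma enorm_scalet_gt0 n (s : R) (x : n.-tuple R) : (0 < s)%R ->
  enorm (scalet s x) = (s * enorm x)%R.
Proof. by move=> s0; rewrite enormZ gtr0_norm. Qed.

Lemma measurable_radial_integral n (f : n.-tuple R -> \bar R) :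
  measurable_fun setT f -> (forall x, 0 <= f x) ->
  measurable_fun setT
    (fun x => \int[lambda]_r ((radial n r)%:E * f (scalet r x))).
Proof.
move=> mf f0; apply: (measurable_fun_fubini_tonelli_G
    (fun p : measurableTypeR R * n.-tuple R =>
      (radial n p.1)%:E * f (scalet p.1 p.2))).
  apply: emeasurable_funM.
    apply/measurable_EFinP.
    exact: (measurableT_comp (@measurable_radial n) measurable_fst).
  exact: (measurableT_comp mf (@measurable_scalet2 n)).
by move=> p; rewrite mule_ge0// lee_fin radial_ge0.
Qed.

(** The right side is an integral over x in the unit ball and r > 0. Substituting r = |x| s,
    exchanging, then replacing s x by x for fixed s moves the constraint |x| <= 1 to |x| <= s; after
    a second exchange the integral in s is that of [radial_kernel], equal to 1. *)
Lemma polar_coordinates n (f : n.-tuple R -> \bar R) : (0 < n)%N ->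
  measurable_fun setT f -> (forall x, 0 <= f x) ->
  \int[lebesgue_tuple n]_x f x =
  \int[@surface_measure R n]_x \int[lambda]_r ((radial n r)%:E * f (scalet r x)).
Proof.
move=> n0 mf f0.
pose T := (measurableTypeR R * n.-tuple R)%type.
pose H x := \int[lambda]_r ((radial n r)%:E * f (scalet r x)).
have mfs : measurable_fun setT (fun p : T => f (scalet p.1 p.2)).
  by apply: measurableT_comp => //; exact: measurable_scalet2.
have me2 : measurable_fun setT (fun p : T => enorm p.2).
  exact: (measurableT_comp (@measurable_enorm R n) measurable_snd).
have mPB : measurable_fun setT (\1_(@punctured_ball n) : _ -> R).
  by apply: measurable_indic; exact: measurable_punctured_ball.
have mr1 : measurable_fun setT (fun p : T => radial n p.1).
  exact: (measurableT_comp (@measurable_radial n) measurable_fst).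
have mk : measurable_fun setT (fun p : T =>
    (radial n p.1)%:E * f (scalet p.1 p.2)).
  by apply: emeasurable_funM => //; exact/measurable_EFinP.
have mkx x : measurable_fun setT (fun r : measurableTypeR R =>
    (radial n r)%:E * f (scalet r x)).
  exact: (measurableT_comp mk (measurable_pair2 x)).
have k0 r x : 0 <= (radial n r)%:E * f (scalet r x).
  by rewrite mule_ge0// lee_fin radial_ge0.
have mH : measurable_fun setT H by exact: measurable_radial_integral.
have H0 x : 0 <= H x by exact: integral_ge0.
rewrite ge0_integral_surface//.
(* The substitution r = |x| s: the Jacobian has degree n - 1 and dr adds one more power of |x|. *)
have step1 (x : n.-tuple R) : (0 < enorm x)%R ->
    H (scalet (enorm x)^-1 x) = (enorm x ^+ n)%:E * H x.
  move=> x0; have x_neq0 : enorm x != 0%R by rewrite gt_eqF.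
  rewrite [LHS]/H -(ge0_integral_lebesgueM x_neq0) ?gtr0_norm//;
    last exact: mkx.
  transitivity (\int[lambda]_s ((enorm x)%:E * ((radial n (enorm x * s))%:E *
      f (scalet (enorm x * s) (scalet (enorm x)^-1 x))))).
    apply/esym; rewrite ge0_integralZl//; last by rewrite lee_fin ltW.
    have := mkx (scalet (enorm x)^-1 x) => /measurableT_comp; apply.
    exact: mulrl_measurable.
  rewrite -ge0_integralZl//; last by rewrite lee_fin exprn_ge0// ltW.
  apply: eq_integral => s _; rewrite !muleA -!EFinM radialM//.
  by rewrite scaletA mulrAC divff// mul1r.
pose G (p : T) : \bar R :=
  (radial n p.1 * n%:R * enorm p.2 ^+ n * \1_(@punctured_ball n) p.2)%:E *
  f (scalet p.1 p.2).
have G0 p : 0 <= G p.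
  rewrite /G indicE mule_ge0// lee_fin mulr_ge0// mulr_ge0 ?exprn_ge0 ?enorm_ge0//.
  by rewrite mulr_ge0 ?radial_ge0.
have mG : measurable_fun setT G.
  apply: emeasurable_funM; last exact: mfs.
  apply/measurable_EFinP; apply: measurable_funM; last exact: (measurableT_comp mPB measurable_snd).
  apply: measurable_funM; first exact: measurable_funM.
  by apply: measurable_funX.
transitivity (\int[lebesgue_tuple n]_x \int[lambda]_s G (s, x)); last first.
  rewrite -ge0_integralZl//; last 2 first.
    apply: emeasurable_funM; last exact/measurable_EFinP.
    exact: (measurableT_comp mH (@measurable_normalize R n)).
    by move=> x _; apply: mule_ge0; [exact: H0|rewrite lee_fin indicE].
  apply: eq_integral => x _; rewrite indicE.
  have [|xPB] := boolP (x \in _); last first.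
    rewrite mule0 mule0; apply: integral0_eq => s _.
    by rewrite /G /= indicE (negbTE xPB) mulr0 mul0e.
  rewrite inE => -[/andP[x0 x1]]; rewrite mule1 [X in _ * X](step1 _ x0) muleA -EFinM.
  rewrite -ge0_integralZl//; last by rewrite lee_fin mulr_ge0// exprn_ge0// ltW.
  apply: eq_integral => s _; rewrite /G /= indicE mem_set ?mulr1; last first.
    by rewrite /punctured_ball /= x0.
  by rewrite muleA -EFinM; congr (_%:E * _); ring.
rewrite -(fubini_tonelli G)//.
pose A : set T := [set p | 0 < enorm p.2 <= p.1]%R.
have mA : measurable A.
  rewrite (_ : A = (setT `&` (fun p : T => enorm p.2) @^-1` `]0%R, +oo[) `&`
                   (setT `&` [set p : T | enorm p.2 <= p.1]%R)).
    apply: measurableI.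
      by apply: me2 => //; exact: measurable_itv.
    by apply: measurable_fun_le => //; exact: measurable_fst.
  apply/seteqP; split => p /=; rewrite in_itv/= andbT; first by move=> /andP[].
  by move=> [[_ h1] [_ h2]]; apply/andP; split.
(* [G] after the change of variable s x -> x: for s > 0, s^n L(s, s x) = G(s, x). *)
pose L (p : T) : \bar R :=
  (n%:R * enorm p.2 ^+ n * (`|p.1| ^+ n.+1) `^ (-1) * \1_A p)%:E * f p.2.
have L0 p : 0 <= L p.
  rewrite mule_ge0// lee_fin mulr_ge0 ?indicE// mulr_ge0 ?powR_ge0//.
  by rewrite mulr_ge0 ?exprn_ge0 ?enorm_ge0.
have mf2 : measurable_fun setT (fun p : T => f p.2).
  exact: (measurableT_comp mf measurable_snd).
have mL : measurable_fun setT L.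
  apply: emeasurable_funM; last exact: mf2.
  apply/measurable_EFinP; apply: measurable_funM; last exact: measurable_indic.
  apply: measurable_funM.
    by apply: measurable_funM => //; exact: measurable_funX.
  apply: (measurableT_comp (@measurable_powR R (-1))).
  apply: measurable_funX.
  exact: (measurableT_comp (@normr_measurable R setT) measurable_fst).
transitivity (\int[lambda]_s \int[lebesgue_tuple n]_x L (s, x)); last first.
  apply: eq_integral => s _.
  have [s0|s0] := ltP 0%R s; last first.
    apply: eq_integral => x _; rewrite /L /G /radial /=.
    rewrite (_ : \1_`]0%R, +oo[ s = 0%R) ?mulr0 ?mul0r ?mul0e; last first.
      by rewrite indicE memNset//= in_itv/= andbT; apply/negP; rewrite -leNgt.
    rewrite indicE memNset ?mulr0 ?mul0e// /A /= => /andP[x0 /(lt_le_trans x0)].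
    by rewrite ltNge s0.
  have s_neq0 : s != 0%R by rewrite gt_eqF.
  have mLs : measurable_fun setT (fun x : n.-tuple R => L (s, x)).
    exact: (measurableT_comp mL (measurable_pair1 s)).
  rewrite -(ge0_integral_scalet s_neq0 mLs)// -ge0_integralZl//; last first.
    exact: (measurableT_comp mLs (measurable_scalet s)).
  apply: eq_integral => x _; rewrite /L /G /= gtr0_norm// muleA -EFinM.
  congr (_%:E * _).
  rewrite powR_inv1 ?exprn_ge0 ?(ltW s0)//.
  rewrite /radial [\1_`]0%R, +oo[ s]indicE mem_set/= ?in_itv/= ?s0// mulr1.
  rewrite enorm_scalet_gt0//.
  have -> : \1_A (s, scalet s x) = \1_(@punctured_ball n) x :> R.
    have se : (s * enorm x <= s)%R = (enorm x <= 1)%R.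
      by rewrite -[X in (_ <= X)%R]mulr1 ler_pM2l.
    rewrite !indicE; congr ((nat_of_bool _)%:R); apply/idP/idP;
      by rewrite !inE /A /punctured_ball/= enorm_scalet_gt0// pmulr_rgt0// se.
  have sn : (s ^+ n = s * s ^+ n.-1)%R by rewrite -exprS prednK.
  by rewrite exprMn exprS sn; field; rewrite s_neq0 expf_neq0.
rewrite (fubini_tonelli L)//.
apply: ge0_ae_eq_integral => //.
  exact: (measurable_fun_fubini_tonelli_G L).
  by move=> x _; exact: integral_ge0.
(* At the origin the kernel vanishes instead of having integral 1, so the two integrands agree only
   off a null set. *)
exists [set x : n.-tuple R | enorm x = 0%R]; split.
- rewrite -[X in measurable X]setTI.
  exact: (@measurable_enorm R n) (measurable_set1 0%R).
- exact: lebesgue_tuple_enorm0.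
- move=> x /=; apply: contra_notP => /eqP x0 _.
  have {}x0 : (0 < enorm x)%R by rewrite lt_neqAle eq_sym x0 enorm_ge0.
  rewrite -[LHS]mul1e -(integral_radial_kernel n0 x0) -ge0_integralZr//.
  - apply: eq_integral => s _; rewrite /L /radial_kernel /=.
    have -> : \1_A (s, x) = \1_`[enorm x, +oo[ s :> R.
      rewrite !indicE; congr ((nat_of_bool _)%:R); apply/idP/idP;
        by rewrite !inE /A /= x0 in_itv/= andbT.
    by [].
  - by apply/measurable_EFinP; exact: measurable_radial_kernel.
  - by move=> s _; rewrite lee_fin radial_kernel_ge0// enorm_ge0.
Qed.

End polar.

(** * Gaussian and spherical moments *)

Section nonneg_series.
Context {R : realType}.

Lemma nneseries_EFin (u : R^nat) (l : R) : series u @ \oo --> l ->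
  (\sum_(0 <= k <oo) (u k)%:E = l%:E)%E.
Proof.
move=> ul; apply/cvg_lim => //.
under eq_fun do rewrite sumEFin.
by apply: cvg_EFin => //; exact: nearW.
Qed.

Lemma nneseries_EFin_cvg (u : R^nat) (l : R) : (forall k, 0 <= u k) ->
  (\sum_(0 <= k <oo) (u k)%:E = l%:E)%E -> series u @ \oo --> l.
Proof.
move=> u0 ul; have cu : cvgn (series u).
  by apply: nnseries_is_cvg => //; rewrite ul ltry.
have := nneseries_EFin cu; rewrite ul => -[->].
exact: cu.
Qed.

Lemma cvg_cosh_series (y : R) :
  series (fun m => y ^+ (2 * m) / (2 * m)`!%:R) @ \oo -->
  (expR y + expR (- y)) / 2.
Proof.
have h M : series (fun m => y ^+ (2 * m) / (2 * m)`!%:R) M =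
    (series (exp_coeff y) (2 * M)%N + series (exp_coeff (- y)) (2 * M)%N) / 2.
  elim: M => [|M IH]; first by rewrite muln0 /series /= !big_geq// add0r mul0r.
  rewrite mulnS !addSn add0n !seriesSr IH /exp_coeff /=.
  have -> : (- y) ^+ (2 * M) = y ^+ (2 * M) by rewrite !exprM sqrrN.
  have -> : (- y) ^+ (2 * M).+1 = - y ^+ (2 * M).+1.
    by rewrite !exprS !exprM sqrrN; ring.
  by field; rewrite !pnatr_eq0 -!lt0n !fact_gt0.
rewrite (_ : series _ = fun M =>
    (series (exp_coeff y) (2 * M)%N + series (exp_coeff (- y)) (2 * M)%N) / 2);
  last by apply/funext.
have sub (z : R) : series (exp_coeff z) (2 * M)%N @[M --> \oo] --> expR z.
  apply: (cvg_comp (fun M => 2 * M)%N (series (exp_coeff z))); last first.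
    exact: is_cvg_series_exp_coeff.
  apply/cvgnyPge => A; near=> M.
  by rewrite (leq_trans (_ : A <= M)%N) ?leq_pmull//; near: M; exact: nbhs_infty_ge.
by apply: cvgMl; apply: cvgD; exact: sub.
Unshelve. all: end_near. Qed.

(* Dividing by [v ^ m], the coefficients of index m differ by O(v) as soon as
   the previous ones agree. *)
Lemma pseries_coef_unique (p q : R^nat) :
  (forall k, 0 <= p k) -> (forall k, 0 <= q k) ->
  (forall v, 0 < v <= 1 -> exists l : R,
    series (fun k => p k * v ^+ k) @ \oo --> l /\
    series (fun k => q k * v ^+ k) @ \oo --> l) ->
  forall m, p m = q m.
Proof.
have main (p' q' : R^nat) (m : nat) :
    (forall k, 0 <= p' k) -> (forall k, 0 <= q' k) ->
    (forall v, 0 < v <= 1 -> exists l : R,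
      series (fun k => p' k * v ^+ k) @ \oo --> l /\
      series (fun k => q' k * v ^+ k) @ \oo --> l) ->
    (forall k, (k < m)%N -> p' k = q' k) -> p' m <= q' m.
  move=> {p q} {}p0 {}q0 pq below.
  have [C [_ qC]] : exists l : R, series (fun k => p' k * 1 ^+ k) @ \oo --> l /\
      series (fun k => q' k * 1 ^+ k) @ \oo --> l by apply: pq; rewrite ltr01 lexx.
  have nd (u : R^nat) : (forall k, 0 <= u k) -> nondecreasing_seq (series u).
    by move=> u0; apply/nondecreasing_seqP => k; rewrite seriesSr lerDl.
  have qC' K : \sum_(0 <= k < K) q' k <= C.
    have := nondecreasing_cvgn_le (nd _ (fun k => mulr_ge0 (q0 k) (exprn_ge0 k ler01))) (cvgP C qC) K.
    rewrite (cvg_lim _ qC)// /series /=.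
    by under eq_bigr do rewrite expr1n mulr1.
  have C0 : 0 <= C by rewrite (le_trans _ (qC' 0%N))// big_geq.
  have bound v : 0 < v <= 1 -> p' m <= q' m + v * C.
    move=> v01; have [v0 v1] := andP v01.
    have [l [pl ql]] := pq v v01.
    have t0 (u : R^nat) : (forall k, 0 <= u k) -> forall k, 0 <= u k * v ^+ k.
      by move=> u0 k; rewrite mulr_ge0// exprn_ge0// ltW.
    have h1 : \sum_(0 <= k < m.+1) p' k * v ^+ k <= l.
      have := nondecreasing_cvgn_le (nd _ (t0 _ p0)) (cvgP l pl) m.+1.
      by rewrite (cvg_lim _ pl).
    have h2 : l <= \sum_(0 <= k < m.+1) q' k * v ^+ k + v ^+ m.+1 * C.
      rewrite -(cvg_lim _ ql)//; apply: limr_le; first exact: (cvgP l ql).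
      near=> K; have mK : (m.+1 <= K)%N by near: K; exact: nbhs_infty_ge.
      rewrite /series /= (big_cat_nat _ mK)//= lerD2l.
      apply: (@le_trans _ _ (v ^+ m.+1 * \sum_(m.+1 <= k < K) q' k)).
        rewrite mulr_sumr !big_nat; apply: ler_sum => k /andP[mk _].
        rewrite mulrC ler_wpM2r// ler_wiXn2l// ltW//.
      rewrite ler_wpM2l ?exprn_ge0 ?(ltW v0)// (le_trans _ (qC' K))//.
      by rewrite [leRHS](big_cat_nat _ mK)//= lerDr sumr_ge0.
    have := le_trans h1 h2.
    rewrite !big_nat_recr//= (eq_big_nat _ _ (F2 := fun k => q' k * v ^+ k)); last first.
      by move=> k /andP[_ km]; rewrite below.
    rewrite -addrA lerD2l exprSr -[_ * v * C]mulrA [_ * (v * C)]mulrC -mulrDl.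
    by rewrite ler_pM2r// exprn_gt0.
  rewrite leNgt; apply/negP => qp.
  (* For this [v], [v * C] is below the supposed gap [p' m - q' m]; [C + 1] is positive even when
     [C] is 0. *)
  have := bound (Num.min 1 ((p' m - q' m) / (C + 1) / 2)) _.
  set v := Num.min _ _.
  have C1 : 0 < C + 1 by rewrite ltr_wpDl.
  have d0 : 0 < p' m - q' m by rewrite subr_gt0.
  have v0 : 0 < v by rewrite lt_min ltr01 !divr_gt0.
  rewrite v0 ge_min lexx => /(_ isT); rewrite leNgt => /negP; apply.
  rewrite -ltrBrDl (@le_lt_trans _ _ ((p' m - q' m) / (C + 1) / 2 * C))//.
    by rewrite ler_wpM2r// ge_min lexx orbT.
  have -> : (p' m - q' m) / (C + 1) / 2 * C = (p' m - q' m) * (C / (C + 1) / 2).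
    by ring.
  rewrite gtr_pMr// ltr_pdivrMr// mul1r ltr_pdivrMr//; lra.
move=> p0 q0 pq m; have [k] := ubnP m; elim: k m => // k IH m mk.
apply/le_anti/andP; split; apply: main => //.
- by move=> j jm; apply: IH; rewrite (leq_trans jm).
- by move=> v /pq[l [? ?]]; exists l.
- by move=> j jm; apply/esym/IH; rewrite (leq_trans jm).
Unshelve. all: end_near. Qed.

End nonneg_series.

(** * Gaussian moments *)

Section gaussian.
Context {R : realType}.
Local Notation lambda := (@lebesgue_measure R).

Lemma dotp_tcons n (a x : R) (t y : n.-tuple R) :
  dotp (tcons (a, t)) (tcons (x, y)) = a * x + dotp t y.
Proof.
rewrite /dotp big_ord_recl; congr (_ + _).
by apply: eq_bigr => i _; rewrite !tnthS.
Qed.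

Lemma measurable_dotpl n (t : n.-tuple R) : measurable_fun setT (dotp t).
Proof.
apply: measurable_sum => i; apply: measurable_funM => //.
exact: measurable_tnth.
Qed.

Lemma dotpZr n (s : R) (t x : n.-tuple R) : dotp t (scalet s x) = s * dotp t x.
Proof. by rewrite -[t in LHS]scalet1 dotpZ mul1r. Qed.

Lemma enorm_sqr n (x : n.-tuple R) : enorm x ^+ 2 = dotp x x.
Proof. by rewrite sqr_sqrtr ?dotp_ge0. Qed.

Definition gauss_weight n (x : n.-tuple R) : R := expR (- dotp x x / 2).

Lemma measurable_gauss_weight n : measurable_fun setT (@gauss_weight n).
Proof.
apply: measurableT_comp => //; apply: measurable_funM => //.
by apply: measurableT_comp => //; exact: measurable_dotp.
Qed.

Definition gauss_mass : R := Num.sqrt (pi *+ 2).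

Lemma gauss_mass_gt0 : 0 < gauss_mass.
Proof. by rewrite sqrtr_gt0 mulrn_wgt0// pi_gt0. Qed.

(** Completing the square turns the integrand into a multiple of the normal density with mean [a]
    and variance 1. *)
Lemma integral_gauss_mgf1 (a : R) :
  (\int[lambda]_x (expR (a * x - x ^+ 2 / 2))%:E =
   (gauss_mass * expR (a ^+ 2 / 2))%:E)%E.
Proof.
have g0 := gauss_mass_gt0.
have E (x : R) : expR (a * x - x ^+ 2 / 2) =
    gauss_mass * expR (a ^+ 2 / 2) * normal_pdf a 1 x.
  rewrite normal_pdfE ?oner_neq0// /normal_peak /normal_fun expr1n mul1r.
  rewrite mulrACA divff ?gt_eqF// mul1r -expRD; congr expR.
  by field.
under eq_integral do rewrite E EFinM.
rewrite ge0_integralZl//.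
- by rewrite integral_normal_pdf mule1.
- by apply/measurable_EFinP; exact: measurable_normal_pdf.
- by move=> x _; rewrite lee_fin normal_pdf_ge0.
- by rewrite lee_fin mulr_ge0// ?expR_ge0// ltW.
Qed.

(** The integral factors over the coordinates, and the product of the exp(t_i^2 / 2) depends on [t]
    only through its norm. *)
Lemma integral_gauss_mgf n (t : n.-tuple R) :
  (\int[lebesgue_tuple n]_x (expR (dotp t x) * gauss_weight x)%:E =
   (gauss_mass ^+ n * expR (dotp t t / 2))%:E)%E.
Proof.
have mF k (u : k.-tuple R) :
    measurable_fun setT (fun x => (expR (dotp u x) * gauss_weight x)%:E).
  apply/measurable_EFinP; apply: measurable_funM; last exact: measurable_gauss_weight.
  by apply: measurableT_comp => //; exact: measurable_dotpl.
have F0 k (u x : k.-tuple R) : (0 <= (expR (dotp u x) * gauss_weight x)%:E)%E.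
  by rewrite lee_fin mulr_ge0 ?expR_ge0.
elim: n t => [|n IH] t.
  rewrite /= integral_dirac//; last exact: mF.
  rewrite diracT mul1e; congr EFin.
  by rewrite /gauss_weight /dotp !big_ord0 oppr0 mul0r expr0 expR0.
case/tupleP: t => a t; rewrite -[[tuple of _]]/(tcons (a, t)).
rewrite ge0_integral_lebesgue_tupleS//.
transitivity (\int[lambda]_x ((expR (a * x - x ^+ 2 / 2))%:E *
    (gauss_mass ^+ n * expR (dotp t t / 2))%:E))%E.
  apply: eq_integral => x _; rewrite -IH -ge0_integralZl//; last exact: mF.
  apply: eq_integral => y _; rewrite -EFinM /gauss_weight !dotp_tcons.
  by rewrite -!expRD; congr ((expR _)%:E); field.
rewrite ge0_integralZr//; last 2 first.
- apply/measurable_EFinP; apply: measurableT_comp => //; apply: measurable_funB.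
    exact: mulrl_measurable.
  by apply: measurable_funM => //; exact: exprn_measurable.
- by rewrite lee_fin mulr_ge0 ?expR_ge0// exprn_ge0// ltW// gauss_mass_gt0.
rewrite integral_gauss_mgf1 -EFinM dotp_tcons; congr EFin.
by rewrite mulrACA -exprS -expRD; congr (_ * expR _); field.
Qed.

Definition gauss_moment n m (t : n.-tuple R) : \bar R :=
  \int[lebesgue_tuple n]_x (dotp t x ^+ (2 * m) * gauss_weight x)%:E.

Lemma measurable_moment_fun n m (t : n.-tuple R) (k : R) :
  measurable_fun setT (fun x => (k * (dotp t x ^+ (2 * m) * gauss_weight x))%:E).
Proof.
apply/measurable_EFinP; apply: measurable_funM => //.
apply: measurable_funM; last exact: measurable_gauss_weight.
by apply: measurable_funX; exact: measurable_dotpl.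
Qed.

Lemma moment_fun_ge0 n m (t x : n.-tuple R) :
  0 <= dotp t x ^+ (2 * m) * gauss_weight x.
Proof. by rewrite mulr_ge0 ?expR_ge0// exprM exprn_ge0// sqr_ge0. Qed.

(** Both sides integrate cosh(u t.x) against the Gaussian weight. Averaging over u and -u removes
    the odd terms; the remaining ones are nonnegative and can be integrated termwise. *)
Lemma gauss_moment_series n (t : n.-tuple R) (u : R) :
  (\sum_(0 <= m <oo) ((u ^+ (2 * m) / (2 * m)`!%:R)%:E * gauss_moment m t) =
   (gauss_mass ^+ n * expR (u ^+ 2 * dotp t t / 2))%:E)%E.
Proof.
transitivity (\int[lebesgue_tuple n]_x
  \sum_(0 <= m <oo) ((u ^+ (2 * m) / (2 * m)`!%:R) *
                     (dotp t x ^+ (2 * m) * gauss_weight x))%:E)%E.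
  have c0 m : 0 <= u ^+ (2 * m) / (2 * m)`!%:R.
    by rewrite divr_ge0// exprM exprn_ge0// sqr_ge0.
  rewrite integral_nneseries//; last 2 first.
  - by move=> m; exact: measurable_moment_fun.
  - by move=> m x _; rewrite lee_fin mulr_ge0// moment_fun_ge0.
  apply: eq_eseriesr => m _; rewrite /gauss_moment -ge0_integralZl//.
  - have := measurable_moment_fun m t 1.
    by under eq_fun do rewrite mul1r.
  - by move=> x _; rewrite lee_fin moment_fun_ge0.
  - by rewrite lee_fin.
transitivity (\int[lebesgue_tuple n]_x
  (2^-1%:E * ((expR (dotp (scalet u t) x) * gauss_weight x)%:E +
              (expR (dotp (scalet (- u) t) x) * gauss_weight x)%:E)))%E.
  apply: eq_integral => x _.
  have -> : dotp (scalet u t) x = u * dotp t x.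
    by rewrite -[x in LHS]scalet1 dotpZ mulr1.
  have -> : dotp (scalet (- u) t) x = - (u * dotp t x).
    by rewrite -[x in LHS]scalet1 dotpZ mulr1 mulNr.
  rewrite -EFinD -EFinM; apply: nneseries_EFin.
  have -> : 2^-1 * (expR (u * dotp t x) * gauss_weight x +
      expR (- (u * dotp t x)) * gauss_weight x) =
      (expR (u * dotp t x) + expR (- (u * dotp t x))) / 2 * gauss_weight x by ring.
  rewrite (_ : series _ = fun M =>
      series (fun m => (u * dotp t x) ^+ (2 * m) / (2 * m)`!%:R) M *
      gauss_weight x).
    by apply: cvgMl; exact: cvg_cosh_series.
  apply/funext => M; rewrite /series /= mulr_suml; apply: eq_bigr => m _.
  by rewrite exprMn; ring.
have mexp (v : n.-tuple R) :
    measurable_fun setT (fun x => (expR (dotp v x) * gauss_weight x)%:E).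
  apply/measurable_EFinP; apply: measurable_funM; last exact: measurable_gauss_weight.
  by apply: measurableT_comp => //; exact: measurable_dotpl.
have exp0 (v x : n.-tuple R) : (0 <= (expR (dotp v x) * gauss_weight x)%:E)%E.
  by rewrite lee_fin mulr_ge0 ?expR_ge0.
rewrite ge0_integralZl//; [|exact: emeasurable_funD|by move=> x _; exact: adde_ge0].
rewrite ge0_integralD//.
rewrite !integral_gauss_mgf !dotpZ -EFinD -EFinM; congr EFin.
by rewrite mulrNN -expr2; field.
Qed.

(** The quotient (2m)! / (2^m m!) is the double factorial (2m - 1)!!, the moment of order 2m of a
    standard normal variable. *)
Definition gauss_moment_const n m : R :=
  gauss_mass ^+ n * (2 * m)`!%:R / (2 ^+ m * m`!%:R).

Lemma gauss_moment_const_gt0 n m : 0 < gauss_moment_const n m.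
Proof.
rewrite divr_gt0// mulr_gt0 ?exprn_gt0 ?gauss_mass_gt0 ?ltr0n ?fact_gt0//.
Qed.

Lemma gauss_moment_constS n m :
  gauss_moment_const n m.+1 = (2 * m).+1%:R * gauss_moment_const n m.
Proof.
rewrite /gauss_moment_const mulnS !addSn add0n !factS !natrM exprS.
rewrite -(natr1 m) -![(2 * m).+2%:R]natr1 -![(2 * m).+1%:R]natr1 natrM; field.
by rewrite pnatr_eq0 -lt0n fact_gt0 natr1 pnatr_eq0 expf_neq0// pnatr_eq0.
Qed.

(** Comparison of the coefficients of v = u^2 in [gauss_moment_series] with those of the exponential
    series. *)
Lemma gauss_momentE n m (t : n.-tuple R) :
  gauss_moment m t = (gauss_moment_const n m * dotp t t ^+ m)%:E.
Proof.
have J0 k : (0 <= gauss_moment k t)%E.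
  by apply: integral_ge0 => x _; rewrite lee_fin moment_fun_ge0.
have c0 (u : R) k : 0 <= u ^+ (2 * k) / (2 * k)`!%:R.
  by rewrite divr_ge0// exprM exprn_ge0// sqr_ge0.
(* An infinite moment would make the series of nonnegative terms infinite at u = 1. *)
have Jfin k : gauss_moment k t \is a fin_num.
  rewrite ge0_fin_numE// ltey; apply/negP => /eqP Joo.
  have /eqP := gauss_moment_series t 1; apply/negP.
  rewrite (@nneseriesD1 _ _ k)//.
    rewrite Joo expr1n mul1r mulry gtr0_sg ?invr_gt0 ?ltr0n ?fact_gt0// mul1e.
    rewrite addye// gt_eqF// (lt_le_trans (ltNyr 0))// nneseries_ge0// => j _ _.
    by rewrite mule_ge0// lee_fin.
  by move=> j _; rewrite mule_ge0// lee_fin.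
pose p k := fine (gauss_moment k t) / (2 * k)`!%:R.
pose q k := gauss_mass ^+ n * ((dotp t t / 2) ^+ k / k`!%:R).
have /(_ m) : forall k, p k = q k.
  apply: pseries_coef_unique => [k|k|v /andP[v0 v1]].
  - by rewrite divr_ge0// fine_ge0.
  - rewrite mulr_ge0 ?exprn_ge0 ?(ltW gauss_mass_gt0)// divr_ge0//.
    by rewrite exprn_ge0// divr_ge0// dotp_ge0.
  exists (gauss_mass ^+ n * expR (v * (dotp t t / 2))); split.
    apply: nneseries_EFin_cvg => [k|].
      by rewrite mulr_ge0 ?exprn_ge0 ?(ltW v0)// divr_ge0// fine_ge0.
    have := gauss_moment_series t (Num.sqrt v).
    rewrite sqr_sqrtr ?(ltW v0)// -mulrA => <-.
    apply: eq_eseriesr => k _; rewrite exprM sqr_sqrtr ?(ltW v0)//.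
    by rewrite -[in RHS](fineK (Jfin k)) -EFinM /p; congr EFin; ring.
  rewrite (_ : series _ = fun M => gauss_mass ^+ n * series (exp_coeff (v * (dotp t t / 2))) M).
    by apply: cvgMr; exact: is_cvg_series_exp_coeff.
  apply/funext => M; rewrite /series /= mulr_sumr; apply: eq_bigr => k _.
  by rewrite /exp_coeff /q /= !exprMn; ring.
rewrite /p /q => pq; rewrite -(fineK (Jfin m)); congr EFin.
have f_neq0 : (2 * m)`!%:R != 0 :> R by rewrite pnatr_eq0 -lt0n fact_gt0.
rewrite -[LHS](divfK f_neq0) pq /gauss_moment_const expr_div_n; field.
by rewrite pnatr_eq0 -lt0n fact_gt0 expf_neq0// pnatr_eq0.
Qed.

End gaussian.

(** * Even moments of linear forms on the sphere *)

Section sphere_moments.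
Context {R : realType}.
Local Open Scope ereal_scope.
Local Notation lambda := (@lebesgue_measure R).
Local Notation sphere n := (@unit_sphere R n).
Local Notation sigma n := (@surface_measure R n).

Lemma measurable_unit_sphere n : measurable (sphere n).
Proof.
rewrite -[X in measurable X]setTI.
exact: (@measurable_enorm R n) (measurable_set1 1%R).
Qed.

Lemma unit_sphere_dotp n (x : n.-tuple R) : sphere n x -> dotp x x = 1%R.
Proof. by rewrite -enorm_sqr /unit_sphere /= => ->; rewrite expr1n. Qed.

Lemma scalet_unit n (x : n.-tuple R) : (0 < enorm x)%R ->
  sphere n (scalet (enorm x)^-1 x).
Proof.
move=> x0; rewrite /unit_sphere /= enormZ gtr0_norm ?invr_gt0//.
by rewrite mulVf// gt_eqF.
Qed.

Lemma integral_surface_sphere n (g : n.-tuple R -> \bar R) : (0 < n)%N ->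
  measurable_fun setT g -> (forall x, 0 <= g x) ->
  \int[sigma n]_x g x = \int[sigma n]_(x in sphere n) g x.
Proof.
move=> n0 mg g0; rewrite [RHS]integral_mkcond !ge0_integral_surface//.
- congr (_ * _); apply: eq_integral => x _; rewrite patchE indicE.
  have [|_] := boolP (x \in _); last by rewrite !mule0.
  by rewrite inE => -[/andP[x0 _]]; rewrite mem_set//; exact: scalet_unit.
- by apply/(measurable_restrictT _ _).1; [exact: measurable_unit_sphere|exact: measurable_funTS].
- by move=> x; rewrite patchE; case: ifP.
Qed.

Definition chi_moment (k : nat) : \bar R :=
  \int[lambda]_(r in `]0%R, +oo[) (r ^+ k * expR (- r ^+ 2 / 2))%:E.

Definition sphere_moment n m (t : n.-tuple R) : \bar R :=
  \int[sigma n]_(x in sphere n) (dotp t x ^+ (2 * m))%:E.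

(** In polar coordinates the integrand splits, as (t . r x)^(2m) = r^(2m) (t . x)^(2m) and the
    weight depends on r alone; the Jacobian adds the exponent n - 1. *)
Lemma sphere_momentM n m (t : n.-tuple R) : (0 < n)%N ->
  sphere_moment m t * chi_moment (n.-1 + 2 * m) = gauss_moment m t.
Proof.
move=> n0; rewrite /gauss_moment.
have mf : measurable_fun setT
    (fun x : n.-tuple R => (dotp t x ^+ (2 * m) * gauss_weight x)%:E).
  have := measurable_moment_fun m t 1%R.
  by under eq_fun do rewrite mul1r.
have f0 (x : n.-tuple R) : 0 <= (dotp t x ^+ (2 * m) * gauss_weight x)%:E.
  by rewrite lee_fin moment_fun_ge0.
rewrite polar_coordinates// integral_surface_sphere//; last 2 first.
- exact: (measurable_radial_integral mf f0).
- by move=> x; apply: integral_ge0 => r _; rewrite mule_ge0// lee_fin radial_ge0.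
rewrite /sphere_moment -ge0_integralZr//; last 4 first.
- exact: measurable_unit_sphere.
- apply/measurable_EFinP/measurable_funTS/measurable_funX; exact: measurable_dotpl.
- by move=> x _; rewrite lee_fin exprM exprn_ge0// sqr_ge0.
- by apply: integral_ge0 => r /=; rewrite in_itv/= andbT => r0;
    rewrite lee_fin mulr_ge0 ?expR_ge0// exprn_ge0// ltW.
apply: eq_integral => x /[!inE] x1.
rewrite /chi_moment -ge0_integralZl//; last 3 first.
- apply/measurable_EFinP/measurable_funTS; apply: measurable_funM.
    exact: exprn_measurable.
  apply: measurableT_comp => //; apply: measurable_funM => //.
  by apply: measurableT_comp => //; exact: exprn_measurable.
- by move=> r /=; rewrite in_itv/= andbT => r0;
    rewrite lee_fin mulr_ge0 ?expR_ge0// exprn_ge0// ltW.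
- by rewrite lee_fin exprM exprn_ge0// sqr_ge0.
rewrite integral_mkcond; apply: eq_integral => r _; rewrite patchE /radial indicE.
case: ifPn => [|_]; last by rewrite mulr0 mul0e.
rewrite inE /= in_itv/= andbT => r0.
rewrite -!EFinM /gauss_weight dotpZ dotpZr (unit_sphere_dotp x1) !mulr1 -expr2.
by rewrite exprMn exprD; congr EFin; ring.
Qed.

Local Close Scope ereal_scope.

Section unit_vector.
Variables (n : nat) (mu : n.-tuple R).
Hypotheses (n0 : (0 < n)%N) (mu1 : sphere n mu).

Let moment (m : nat) : R := fine (sphere_moment m mu).

Let sphere_moment_ge0 m (t : n.-tuple R) : (0 <= sphere_moment m t)%E.
Proof. by apply: integral_ge0 => x _; rewrite lee_fin exprM exprn_ge0// sqr_ge0. Qed.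

Let chi_moment_ge0 k : (0 <= chi_moment k)%E.
Proof.
by apply: integral_ge0 => r /=; rewrite in_itv/= andbT => r0;
  rewrite lee_fin mulr_ge0 ?expR_ge0// exprn_ge0// ltW.
Qed.

(** An infinite [x] would give a product that is 0 (as 0 times infinity is 0) or infinite. Both
    factors of [sphere_momentM] are thus finite because the Gaussian moment is finite and
    positive. *)
Let mule_fin_gt0 (x y : \bar R) (r : R) : 0 < r ->
  (0 <= x)%E -> (0 <= y)%E -> (x * y = r%:E)%E -> x \is a fin_num.
Proof.
move=> r0 x0 y0 xy; rewrite ge0_fin_numE// ltey; apply/eqP => xoo.
move: xy; rewrite xoo; move: y0; rewrite le_eqVlt => /predU1P[<-|y0].
  by rewrite mule0 => -[] /eqP; rewrite lt_eqF.
by rewrite gt0_mulye.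
Qed.

Let gauss_pos m : 0 < @gauss_moment_const R n m.
Proof. exact: gauss_moment_const_gt0. Qed.

Let moment_chi m : (sphere_moment m mu * chi_moment (n.-1 + 2 * m) =
  (@gauss_moment_const R n m)%:E)%E.
Proof.
by rewrite sphere_momentM// gauss_momentE (unit_sphere_dotp mu1) expr1n mulr1.
Qed.

Let moment_fin m : sphere_moment m mu \is a fin_num.
Proof. exact: mule_fin_gt0 (gauss_pos m) _ _ (moment_chi m). Qed.

Let chi_fin m : chi_moment (n.-1 + 2 * m) \is a fin_num.
Proof.
by apply: mule_fin_gt0 (gauss_pos m) _ _ _; rewrite 1?muleC; last exact: moment_chi.
Qed.

Let momentM m :
  moment m * fine (chi_moment (n.-1 + 2 * m)) = @gauss_moment_const R n m.
Proof. by apply: EFin_inj; rewrite EFinM !fineK// moment_chi. Qed.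

Let chi_gt0 m : 0 < fine (chi_moment (n.-1 + 2 * m)).
Proof.
rewrite lt_neqAle fine_ge0// andbT eq_sym; apply: contra_eq_neq (momentM m) => ->.
by rewrite mulr0 lt_eqF.
Qed.

Lemma moment_gt0 m : 0 < moment m.
Proof. by rewrite -(pmulr_lgt0 _ (chi_gt0 m)) momentM. Qed.

(** The chi moment does not depend on [t], so dividing by it leaves the dependence on [t] of the
    Gaussian moment. *)
Lemma sphere_momentE m (t : n.-tuple R) :
  sphere_moment m t = (moment m * dotp t t ^+ m)%:E.
Proof.
have := sphere_momentM m t n0; rewrite gauss_momentE -momentM.
have := sphere_moment_ge0 m t; rewrite -[X in (_ * X)%E](fineK (chi_fin m)).
case: (sphere_moment m t) => [a _|_|//].
  rewrite -EFinM => -[] /eqP; rewrite mulrAC.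
  by rewrite (inj_eq (mulIf (lt0r_neq0 (chi_gt0 m)))) => /eqP ->.
by rewrite mulyr gtr0_sg// mul1e.
Qed.

(** Quotient of two recursions: the Gaussian moments gain the factor 2m + 1, the chi moments the
    factor n + 2m. *)
Lemma sphere_momentS m :
  (n + 2 * m)%:R * moment m.+1 = (2 * m).+1%:R * moment m.
Proof.
have chiS : fine (chi_moment (n.-1 + 2 * m.+1)) =
    (n + 2 * m)%:R * fine (chi_moment (n.-1 + 2 * m)).
  have -> : (n.-1 + 2 * m.+1 = (n.-1 + 2 * m).+2)%N by lia.
  rewrite /chi_moment integral_chi_funS fineM//.
    by rewrite /= -addSn prednK.
  exact: chi_fin.
apply: (mulIf (lt0r_neq0 (chi_gt0 m))).
rewrite -mulrA [moment _ * _]mulrC mulrA -chiS mulrC momentM -mulrA momentM.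
exact: gauss_moment_constS.
Qed.

Lemma surface_measure_sphere : sigma n (sphere n) = (moment 0)%:E.
Proof.
have := sphere_momentE 0 mu; rewrite (unit_sphere_dotp mu1) mulr1 => <-.
rewrite /sphere_moment muln0; under eq_integral do rewrite expr0.
by rewrite integral_cst ?mul1e//; exact: measurable_unit_sphere.
Qed.

End unit_vector.

End sphere_moments.

Lemma poly_ext (R : numDomainType) (p q : {poly R}) :
  (forall x, p.[x] = q.[x]) -> p = q.
Proof.
move=> pq; apply/eqP; rewrite -subr_eq0; apply/negPn/negP => pq0.
pose rs := [seq i%:R : R | i <- iota 0 (size (p - q))].
have := max_poly_roots pq0 (rs := rs).
rewrite size_map size_iota ltnn; apply: contraPP => _; rewrite not_implyE.
split; last first.
  apply/implyP; rewrite map_inj_uniq ?iota_uniq//; exact: mulrIn (oner_neq0 R).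
apply/allP => _ /mapP[i _ ->]; by rewrite /root !hornerE pq subrr.
Qed.

(** * Odd, polarized and exponential integrals over the sphere *)

Section sphere_integrals.
Context {R : realType} (n : nat) (mu : n.-tuple R).
Hypotheses (n0 : (0 < n)%N) (mu1 : unit_sphere mu).
Local Notation sphere := (@unit_sphere R n).
Local Notation sigma := (@surface_measure R n).
Local Notation moment m := (fine (sphere_moment m mu)).

Let mS : measurable sphere. Proof. exact: measurable_unit_sphere. Qed.

Lemma sphere_integrable (g : n.-tuple R -> R) (C : R) :
  measurable_fun setT g -> (forall x, sphere x -> `|g x| <= C) ->
  sigma.-integrable sphere (EFin \o g).
Proof.
move=> mg gC; apply: measurable_bounded_integrable => //.
- by rewrite [ltLHS](surface_measure_sphere n0 mu1) ltry.
- exact: measurable_funTS.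
- exists C; split; first exact: num_real.
  by move=> M CM x Sx /=; rewrite (le_trans (gC x Sx))// ltW.
Qed.

(** The l^1 norm bounds [dotp t] on the sphere because coordinates there are at most 1 in absolute
    value. *)
Definition dotp_bound (t : n.-tuple R) : R := \sum_i `|tnth t i|.

Lemma dotp_bound_ge0 t : 0 <= dotp_bound t. Proof. exact: sumr_ge0. Qed.

Lemma sphere_coord (x : n.-tuple R) i : sphere x -> `|tnth x i| <= 1.
Proof.
move=> x1; have := unit_sphere_dotp x1; rewrite /dotp (bigD1 i)//= => E.
rewrite -(@expr_le1 _ 2)// real_normK ?num_real// -E expr2 lerDl.
by apply: sumr_ge0 => j _; rewrite -expr2 sqr_ge0.
Qed.

Lemma dotp_le_bound (t x : n.-tuple R) : sphere x -> `|dotp t x| <= dotp_bound t.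
Proof.
move=> x1; rewrite (le_trans (ler_norm_sum _ _ _))// ler_sum// => i _.
by rewrite normrM ler_piMr// sphere_coord.
Qed.

Lemma enorm_scaletN (x : n.-tuple R) : enorm (scalet (-1) x) = enorm x.
Proof. by rewrite enormZ normrN1 mul1r. Qed.

(** The antipodal map preserves the punctured ball, commutes with normalization, and scales Lebesgue
    measure by |-1|^n = 1. *)
Lemma ge0_integral_surfaceN (g : n.-tuple R -> \bar R) :
  measurable_fun setT g -> (forall x, 0 <= g x)%E ->
  (\int[sigma]_x g (scalet (-1) x) = \int[sigma]_x g x)%E.
Proof.
move=> mg g0.
have mgN : measurable_fun setT (fun x => g (scalet (-1) x)).
  exact: (measurableT_comp mg (measurable_scalet (-1))).
rewrite !ge0_integral_surface//; congr (_ * _)%E.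
pose h x := (g (scalet (enorm x)^-1 x) * (\1_(@punctured_ball R n) x)%:E)%E.
have N1 : (-1 : R) != 0 by rewrite oppr_eq0 oner_eq0.
rewrite -[RHS]/(\int[lebesgue_tuple n]_x h x)%E -(ge0_integral_scalet (f:=h) N1).
- rewrite normrN1 expr1n mul1e; apply: eq_integral => x _.
  rewrite /h enorm_scaletN !scaletA [-1 * _]mulrC !indicE.
  have -> // : (scalet (-1) x \in @punctured_ball R n) = (x \in @punctured_ball R n).
  by apply/idP/idP; rewrite !inE /punctured_ball /= enorm_scaletN.
- rewrite /h; apply: emeasurable_funM.
    exact: (measurableT_comp mg (@measurable_normalize R n)).
  by apply/measurable_EFinP; apply: measurable_indic; exact: measurable_punctured_ball.
- by move=> x; rewrite /h indicE mule_ge0 ?lee_fin.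
Qed.

Lemma sphere_integral_odd (g : n.-tuple R -> R) :
  measurable_fun setT g -> (forall x, g (scalet (-1) x) = - g x) ->
  \int[sigma]_(x in sphere) g x = 0.
Proof.
move=> mg gN; rewrite /Rintegral integralE.
have mp : measurable_fun setT (fun x => (g x)%:E) by exact/measurable_EFinP.
rewrite -!integral_surface_sphere//; last 2 first.
- exact: (measurable_funeneg mp).
- exact: (measurable_funepos mp).
rewrite -(ge0_integral_surfaceN (measurable_funepos mp))//.
have -> : (\int[sigma]_x ((fun x => (g x)%:E)^\+) (scalet (-1) x) =
    \int[sigma]_x ((fun x => (g x)%:E)^\- x))%E.
  by apply: eq_integral => x _; rewrite funeposE funenegE gN.
(* The positive and negative parts have the same integral; were it infinite, [fine] would send the
   difference to 0. *)
case: (\int[sigma]_x _)%E => [r| |]//=; rewrite subrr//.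
Qed.

Definition addt (x y : n.-tuple R) : n.-tuple R :=
  [tuple tnth x i + tnth y i | i < n].

Lemma dotpC (x y : n.-tuple R) : dotp x y = dotp y x.
Proof. by apply: eq_bigr => i _; rewrite mulrC. Qed.

Lemma dotp_addl (x y z : n.-tuple R) : dotp (addt x y) z = dotp x z + dotp y z.
Proof.
by rewrite /dotp -big_split; apply: eq_bigr => i _; rewrite tnth_mktuple mulrDl.
Qed.

Lemma dotp_scaletl e (x y : n.-tuple R) : dotp (scalet e x) y = e * dotp x y.
Proof. by rewrite dotpC dotpZr dotpC. Qed.

(* Compare the coefficients of [e] in
   [int ((mu + e nu) . x) ^ (2 m) = A_m |mu + e nu| ^ (2 m)]. *)
Lemma sphere_moment_polarization (nu : n.-tuple R) m :
  \int[sigma]_(x in sphere) (dotp nu x * dotp mu x ^+ (2 * m).+1) =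
  dotp nu mu * moment m.+1.
Proof.
pose k2 := (2 * m.+1)%N.
have fE e : \int[sigma]_(x in sphere) (dotp (addt mu (scalet e nu)) x ^+ k2) =
    moment m.+1 * (1 + 2 * e * dotp nu mu + e ^+ 2 * dotp nu nu) ^+ m.+1.
  rewrite /Rintegral -[X in fine X]/(sphere_moment m.+1 _).
  rewrite (sphere_momentE n0 mu1)/=; congr (_ * _ ^+ _).
  rewrite dotp_addl ![dotp _ (addt _ _)]dotpC !dotp_addl !dotp_scaletl.
  by rewrite (unit_sphere_dotp mu1) [dotp mu (scalet _ _)]dotpC !dotp_scaletl
    dotpZr; ring.
pose X j := \int[sigma]_(x in sphere) (dotp nu x ^+ j * dotp mu x ^+ (k2 - j)).
have ix j : sigma.-integrable sphere
    (EFin \o (fun x => dotp nu x ^+ j * dotp mu x ^+ (k2 - j))).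
  apply: (@sphere_integrable _ (dotp_bound nu ^+ j * dotp_bound mu ^+ (k2 - j))).
    by apply: measurable_funM; apply: measurable_funX; exact: measurable_dotpl.
  move=> x x1; rewrite normrM !normrX.
  by rewrite ler_pM// lerXn2r ?nnegrE ?dotp_bound_ge0// dotp_le_bound.
(* The same polynomial in e twice: [p] by the binomial formula under the integral, [q] by expanding
   |mu + e nu|^2 with |mu| = 1. The factor 2 (m + 1) is common to both linear coefficients. *)
pose p : {poly R} := \poly_(j < k2.+1) ('C(k2, j)%:R * X j).
pose q : {poly R} := (moment m.+1)%:P *
  (1 + (2 * dotp nu mu)%:P * 'X + (dotp nu nu)%:P * 'X^2) ^+ m.+1.
have pqE e : p.[e] = q.[e].
  transitivity (\int[sigma]_(x in sphere) (dotp (addt mu (scalet e nu)) x ^+ k2)).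
    rewrite horner_poly; transitivity (\int[sigma]_(x in sphere)
        \sum_(j < k2.+1) 'C(k2, j)%:R * e ^+ j * (dotp nu x ^+ j * dotp mu x ^+ (k2 - j))).
      rewrite Rintegral_sum//; last first.
        move=> j; have := integrableZl mS ('C(k2, j)%:R * e ^+ j) (ix j).
        by apply: eq_integrable.
      by apply: eq_bigr => j _; rewrite RintegralZl// mulrAC.
    apply: eq_Rintegral => x _; rewrite dotp_addl dotp_scaletl exprDn.
    by apply: eq_bigr => j _; rewrite exprMn -mulr_natr; ring.
  by rewrite fE /q !hornerE /=; congr (_ * _ ^+ _); ring.
have : p`_1 = q`_1 by rewrite (poly_ext pqE).
have X1 : X 1%N =
    \int[sigma]_(x in sphere) (dotp nu x * dotp mu x ^+ (2 * m).+1).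
  apply: eq_Rintegral => x _; rewrite expr1; congr (_ * _ ^+ _).
  by rewrite /k2 mulnS addSn subn1.
rewrite coef_poly bin1 X1.
have -> : q`_1 = 2 * m.+1%:R * (dotp nu mu * moment m.+1).
  rewrite -[LHS]mulr1n -coef_deriv -horner_coef0 /q derivM derivC mul0r add0r.
  rewrite deriv_exp !derivD -polyC1 !deriv_mulC !derivC derivXn derivX !hornerE /=.
  rewrite hornerMn hornerM horner_exp !hornerE /= expr1n mulr1.
  by rewrite -mulr_natr; ring.
have -> : k2%:R = 2 * m.+1%:R :> R by rewrite natrM.
by rewrite /= => /mulfI; apply; rewrite mulf_neq0// pnatr_eq0.
Qed.

(** Termwise integration by dominated convergence; the sphere has finite mass, so the constant [B]
    is an integrable bound for all partial sums. *)
Lemma sphere_integral_exp (h : n.-tuple R -> R) (C kappa : R) :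
  measurable_fun setT h -> (forall x, sphere x -> `|h x| <= C) ->
  series (fun k => kappa ^+ k / k`!%:R *
    \int[sigma]_(x in sphere) (h x * dotp mu x ^+ k)) @ \oo -->
  \int[sigma]_(x in sphere) (h x * expR (kappa * dotp mu x)).
Proof.
move=> mh hC.
have C0 : 0 <= C by rewrite (le_trans _ (hC _ mu1)).
have mmu : measurable_fun setT (dotp mu) by exact: measurable_dotpl.
pose e (x : n.-tuple R) := exp_coeff (kappa * dotp mu x).
have eE x k : e x k = kappa ^+ k / k`!%:R * dotp mu x ^+ k.
  by rewrite /e /exp_coeff /= exprMn; ring.
have me k : measurable_fun setT (fun x => e x k).
  under eq_fun do rewrite eE; apply: measurable_funM => //.
  exact: measurable_funX.
pose B := C * expR (`|kappa| * dotp_bound mu).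
have B0 : 0 <= B by rewrite mulr_ge0// expR_ge0.
have bound N x : sphere x -> `|h x * series (e x) N| <= B.
  move=> x1; rewrite normrM ler_pM ?hC//.
  rewrite (le_trans (ler_norm_sum _ _ _))//.
  have -> : \sum_(0 <= k < N) `|e x k| = series (exp_coeff `|kappa * dotp mu x|) N.
    by rewrite -normed_series_exp_coeff.
  apply: (@le_trans _ _ (expR `|kappa * dotp mu x|)).
    have nd : nondecreasing_seq (series (exp_coeff `|kappa * dotp mu x|)).
      by apply/nondecreasing_seqP => k; rewrite seriesSr lerDl exp_coeff_ge0.
    exact: (nondecreasing_cvgn_le nd (is_cvg_series_exp_coeff _) N).
  by rewrite ler_expR normrM ler_wpM2l// dotp_le_bound.
have mf N : measurable_fun setT (fun x => h x * series (e x) N).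
  by apply: measurable_funM => //; exact: measurable_sum.
have [||||| _ _] := @dominated_convergence _ _ _ sigma _ mS
  (fun N x => (h x * series (e x) N)%:E)
  (fun x => (h x * expR (kappa * dotp mu x))%:E) (fun=> B%:E).
- by move=> N; apply/measurable_EFinP/measurable_funTS.
- apply/measurable_EFinP/measurable_funTS/measurable_funM => //.
  by apply: measurableT_comp => //; exact: measurable_funM.
- apply: aeW => x _; apply: cvg_EFin; first exact: nearW.
  by apply: cvgMr; exact: is_cvg_series_exp_coeff.
- apply: (@sphere_integrable _ B) => //.
  by move=> x _; rewrite ger0_norm.
- by apply: aeW => x N x1; rewrite lee_fin bound.
set l := (X in _ --> X) => lim.
have lE : l = (\int[sigma]_(x in sphere) (h x * expR (kappa * dotp mu x)))%:E.
  rewrite /Rintegral fineK//; apply: integrable_fin_num => //.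
  apply: (@sphere_integrable _ B).
    by apply: measurable_funM => //; apply: measurableT_comp => //; exact: measurable_funM.
  move=> x x1; rewrite normrM ler_pM ?hC// ger0_norm ?expR_ge0// ler_expR.
  by rewrite (le_trans (ler_norm _))// normrM ler_wpM2l// dotp_le_bound.
move: lim; rewrite lE => /fine_cvg.
apply: cvg_trans; apply: near_eq_cvg; near=> N => /=.
rewrite -[LHS]/(\int[sigma]_(x in sphere) (h x * series (e x) N)).
have ih k : sigma.-integrable sphere (EFin \o (fun x => h x * dotp mu x ^+ k)).
  apply: (@sphere_integrable _ (C * dotp_bound mu ^+ k)).
    by apply: measurable_funM => //; exact: measurable_funX.
  move=> x x1; rewrite normrM normrX ler_pM ?hC//.
  by rewrite lerXn2r ?nnegrE ?dotp_bound_ge0// dotp_le_bound.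
transitivity (\int[sigma]_(x in sphere)
    (\sum_(0 <= k < N) kappa ^+ k / k`!%:R * (h x * dotp mu x ^+ k))).
  apply: eq_Rintegral => x _; rewrite /series /= mulr_sumr.
  by apply: eq_bigr => k _; rewrite eE; ring.
rewrite Rintegral_sum//.
  by rewrite /series /=; apply: eq_bigr => k _; rewrite RintegralZl.
move=> k; apply: (@sphere_integrable _ (`|kappa ^+ k / k`!%:R| * (C * dotp_bound mu ^+ k))).
  by apply: measurable_funM => //; apply: measurable_funM => //; exact: measurable_funX.
move=> x x1; rewrite normrM ler_wpM2l// normrM normrX ler_pM ?hC//.
by rewrite lerXn2r ?nnegrE ?dotp_bound_ge0// dotp_le_bound.
Unshelve. all: end_near. Qed.

End sphere_integrals.

(** * Bessel series and the mean of the FvML distribution *)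

Section bessel.
Context {R : realType} (n : nat).
Hypothesis n2 : (2 <= n)%N.

(** Up to a power of 2, the coefficients in kappa^2 of I_{n/2-1}(kappa) / kappa^(n/2-1). *)
Definition bessel_coef (m : nat) : R :=
  (4 ^+ m * m`!%:R * Gamma (n%:R / 2 + m%:R))^-1.

Let half_ge1 m : 1 <= n%:R / 2 + m%:R :> R.
Proof.
rewrite (@le_trans _ _ (n%:R / 2)) ?lerDl// ler_pdivlMr// mul1r.
by rewrite ler_nat.
Qed.

Lemma bessel_coef_gt0 m : 0 < bessel_coef m.
Proof.
by rewrite invr_gt0 !mulr_gt0 ?exprn_gt0 ?ltr0n ?fact_gt0// Gamma_gt0.
Qed.

(** From 4 (m + 1) (n/2 + m) = (2m + 2) (n + 2m). Both the matching with the sphere moments and the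
    Bessel equation rest on this recursion. *)
Lemma bessel_coefS m :
  (n + 2 * m)%:R * (2 * m).+2%:R * bessel_coef m.+1 = bessel_coef m.
Proof.
have g0 := lt0r_neq0 (Gamma_gt0 (half_ge1 m)).
rewrite /bessel_coef -(natr1 m) addrA GammaS// factS natrM exprS.
have -> : (2 * m).+2 = (2 * m.+1)%N by lia.
rewrite natrD !natrM -natr1; field.
rewrite g0 [1 + _]addrC natr1 !pnatr_eq0 -lt0n fact_gt0 expf_neq0 ?pnatr_eq0//=.
by rewrite andbT -natrM -natrD pnatr_eq0 -lt0n addn_gt0 (ltn_trans _ n2).
Qed.

Lemma bessel_coef_fact m : bessel_coef m <= bessel_coef 0 / m`!%:R.
Proof.
elim: m => [|m IH]; first by rewrite divr1.
rewrite factS natrM invfM mulrA [_ / m.+1%:R]mulrC -mulrA.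
rewrite ler_pdivlMl ?ltr0n// (le_trans _ IH)// -[leRHS]bessel_coefS.
rewrite ler_pM2r ?bessel_coef_gt0// -natrM ler_nat.
rewrite (@leq_trans (1 * (2 * m).+2)) ?leq_mul//; last by lia.
by rewrite mul1n; lia.
Qed.

Lemma cvg_bessel_series (t : R) : 0 <= t ->
  cvgn (series (fun m => bessel_coef m * t ^+ m)).
Proof.
move=> t0.
apply: (@series_le_cvg _ _ (fun m => bessel_coef 0 * exp_coeff t m)).
- by move=> m; rewrite mulr_ge0 ?exprn_ge0// ltW// bessel_coef_gt0.
- by move=> m; rewrite mulr_ge0 ?exp_coeff_ge0// ltW// bessel_coef_gt0.
- move=> m; rewrite /exp_coeff /= mulrCA mulrC ler_wpM2l ?exprn_ge0//.
  exact: bessel_coef_fact.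
- rewrite (_ : series _ = fun M => bessel_coef 0 * series (exp_coeff t) M).
    by apply: is_cvgMr; exact: is_cvg_series_exp_coeff.
  by apply/funext => M; rewrite /series /= mulr_sumr.
Qed.

Lemma cvg_bessel_dseries (t : R) : 0 <= t ->
  cvgn (series (fun m => m.+1%:R * bessel_coef m.+1 * t ^+ m)).
Proof.
move=> t0; apply: (series_le_cvg _ _ _ (cvg_bessel_series t0)) => m.
- by rewrite !mulr_ge0 ?exprn_ge0// ltW// bessel_coef_gt0.
- by rewrite mulr_ge0 ?exprn_ge0// ltW// bessel_coef_gt0.
rewrite ler_wpM2r ?exprn_ge0// -[leRHS]bessel_coefS.
rewrite ler_pM2r ?bessel_coef_gt0// -natrM ler_nat.
rewrite (@leq_trans (1 * (2 * m).+2)) ?leq_mul//; last by lia.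
by lia.
Qed.

Definition bessel_sum (t : R) := limn (series (fun m => bessel_coef m * t ^+ m)).

Definition bessel_dsum (t : R) :=
  limn (series (fun m => m.+1%:R * bessel_coef m.+1 * t ^+ m)).

Lemma bessel_sum_gt0 t : 0 <= t -> 0 < bessel_sum t.
Proof.
move=> t0; rewrite (@lt_le_trans _ _ (bessel_coef 0))// ?bessel_coef_gt0//.
have nd : nondecreasing_seq (series (fun m => bessel_coef m * t ^+ m)).
  apply/nondecreasing_seqP => k; rewrite seriesSr lerDl.
  by rewrite mulr_ge0 ?exprn_ge0// ltW// bessel_coef_gt0.
have := nondecreasing_cvgn_le nd (cvg_bessel_series t0) 1%N.
by rewrite seriesSr /series /= big_geq// add0r expr0 mulr1.
Qed.

Lemma besselI_predE (kappa : R) : 0 < kappa ->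
  besselI (n%:R / 2 - 1) kappa =
  (kappa / 2) `^ (n%:R / 2 - 1) * bessel_sum (kappa ^+ 2).
Proof.
move=> k0; have k20 : 0 < kappa / 2 by rewrite divr_gt0.
rewrite /besselI (_ : series _ = fun M => (kappa / 2) `^ (n%:R / 2 - 1) *
    series (fun m => bessel_coef m * (kappa ^+ 2) ^+ m) M).
  by apply/cvg_lim => //; apply: cvgMr; exact: cvg_bessel_series (sqr_ge0 _).
apply/funext => M; rewrite /series /= mulr_sumr; apply: eq_bigr => m _.
rewrite powRD ?(gt_eqF k20) ?implybT// powR_mulrn ?ltW//.
have -> : n%:R / 2 - 1 + m%:R + 1 = n%:R / 2 + m%:R :> R by ring.
rewrite /bessel_coef exprM expr_div_n -[in LHS]mulrA; congr (_ * _).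
rewrite expr_div_n (_ : 4 = 2 ^+ 2 :> R); last by ring.
field.
have g0 := lt0r_neq0 (Gamma_gt0 (half_ge1 m)).
by rewrite g0 !pnatr_eq0 -lt0n fact_gt0 !expf_neq0 ?pnatr_eq0.
Qed.

(** The m-th term of I_{n/2} carries the Gamma factor of index m + 1 of I_{n/2-1}, and 1 / m! = (m +
    1) / (m + 1)!: the series is the derivative of [bessel_sum]. *)
Lemma besselIE (kappa : R) : 0 < kappa ->
  besselI (n%:R / 2) kappa =
  (kappa / 2) `^ (n%:R / 2 - 1) * (2 * kappa * bessel_dsum (kappa ^+ 2)).
Proof.
move=> k0; have k20 : 0 < kappa / 2 by rewrite divr_gt0.
rewrite /besselI (_ : series _ = fun M => (kappa / 2) `^ (n%:R / 2 - 1) *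
    (2 * kappa * series (fun m => m.+1%:R * bessel_coef m.+1 * (kappa ^+ 2) ^+ m) M)).
  apply/cvg_lim => //; apply: cvgMr; apply: cvgMr.
  exact: cvg_bessel_dseries (sqr_ge0 _).
apply/funext => M; rewrite /series /= !mulr_sumr; apply: eq_bigr => m _.
have -> : n%:R / 2 + (2 * m)%:R = (n%:R / 2 - 1) + (2 * m).+1%:R :> R.
  by rewrite -natr1; ring.
rewrite powRD ?(gt_eqF k20) ?implybT// powR_mulrn ?ltW//.
have -> : n%:R / 2 + m%:R + 1 = n%:R / 2 + m.+1%:R :> R by rewrite -natr1; ring.
rewrite /bessel_coef [4 ^+ m.+1]exprS [(kappa / 2) ^+ _]exprS exprM -[in LHS]mulrA.
congr (_ * _); rewrite !expr_div_n factS natrM (_ : 4 = 2 ^+ 2 :> R); last by ring.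
field; have g0 := lt0r_neq0 (Gamma_gt0 (half_ge1 m.+1)).
by rewrite g0 [1 + _]addrC natr1 !pnatr_eq0 -lt0n fact_gt0 !expf_neq0 ?pnatr_eq0.
Qed.

Lemma bessel_ratioE (kappa : R) : 0 < kappa ->
  bessel_ratio n kappa =
  2 * kappa * bessel_dsum (kappa ^+ 2) / bessel_sum (kappa ^+ 2).
Proof.
move=> k0; rewrite /bessel_ratio besselI_predE// besselIE//.
have p0 : (kappa / 2) `^ (n%:R / 2 - 1) != 0.
  by rewrite gt_eqF// powR_gt0// divr_gt0.
by field; rewrite p0 gt_eqF// bessel_sum_gt0// sqr_ge0.
Qed.

End bessel.

(** * Exponential integrals over the sphere as Bessel series, and the FvML mean *)

Section sphere_bessel.
Context {R : realType} (n : nat) (mu : n.-tuple R).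
Hypotheses (n2 : (2 <= n)%N) (mu1 : unit_sphere mu).
Local Notation sphere := (@unit_sphere R n).
Local Notation sigma := (@surface_measure R n).
Local Notation moment m := (fine (sphere_moment m mu)).

Let n0 : (0 < n)%N. Proof. by rewrite (ltn_trans _ n2). Qed.

(** The common ratio, over all m, of moment m / (2m)! to [bessel_coef n m]; it cancels in the
    mean. *)
Definition sphere_bessel_const : R := moment 0 / bessel_coef n 0.

Lemma sphere_bessel_const_gt0 : 0 < sphere_bessel_const.
Proof. by rewrite divr_gt0 ?moment_gt0// bessel_coef_gt0. Qed.

(** Up to the factor (2m)!, [sphere_momentS] and [bessel_coefS] are the same recursion. *)
Lemma moment_bessel m :
  moment m = (2 * m)`!%:R * (sphere_bessel_const * bessel_coef n m).
Proof.
elim: m => [|m IH].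
  by rewrite muln0 fact0 mul1r divfK// gt_eqF// bessel_coef_gt0.
have nm0 : (n + 2 * m)%:R != 0 :> R by rewrite pnatr_eq0 -lt0n addn_gt0 n0.
apply: (mulfI nm0); rewrite sphere_momentS// IH -(bessel_coefS n2 m).
have -> : (2 * m.+1 = (2 * m).+2)%N by lia.
by rewrite !factS !natrM; ring.
Qed.

Let mdot (t : n.-tuple R) : measurable_fun setT (dotp t).
Proof. exact: measurable_dotpl. Qed.

Let dotpN (t x : n.-tuple R) : dotp t (scalet (-1) x) = - dotp t x.
Proof. by rewrite dotpZr mulN1r. Qed.

Let cvg_even (u : R^nat) (l : R) :
  series u @ \oo --> l -> (series u (2 * M)%N) @[M --> \oo] --> l.
Proof.
apply: cvg_comp; apply/cvgnyPge => A; near=> M.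
by rewrite (leq_trans (_ : A <= M)%N) ?leq_pmull//; near: M; exact: nbhs_infty_ge.
Unshelve. all: end_near. Qed.

(** Odd powers integrate to 0, so the limit is taken along the partial sums of even length. *)
Lemma sphere_integral_expE (kappa : R) :
  \int[sigma]_(x in sphere) expR (kappa * dotp mu x) =
  sphere_bessel_const * bessel_sum n (kappa ^+ 2).
Proof.
pose u k := kappa ^+ k / k`!%:R *
  \int[sigma]_(x in sphere) (1 * dotp mu x ^+ k).
have : series u @ \oo --> \int[sigma]_(x in sphere) (1 * expR (kappa * dotp mu x)).
  apply: (@sphere_integral_exp R n mu n0 mu1 (fun=> 1) 1); first exact: measurable_cst.
  by move=> x _; rewrite normr1.
under eq_Rintegral do rewrite mul1r.
move=> /cvg_even h; rewrite -(cvg_lim _ h)//; apply/cvg_lim => //.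
rewrite (_ : (fun M => series u (2 * M)%N) = fun M => sphere_bessel_const *
    series (fun m => bessel_coef n m * (kappa ^+ 2) ^+ m) M).
  by apply: cvgMr; apply: cvg_bessel_series => //; exact: sqr_ge0.
have odd0 m : u (2 * m).+1 = 0.
  rewrite /u sphere_integral_odd ?mulr0//.
    by apply: measurable_funM => //; exact: measurable_funX.
  by move=> x; rewrite !mul1r dotpN exprS exprM sqrrN -exprM mulNr -exprS.
have even m : u (2 * m)%N =
    sphere_bessel_const * (bessel_coef n m * (kappa ^+ 2) ^+ m).
  rewrite /u; under eq_Rintegral do rewrite mul1r.
  rewrite -[X in _ * X]/(moment m) moment_bessel exprM.
  by field; rewrite pnatr_eq0 -lt0n fact_gt0.
apply/funext; elim=> [|M IH]; first by rewrite muln0 /series /= !big_geq// mulr0.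
by rewrite mulnS !addSn add0n !seriesSr IH odd0 even addr0 mulrDr.
Qed.

(** Here the even powers vanish, and [sphere_moment_polarization] evaluates the odd ones. *)
Lemma sphere_integral_dotp_expE (kappa : R) (nu : n.-tuple R) :
  \int[sigma]_(x in sphere) (dotp nu x * expR (kappa * dotp mu x)) =
  dotp nu mu * (sphere_bessel_const * (2 * kappa * bessel_dsum n (kappa ^+ 2))).
Proof.
pose u k := kappa ^+ k / k`!%:R *
  \int[sigma]_(x in sphere) (dotp nu x * dotp mu x ^+ k).
have h := @sphere_integral_exp R n mu n0 mu1 _ _ kappa (mdot nu) (@dotp_le_bound R n nu).
have {}h : series u (2 * M)%N @[M --> \oo] --> _ := cvg_even h.
rewrite -(cvg_lim _ h)//; apply/cvg_lim => //.
rewrite (_ : (fun M => series u (2 * M)%N) = fun M => dotp nu mu * (sphere_bessel_const *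
    (2 * kappa * series (fun m => m.+1%:R * bessel_coef n m.+1 * (kappa ^+ 2) ^+ m) M))).
  do 3 apply: cvgMr; apply: cvg_bessel_dseries => //; exact: sqr_ge0.
have even0 m : u (2 * m)%N = 0.
  rewrite /u sphere_integral_odd ?mulr0//.
    by apply: measurable_funM => //; exact: measurable_funX.
  by move=> x; rewrite !dotpN exprM sqrrN -exprM mulNr.
have odd m : u (2 * m).+1 = dotp nu mu * (sphere_bessel_const *
    (2 * kappa * (m.+1%:R * bessel_coef n m.+1 * (kappa ^+ 2) ^+ m))).
  rewrite /u sphere_moment_polarization// moment_bessel.
  have -> : (2 * m.+1 = (2 * m).+2)%N by lia.
  rewrite exprS exprM [((2 * m).+2)`!]factS natrM.
  have -> : (2 * m).+2%:R = 2 * m.+1%:R :> R by rewrite -natrM; congr _%:R; lia.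
  by field; rewrite pnatr_eq0 -lt0n fact_gt0.
apply/funext; elim=> [|M IH]; first by rewrite muln0 /series /= !big_geq// !mulr0.
by rewrite mulnS !addSn add0n !seriesSr IH even0 odd addr0 !mulrDr.
Qed.

Lemma fvml_const_ge0 (kappa : R) : 0 < kappa -> 0 <= @fvml_const R n kappa.
Proof.
move=> k0; rewrite /fvml_const besselI_predE// divr_ge0 ?powR_ge0//.
by rewrite !mulr_ge0 ?powR_ge0// ltW// bessel_sum_gt0// sqr_ge0.
Qed.

Lemma measurable_fvml_density (kappa : R) :
  measurable_fun setT (fvml_density mu kappa).
Proof.
apply: measurable_funM => //; apply: measurableT_comp => //.
exact: measurable_funM.
Qed.

Section distribution.
Context d (T : measurableType d) (P : probability T R).
Variables (X : {RV P >-> n.-tuple R}) (kappa : R).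
Hypotheses (k0 : 0 < kappa)
  (XP : forall E, measurable E -> distribution P X E = fvml mu kappa E).

Let f0 x : 0 <= fvml_density mu kappa x.
Proof. by rewrite mulr_ge0 ?expR_ge0// fvml_const_ge0. Qed.

Lemma ge0_integral_fvml (g : n.-tuple R -> \bar R) :
  measurable_fun setT g -> (forall x, 0 <= g x)%E ->
  (\int[P]_w g (X w) =
   \int[sigma]_(x in sphere) (g x * (fvml_density mu kappa x)%:E))%E.
Proof.
move=> mg g0.
have nuE (A : set (n.-tuple R)) : measurable A ->
    (1%:E * distribution P X A =
     \int[sigma]_(x in id @^-1` A) (fvml_density mu kappa x)%:E)%E.
  by move=> mA; rewrite mul1e XP.
have := ge0_integral_density (@measurable_id _ _ setT) (measurable_fvml_density kappa) f0 nuE mg g0.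
rewrite mul1e ge0_integral_distribution// => ->.
rewrite integral_surface_sphere//.
- apply: emeasurable_funM => //; apply/measurable_EFinP.
  exact: measurable_fvml_density.
- by move=> x; rewrite mule_ge0// lee_fin.
Qed.

Lemma integral_fvml (g : n.-tuple R -> R) : measurable_fun setT g ->
  \int[P]_w g (X w) =
  \int[sigma]_(x in sphere) (g x * fvml_density mu kappa x).
Proof.
move=> mg.
have mEg : measurable_fun setT (fun x => (g x)%:E) by exact/measurable_EFinP.
rewrite /Rintegral integralE [in RHS]integralE; congr (fine (_ - _)%E).
- transitivity (\int[P]_w (fun x => (g x)%:E)^\+ (X w))%E.
    by apply: eq_integral => w _; rewrite !funeposE.
  rewrite (ge0_integral_fvml (measurable_funepos mEg))//.
  apply: eq_integral => x _; rewrite !funeposE -EFin_max -EFinM -EFin_max.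
  by rewrite maxr_pMl// mul0r.
- transitivity (\int[P]_w (fun x => (g x)%:E)^\- (X w))%E.
    by apply: eq_integral => w _; rewrite !funenegE.
  rewrite (ge0_integral_fvml (measurable_funeneg mEg))//.
  apply: eq_integral => x _; rewrite !funenegE -!EFinN -EFin_max -EFinM -EFin_max.
  by rewrite maxr_pMl// mul0r mulNr.
Qed.

Lemma fvml_sphere : P (X @^-1` (~` sphere)) = 0%E.
Proof.
have mN : measurable (~` sphere) by apply: measurableC; exact: measurable_unit_sphere.
have mXN : measurable (X @^-1` (~` sphere)).
  by rewrite -[Y in measurable Y]setTI; exact: measurable_funPT.
transitivity (\int[P]_w (\1_(~` sphere) (X w))%:E)%E.
  rewrite -[in LHS](setIT (X @^-1` _)); apply/esym.
  exact: (integral_indic P measurableT mXN).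
rewrite (ge0_integral_fvml (g := fun x => (\1_(~` sphere) x)%:E)).
- apply: integral0_eq => x x1; rewrite indicE memNset ?mul0e//.
- by apply/measurable_EFinP; exact: measurable_indic.
- by move=> x; rewrite lee_fin indicE.
Qed.

Lemma fvml_mean (nu : n.-tuple R) :
  \int[P]_w dotp nu (X w) = dotp nu mu * bessel_ratio n kappa.
Proof.
have exp_bound x : sphere x ->
    `|expR (kappa * dotp mu x)| <= expR (`|kappa| * dotp_bound mu).
  move=> x1; rewrite ger0_norm ?expR_ge0// ler_expR (le_trans (ler_norm _))//.
  by rewrite normrM ler_wpM2l// dotp_le_bound.
(* The constant is determined by the total mass 1 of the law of [X], not by evaluating its
   formula. *)
have norm : fvml_const n kappa * (sphere_bessel_const * bessel_sum n (kappa ^+ 2)) = 1.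
  have := integral_fvml (@measurable_cst _ _ _ _ setT (1 : R)).
  rewrite Rintegral_cst// [X in fine X](@probability_setT _ _ _ P)/= mul1r => ->.
  rewrite -sphere_integral_expE -RintegralZl//; last 2 first.
  - exact: measurable_unit_sphere.
  - apply: (@sphere_integrable _ _ mu n0 mu1 _ (expR (`|kappa| * dotp_bound mu))).
      by apply: measurableT_comp => //; exact: measurable_funM.
    exact: exp_bound.
  by apply: eq_Rintegral => x _; rewrite mul1r.
rewrite integral_fvml//.
transitivity (\int[sigma]_(x in sphere) (fvml_const n kappa *
   (dotp nu x * expR (kappa * dotp mu x)))).
  by apply: eq_Rintegral => x _; rewrite /fvml_density mulrCA.
rewrite RintegralZl//; last 2 first.
- exact: measurable_unit_sphere.
- apply: (@sphere_integrable _ _ mu n0 mu1 _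
    (dotp_bound nu * expR (`|kappa| * dotp_bound mu))).
    apply: measurable_funM => //.
    by apply: measurableT_comp => //; exact: measurable_funM.
  by move=> x x1; rewrite normrM ler_pM ?exp_bound// dotp_le_bound.
rewrite sphere_integral_dotp_expE bessel_ratioE//.
have s0 := lt0r_neq0 (bessel_sum_gt0 n2 (sqr_ge0 kappa)).
have c0 := lt0r_neq0 sphere_bessel_const_gt0.
have -> : fvml_const n kappa = (sphere_bessel_const * bessel_sum n (kappa ^+ 2))^-1.
  by apply: (mulIf (mulf_neq0 c0 s0)); rewrite norm mulVf// mulf_neq0.
by field; rewrite s0 c0.
Qed.

End distribution.

End sphere_bessel.

(** * Unbiasedness *)

Section unbiased.
Context d (T : measurableType d) {R : realType} (P : probability T R).
Context (n N : nat) (X : 'I_N -> {RV P >-> n.-tuple R}).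

(** Reduction to a product over all of ['I_N]: the factors are transported along [f], and an index
    outside its image receives the empty product 1. *)
Lemma indep_prod_inj (I : finType) (f : I -> 'I_N) (G : I -> n.-tuple R -> R) :
  mutually_independent X -> injective f ->
  (forall i, measurable_fun setT (G i)) -> (forall i x, `|G i x| <= 1) ->
  \int[P]_w (\prod_i G i (X (f i) w)) = \prod_i \int[P]_w G i (X (f i) w).
Proof.
move=> indX injf mG G1.
pose H j x := \prod_(i | f i == j) G i x.
have mH j : measurable_fun setT (H j).
  rewrite /H; under eq_fun do rewrite -big_filter.
  by apply: measurable_prod => i _.
have H1 j x : `|H j x| <= 1.
  by rewrite normr_prod prodr_ile1// => i _; rewrite normr_ge0 G1.
have part (F : I -> R) : \prod_i F i = \prod_j \prod_(i | f i == j) F i.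
  by rewrite (partition_big f predT).
transitivity (\int[P]_w (\prod_j H j (X j w))).
  apply: eq_Rintegral => w _; rewrite part; apply: eq_bigr => j _.
  by apply: eq_bigr => i /eqP ->.
rewrite (indep_prod indX mH H1) [RHS]part; apply: eq_bigr => j _.
have [[i ij]|nj] := pselect (exists i, f i = j).
  have fj k : (f k == j) = (k == i) by rewrite -ij (inj_eq injf).
  rewrite (eq_bigl _ _ fj) big_pred1_eq ij; apply: eq_Rintegral => w _.
  by rewrite /H (eq_bigl _ _ fj) big_pred1_eq.
have fj k : (f k == j) = false by apply/eqP => fk; apply: nj; exists k.
rewrite [RHS]big_pred0//; under eq_Rintegral do rewrite /H big_pred0//.
by rewrite Rintegral_cst// [X in fine X](@probability_setT _ _ _ P) /= mulr1.
Qed.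

Hypothesis n2 : (2 <= n)%N.
Variables (mu : n.-tuple R) (kappa : R).
Hypotheses (mu1 : unit_sphere mu) (k0 : 0 < kappa) (iidX : iid_fvml X mu kappa).
Local Notation sphere := (@unit_sphere R n).

Let n0 : (0 < n)%N. Proof. by rewrite (ltn_trans _ n2). Qed.

(* The cutoff makes the coordinates bounded everywhere, as [indep_prod] requires. *)
Let coord (a : 'I_n) (x : n.-tuple R) : R := tnth x a * \1_sphere x.

Let mcoord a : measurable_fun setT (coord a).
Proof.
apply: measurable_funM; first exact: measurable_tnth.
by apply: measurable_indic; exact: measurable_unit_sphere.
Qed.

Let coord_le1 a x : `|coord a x| <= 1.
Proof.
rewrite /coord indicE; have [|_] := boolP (x \in _); last by rewrite mulr0 normr0.
by rewrite inE mulr1; exact: sphere_coord.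
Qed.

Let coord_mean a i :
  \int[P]_w coord a (X i w) = tnth mu a * bessel_ratio n kappa.
Proof.
pose e : n.-tuple R := [tuple (k == a)%:R | k < n].
have dotpe x : dotp e x = tnth x a.
  rewrite /dotp (bigD1 a)//= tnth_mktuple eqxx mul1r big1 ?addr0// => k ka.
  by rewrite tnth_mktuple (negbTE ka) mul0r.
have [_ /(_ i) XP] := iidX.
rewrite -dotpe -(fvml_mean n2 mu1 k0 XP) !(integral_fvml n2 k0 XP)//.
  apply: eq_Rintegral => x /[1!inE] x1.
  by rewrite /coord indicE mem_set// mulr1 dotpe.
exact: measurable_dotpl.
Qed.

Let cut (x : 'I_N -> n.-tuple R) (i : 'I_N) : n.-tuple R :=
  [tuple coord a (x i) | a < n].

(** Expanding every scalar product into coordinates gives products of 2l factors in distinct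
    variables, each of mean mu_a A_n(kappa). Summing over [a] leaves A_n(kappa)^(2l), as the squares
    of the mu_a sum to 1; [N ^_ (2 * l)] counts the tuples. *)
Lemma Dstat_mean l :
  \int[P]_w Dstat l (cut (fun i => X i w)) =
  (N ^_ (2 * l))%:R * bessel_ratio n kappa ^+ (2 * l).
Proof.
(* The 2l positions are indexed by a pair number and a side, which separates the two ends of each
   scalar product. *)
pose f (t : (2 * l).-tuple 'I_N) (p : 'I_l * bool) : 'I_N :=
  tnth t (if p.2 then pair_snd p.1 else pair_fst p.1).
have injf (t : (2 * l).-tuple 'I_N) : uniq t -> injective (f t).
  move=> ut [k b] [k' b'] /((tuple_uniqP _ ut) _ _)/(congr1 val).
  by case: b; case: b' => /= kk; congr pair; try apply: val_inj => /=; lia.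
pose F (t : (2 * l).-tuple 'I_N) (a : {ffun 'I_l -> 'I_n}) w :=
  \prod_(p : 'I_l * bool) coord (a p.1) (X (f t p) w).
have DE w : Dstat l (cut (fun i => X i w)) =
    \sum_(t : (2 * l).-tuple 'I_N | uniq t) \sum_(a : {ffun 'I_l -> 'I_n}) F t a w.
  apply: eq_bigr => t _; rewrite /dotp bigA_distr_bigA; apply: eq_bigr => a _.
  rewrite /F -(pair_bigA _ (fun k b => coord (a k) (X (f t (k, b)) w)))/=.
  apply: eq_bigr => k _; rewrite !tnth_mktuple.
  by rewrite (bigD1 true)//= (bigD1 false)//= big1 ?mulr1 1?mulrC// => -[].
have Fb t a w : `|F t a w| <= 1.
  by rewrite normr_prod prodr_ile1// => p _; rewrite normr_ge0 coord_le1.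
have mF t a : measurable_fun setT (F t a).
  by apply: measurable_prod => p _; exact: measurableT_comp.
have iF t a : P.-integrable setT (EFin \o F t a).
  by apply: (@bounded_RV_integrable _ _ _ P (F t a) 1).
have EF (t : (2 * l).-tuple 'I_N) (a : {ffun 'I_l -> 'I_n}) : uniq t ->
    \int[P]_w F t a w = \prod_(k < l) (tnth mu (a k) * bessel_ratio n kappa) ^+ 2.
  move=> ut; have [indX _] := iidX.
  rewrite (indep_prod_inj (G := fun p => coord (a p.1)) indX (injf _ ut))//.
  under eq_bigr do rewrite coord_mean.
  rewrite -(pair_bigA _ (fun k b => tnth mu (a k) * bessel_ratio n kappa))/=.
  by apply: eq_bigr => k _; rewrite prodr_const card_bool.
under eq_Rintegral do rewrite DE big_mkcond.
rewrite Rintegral_sum//; last first.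
  move=> t; case: (uniq t).
    apply: (@bounded_RV_integrable _ _ _ P _ #|{ffun 'I_l -> 'I_n}|%:R).
      by apply: measurable_sum.
    move=> w; rewrite (le_trans (ler_norm_sum _ _ _))//.
    by rewrite -sum1_card natr_sum ler_sum.
  by apply: (@bounded_RV_integrable _ _ _ P _ 0) => // w; rewrite normr0.
transitivity (\sum_(t : (2 * l).-tuple 'I_N | uniq t) bessel_ratio n kappa ^+ (2 * l)).
  rewrite [RHS]big_mkcond; apply: eq_bigr => t _; case: ifP => [ut|_]; last first.
    by rewrite Rintegral_cst// mul0r.
  rewrite Rintegral_sum//; under eq_bigr do rewrite EF//.
  rewrite -(bigA_distr_bigA (fun (k : 'I_l) a => (tnth mu a * bessel_ratio n kappa) ^+ 2)).
  under eq_bigr do under eq_bigr do rewrite exprMn.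
  under eq_bigr do rewrite -mulr_suml.
  have -> : \sum_i tnth mu i ^+ 2 = 1.
    by rewrite -(unit_sphere_dotp mu1); apply: eq_bigr => i _; rewrite expr2.
  by rewrite mul1r prodr_const card_ord exprM.
rewrite sumr_const mulr_natl; congr (_ *+ _).
transitivity #|[set t : (2 * l).-tuple 'I_N | all predT t & uniq t]|.
  by apply: eq_card => t; rewrite !inE all_predT.
by rewrite card_uniq_tuples card_ord.
Qed.

Let measurable_Dstat (Y : 'I_N -> T -> n.-tuple R) l :
  (forall i, measurable_fun setT (Y i)) ->
  measurable_fun setT (fun w => Dstat l (fun i => Y i w)).
Proof.
move=> mY; rewrite /Dstat; under eq_fun do rewrite -big_filter.
apply: measurable_sum => t; apply: measurable_prod => k _.
apply: measurable_sum => a.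
by apply: measurable_funM; exact: (measurableT_comp (measurable_tnth a) (mY _)).
Qed.

Let measurable_zeta_hat (Y : 'I_N -> T -> n.-tuple R) M :
  (forall i, measurable_fun setT (Y i)) ->
  measurable_fun setT (fun w => zeta_hat M (fun i => Y i w)).
Proof.
move=> mY; apply: measurable_sum => l; apply: measurable_funM => //.
by apply: measurable_funM => //; exact: measurable_Dstat.
Qed.

Let mcut i : measurable_fun setT (fun w => cut (fun j => X j w) i).
Proof.
apply/measurable_fun_tnthP => a; rewrite (_ : _ \o _ = fun w => coord a (X i w)).
  exact: measurableT_comp.
by apply/funext => w /=; rewrite tnth_mktuple.
Qed.

Let Dstat_cut_integrable l :
  P.-integrable setT (EFin \o (fun w => Dstat l (cut (fun i => X i w)))).
Proof.
apply: (@bounded_RV_integrable _ _ _ P _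
    (\sum_(t : (2 * l).-tuple 'I_N | uniq t) \prod_(k < l) n%:R)).
  by apply: measurable_Dstat => i; exact: mcut.
move=> w; rewrite (le_trans (ler_norm_sum _ _ _))// ler_sum// => t _.
rewrite normr_prod ler_prod// => k _; rewrite normr_ge0/=.
rewrite (le_trans (ler_norm_sum _ _ _))// -[leRHS]mulr1 mulr_natl.
rewrite -[X in _ *+ X]card_ord -sumr_const ler_sum// => a _.
by rewrite normrM !tnth_mktuple mulr_ile1.
Qed.

Lemma zeta_hat_unbiased M : (2 * M <= N)%N ->
  ('E_P[fun w => zeta_hat M (fun i => X i w)])%E = (zeta n M kappa)%:E.
Proof.
move=> MN; rewrite expectation.unlock.
(* All [X i] lie on the sphere almost surely, and there the cutoff changes nothing. *)
transitivity (\int[P]_w (zeta_hat M (cut (fun i => X i w)))%:E)%E.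
  apply: ae_eq_integral => //.
  - by apply/measurable_EFinP; exact: measurable_zeta_hat.
  - by apply/measurable_EFinP; apply: measurable_zeta_hat => i; exact: mcut.
  have onsphere i : {ae P, forall w, sphere (X i w)}.
    have [_ /(_ i) XP] := iidX.
    exists (X i @^-1` (~` sphere)); split => //.
    - rewrite -[Y in measurable Y]setTI; apply: measurable_funPT => //.
      by apply: measurableC; exact: measurable_unit_sphere.
    - exact: (fvml_sphere n2 k0 XP).
  have := filter_forall (ae_filter_ringOfSetsType P) onsphere; apply: filterS => w h _.
  congr (zeta_hat M _)%:E; apply/funext => i; apply: eq_from_tnth => a.
  by rewrite tnth_mktuple /coord indicE mem_set ?mulr1//; exact: h.
have iterm l : P.-integrable setT (EFin \o (fun w =>
    ccoef R n l * Dstat l (cut (fun i => X i w)) / (N ^_ (2 * l))%:R)).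
  have := integrableZl measurableT (ccoef R n l / (N ^_ (2 * l))%:R)
    (Dstat_cut_integrable l).
  by apply: eq_integrable => // w _ /=; rewrite -EFinM; congr EFin; ring.
have iZ : P.-integrable setT (EFin \o (fun w => zeta_hat M (cut (fun i => X i w)))).
  have := @integrable_sum _ _ _ P setT measurableT _ (index_iota 1 M.+1) xpredT _ (fun l _ => iterm l).
  by apply: eq_integrable => // w _ /=; rewrite sumEFin.
rewrite -[LHS]fineK; last exact: integrable_fin_num iZ.
congr EFin; rewrite -[LHS]/(\int[P]_w _) Rintegral_sum//.
rewrite /zeta !big_nat; apply: eq_bigr => l /andP[_ lM].
transitivity (\int[P]_w (ccoef R n l / (N ^_ (2 * l))%:R * Dstat l (cut (fun i => X i w)))).
  by apply: eq_Rintegral => w _; ring.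
rewrite RintegralZl// Dstat_mean -mulrA; congr (_ * _).
(* The falling factorial is nonzero because 2l <= 2M <= N. *)
rewrite mulKf// pnatr_eq0 -lt0n ffact_gt0 (leq_trans _ MN)// leq_mul2l/=.
by rewrite -ltnS.
Qed.

End unbiased.

(** * Formal power series *)

Section formal_series.
Context {R : realType}.

(** A separate name for sequences, to carry the Cauchy product as ring multiplication. *)
Definition fps : Type := nat -> R.

HB.instance Definition _ := gen_eqMixin fps.
HB.instance Definition _ := gen_choiceMixin fps.

Implicit Types u v w : fps.

Definition fps_add u v : fps := fun k => u k + v k.
Definition fps_opp u : fps := fun k => - u k.
Definition fps_zero : fps := fun=> 0.
Definition fps_one : fps := fun k => (k == 0%N)%:R.
Definition fps_mul u v : fps := cauchy_prod u v.

(** Coefficients of a product below [K] depend only on truncations, so associativity and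
    commutativity are inherited from polynomials. *)
Let trunc K u : {poly R} := \poly_(i < K) u i.

Let fps_mul_trunc K u v k : (k < K)%N ->
  fps_mul u v k = (trunc K u * trunc K v)`_k.
Proof.
move=> kK; rewrite coefM; apply: eq_bigr => i _; rewrite !coef_poly.
by rewrite (leq_ltn_trans _ kK) ?leq_ord// (leq_ltn_trans _ kK)// leq_subr.
Qed.

Let trunc_mul K u v k : (k < K)%N -> (trunc K (fps_mul u v))`_k = (trunc K u * trunc K v)`_k.
Proof. by move=> kK; rewrite coef_poly kK; exact: fps_mul_trunc. Qed.

Let fps_mulA : associative fps_mul.
Proof.
move=> u v w; apply/funext => k.
rewrite (fps_mul_trunc _ _ (ltnSn k)) [RHS](fps_mul_trunc _ _ (ltnSn k)).
transitivity ((trunc k.+1 u * (trunc k.+1 v * trunc k.+1 w))`_k).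
  rewrite !coefM; apply: eq_bigr => i _; congr (_ * _).
  by rewrite trunc_mul// ltnS leq_subr.
rewrite mulrA [LHS]coefM [RHS]coefM; apply: eq_bigr => i _; congr (_ * _).
by rewrite trunc_mul.
Qed.

Let fps_mulC : commutative fps_mul.
Proof.
move=> u v; apply/funext => k.
by rewrite !(fps_mul_trunc _ _ (ltnSn k)) mulrC.
Qed.

Let fps_mul1 : left_id fps_one fps_mul.
Proof.
move=> u; apply/funext => k; rewrite /fps_mul /cauchy_prod big_ord_recl /=.
by rewrite /fps_one eqxx mul1r subn0 big1 ?addr0// => i _; rewrite mul0r.
Qed.

Let fps_mulDl : left_distributive fps_mul fps_add.
Proof.
move=> u v w; apply/funext => k; rewrite /fps_mul /cauchy_prod /fps_add.
by rewrite -big_split; apply: eq_bigr => i _; rewrite mulrDl.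
Qed.

Let fps_addA : associative fps_add.
Proof. by move=> u v w; apply/funext => k; exact: addrA. Qed.
Let fps_addC : commutative fps_add.
Proof. by move=> u v; apply/funext => k; exact: addrC. Qed.
Let fps_add0 : left_id fps_zero fps_add.
Proof. by move=> u; apply/funext => k; exact: add0r. Qed.
Let fps_addN : left_inverse fps_zero fps_opp fps_add.
Proof. by move=> u; apply/funext => k; exact: addNr. Qed.

HB.instance Definition _ :=
  GRing.isZmodule.Build fps fps_addA fps_addC fps_add0 fps_addN.

Let fps_one_neq0 : fps_one != 0 :> fps.
Proof.
apply/eqP => /(congr1 (fun u : fps => u 0%N)); rewrite /fps_one eqxx.
by move/eqP; rewrite oner_eq0.
Qed.

HB.instance Definition _ := GRing.Zmodule_isComNzRing.Build fps
  fps_mulA fps_mulC fps_mul1 fps_mulDl fps_one_neq0.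

Lemma fps_coefD u v k : (u + v) k = u k + v k. Proof. by []. Qed.
Lemma fps_coefN u k : (- u) k = - u k. Proof. by []. Qed.
Lemma fps_coef0 k : (0 : fps) k = 0. Proof. by []. Qed.
Lemma fps_coef1 k : (1 : fps) k = (k == 0%N)%:R. Proof. by []. Qed.
Lemma fps_coefM u v k : (u * v) k = \sum_(i < k.+1) u i * v (k - i)%N.
Proof. by []. Qed.

Lemma fps_coefMn u m k : (u *+ m) k = u k *+ m.
Proof. by elim: m => // m IH; rewrite !mulrS fps_coefD IH. Qed.

Lemma fps_coef_sum (I : Type) (s : seq I) (F : I -> fps) k :
  (\sum_(i <- s) F i) k = \sum_(i <- s) F i k.
Proof.
by elim: s => [|i s IH]; rewrite ?big_nil// !big_cons fps_coefD IH.
Qed.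

Definition fpsC (c : R) : fps := fun k => if k is 0%N then c else 0.
Definition fpsX : fps := fun k => (k == 1%N)%:R.

Lemma fps_coefCM c u k : (fpsC c * u) k = c * u k.
Proof.
rewrite fps_coefM big_ord_recl/= subn0 big1 ?addr0// => i _.
by rewrite mul0r.
Qed.

Lemma fps_coefXM u k : (fpsX * u) k.+1 = u k.
Proof.
rewrite fps_coefM !big_ord_recl/= {1}/fpsX /= mul0r add0r.
by rewrite /fpsX eqxx mul1r subn1 big1 ?addr0// => i _; rewrite mul0r.
Qed.

Lemma fps_coefXM0 u : (fpsX * u) 0%N = 0.
Proof. by rewrite fps_coefM big_ord_recl big_ord0 /fpsX mul0r addr0. Qed.

Lemma fps_coefXnM m u k : (fpsX ^+ m * u) (m + k)%N = u k.
Proof.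
elim: m => [|m IH]; first by rewrite expr0 mul1r.
by rewrite exprS -mulrA addSn fps_coefXM.
Qed.

Lemma fps_coefXnM_lt m u k : (k < m)%N -> (fpsX ^+ m * u) k = 0.
Proof.
elim: m k => // m IH [|k] km; rewrite exprS -mulrA ?fps_coefXM0//.
by rewrite fps_coefXM IH.
Qed.

Lemma cauchy_expE u m : cauchy_exp u m = u ^+ m.
Proof. by elim: m => [//|m IH]; rewrite exprS -IH. Qed.

Lemma fps_coefM0 u v : (u * v) 0%N = u 0%N * v 0%N.
Proof. by rewrite fps_coefM big_ord_recl big_ord0 addr0. Qed.

Lemma fps_coefX0 u m : (u ^+ m) 0%N = u 0%N ^+ m.
Proof. by elim: m => [//|m IH]; rewrite !exprS fps_coefM0 IH. Qed.

(* Euler operator t d/dt *)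
Definition euler u : fps := fun k => k%:R * u k.

Lemma eulerD u v : euler (u + v) = euler u + euler v.
Proof. by apply/funext => k; rewrite /euler !fps_coefD mulrDr. Qed.

Lemma eulerN u : euler (- u) = - euler u.
Proof. by apply/funext => k; rewrite /euler !fps_coefN mulrN. Qed.

Lemma eulerM u v : euler (u * v) = euler u * v + u * euler v.
Proof.
apply/funext => k; rewrite fps_coefD /euler !fps_coefM mulr_sumr -big_split.
apply: eq_bigr => i _ /=.
have -> : k%:R = i%:R + (k - i)%:R :> R by rewrite -natrD subnKC// leq_ord.
ring.
Qed.

Lemma euler1 : euler 1 = 0.
Proof. by apply/funext => -[|k]; rewrite /euler ?mul0r// fps_coef1 mulr0. Qed.

Lemma eulerC c : euler (fpsC c) = 0.
Proof. by apply/funext => -[|k]; rewrite /euler ?mul0r//= mulr0. Qed.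

Lemma eulerX : euler fpsX = fpsX.
Proof. by apply/funext => -[|[|k]]; rewrite /euler /fpsX ?mul0r ?mulr0 ?mul1r. Qed.

Lemma euler_sum (I : Type) (s : seq I) (F : I -> fps) :
  euler (\sum_(i <- s) F i) = \sum_(i <- s) euler (F i).
Proof.
elim: s => [|i s IH]; last by rewrite !big_cons eulerD IH.
by rewrite !big_nil; apply/funext => k; rewrite /euler mulr0.
Qed.

Lemma euler_exp u m : euler (u ^+ m) = u ^+ m.-1 * euler u *+ m.
Proof.
elim: m => [|[|m] IH]; first by rewrite expr0 euler1 mulr0n.
  by rewrite expr1 expr0 mul1r.
by rewrite exprS eulerM IH /= mulrnAr mulrA -exprS [euler u * _]mulrC -mulrS.
Qed.

(** As [p] has no constant term, coefficient k of [p * w] involves only earlier coefficients of [w],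
    and strong induction applies. The resonant indices, where [a k = 0], are left to the third
    hypothesis. *)
Lemma fps_linear_uniq (a : nat -> R) (p w : fps) :
  (forall k, a k * w k = (p * w) k) -> p 0%N = 0 ->
  (forall k, a k = 0 -> w k = 0) -> w = 0.
Proof.
move=> eqw p0 a0; apply/funext => k; have [m] := ubnP k.
elim: m k => // m IH k km; have := eqw k.
rewrite fps_coefM big_ord_recl p0 mul0r add0r big1 => [|i _].
  by move/eqP; rewrite mulf_eq0 => /orP[/eqP/a0//|/eqP].
rewrite IH ?mulr0//; have := ltn_ord i; rewrite /= /bump /=; lia.
Qed.

(* Sending t to kappa^2. *)
Definition fps_even u : fps := fun k => if odd k then 0 else u k./2.

Lemma sum_even_ord (F : nat -> R) m : (forall i, F (2 * i).+1 = 0) ->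
  \sum_(i < (2 * m).+1) F i = \sum_(i < m.+1) F (2 * i)%N.
Proof.
move=> F0; elim: m => [|m IH]; first by rewrite !big_ord_recr !big_ord0.
rewrite mulnS !addSn add0n 2!big_ord_recr/= IH [RHS]big_ord_recr/= F0 addr0.
by rewrite mulnS.
Qed.

Lemma fps_even2 u k : fps_even u (2 * k)%N = u k.
Proof. by rewrite /fps_even mul2n odd_double doubleK. Qed.

Lemma fps_evenM u v : fps_even (u * v) = fps_even u * fps_even v.
Proof.
apply/funext => k; have [ok|ek] := boolP (odd k).
  rewrite {1}/fps_even ok fps_coefM big1// => i _; rewrite /fps_even.
  have := ok; rewrite -[in odd k](subnKC (leq_ord i)) oddD.
  by case: (odd i) => /= [_|->]; rewrite ?mul0r ?mulr0.
have -> : k = (2 * k./2)%N by rewrite mul2n -[LHS]odd_double_half (negbTE ek).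
rewrite fps_even2 !fps_coefM; set m := k./2.
rewrite (@sum_even_ord (fun i => fps_even u i * fps_even v (2 * m - i)%N)).
  by apply: eq_bigr => i _; rewrite -mulnBr !fps_even2.
by move=> i; rewrite /fps_even /= mul2n odd_double mul0r.
Qed.

Lemma fps_evenXn u m : fps_even (u ^+ m) = fps_even u ^+ m.
Proof.
elim: m => [|m IH]; last by rewrite !exprS fps_evenM IH.
by apply/funext => -[|[|k]]; rewrite /fps_even ?fps_coef1//=; case: ifP.
Qed.

Lemma fps_evenX : fps_even fpsX = fpsX ^+ 2.
Proof.
apply/funext => k; rewrite expr2.
case: k => [|[|[|k]]]; rewrite ?fps_coefXM0 ?fps_coefXM /fps_even /fpsX//=.
by case: ifP => //; case: k => [|[|k]].
Qed.

End formal_series.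

(** * Weighted l^1 norms of formal series *)

Section weighted_norm.
Context {R : realType} (r : R).
Hypothesis r0 : 0 < r.
Implicit Types u v : @fps R.

(** A bound on all partial sums, so that no limit is involved in the norm estimates. *)
Definition wnorm_le u (C : R) := forall K, \sum_(k < K) `|u k| * r ^+ k <= C.

Lemma wnorm_coef u C k : wnorm_le u C -> `|u k| * r ^+ k <= C.
Proof.
move=> /(_ k.+1); rewrite big_ord_recr/=; apply: le_trans.
by rewrite lerDr sumr_ge0// => i _; rewrite mulr_ge0// exprn_ge0// ltW.
Qed.

Lemma wnormD u v C D : wnorm_le u C -> wnorm_le v D -> wnorm_le (u + v) (C + D).
Proof.
move=> uC vD K; apply: le_trans (lerD (uC K) (vD K)); rewrite -big_split/=.
by apply: ler_sum => k _; rewrite -mulrDl ler_wpM2r ?exprn_ge0 ?(ltW r0)// ler_normD.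
Qed.

Lemma wnormN u C : wnorm_le u C -> wnorm_le (- u) C.
Proof. by move=> uC K; under eq_bigr do rewrite fps_coefN normrN. Qed.

Lemma wnormM u v C D : wnorm_le u C -> wnorm_le v D -> wnorm_le (u * v) (C * D).
Proof.
move=> uC vD K.
pose a i := `|u i| * r ^+ i; pose b i := `|v i| * r ^+ i.
have a0 i : 0 <= a i by rewrite mulr_ge0// exprn_ge0// ltW.
have b0 i : 0 <= b i by rewrite mulr_ge0// exprn_ge0// ltW.
(* With nonnegative coefficients, P(1) Q(1) is at least the sum of the first [K] coefficients of the
   product. *)
pose P := \poly_(i < K) a i; pose Q := \poly_(i < K) b i.
have P0 i : 0 <= P`_i by rewrite coef_poly; case: ifP.
have Q0 i : 0 <= Q`_i by rewrite coef_poly; case: ifP.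
have PQ0 i : 0 <= (P * Q)`_i by rewrite coefM sumr_ge0// => j _; rewrite mulr_ge0.
apply: (@le_trans _ _ (\sum_(k < K) (P * Q)`_k)).
  apply: ler_sum => k _; rewrite fps_coefM coefM.
  rewrite (le_trans (ler_wpM2r _ (ler_norm_sum _ _ _))) ?exprn_ge0 ?(ltW r0)//.
  rewrite mulr_suml ler_sum// => i _; rewrite !coef_poly.
  rewrite (leq_ltn_trans (leq_ord i)) // (leq_ltn_trans (leq_subr _ _))//.
  rewrite /a /b normrM mulrACA -exprD subnKC// leq_ord//.
have PE : P.[1] <= C.
  rewrite horner_poly; apply: le_trans (uC K).
  by apply: ler_sum => i _; rewrite expr1n mulr1.
have QE : Q.[1] <= D.
  rewrite horner_poly; apply: le_trans (vD K).
  by apply: ler_sum => i _; rewrite expr1n mulr1.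
have P1 : 0 <= P.[1] by rewrite horner_coef sumr_ge0// => i _; rewrite expr1n mulr1.
have Q1 : 0 <= Q.[1] by rewrite horner_coef sumr_ge0// => i _; rewrite expr1n mulr1.
apply: le_trans (ler_pM P1 Q1 PE QE); rewrite -hornerM.
rewrite (horner_coef_wide _ (leq_maxr K (size (P * Q)))).
under [leRHS]eq_bigr do rewrite expr1n mulr1.
rewrite -!(big_mkord xpredT (fun i => (P * Q)`_i)).
rewrite (big_cat_nat _ (leq_maxl K (size (P * Q))))//= lerDl.
by rewrite sumr_ge0.
Qed.

Lemma wnorm1 : wnorm_le 1 1.
Proof.
case=> [|K]; first by rewrite big_ord0.
rewrite big_ord_recl/= expr0 fps_coef1 eqxx normr1 mulr1 big1 ?addr0// => i _.
by rewrite fps_coef1 /= normr0 mul0r.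
Qed.

Lemma wnormXn u C m : wnorm_le u C -> wnorm_le (u ^+ m) (C ^+ m).
Proof.
move=> uC; elim: m => [|m IH]; first by rewrite !expr0; exact: wnorm1.
by rewrite !exprS; exact: wnormM.
Qed.

Lemma wnormC c : wnorm_le (fpsC c) `|c|.
Proof.
case=> [|K]; first by rewrite big_ord0.
rewrite big_ord_recl/= expr0 mulr1 big1 ?addr0// => i _.
by rewrite normr0 mul0r.
Qed.

Lemma wnormX : wnorm_le fpsX r.
Proof.
case=> [|[|K]]; rewrite ?big_ord0 ?(ltW r0)//.
  by rewrite big_ord_recl big_ord0 /fpsX normr0 mul0r addr0 ltW.
rewrite 2!big_ord_recl /fpsX /= normr0 mul0r add0r normr1 mul1r expr1 big1 ?addr0//.
by move=> i _; rewrite mul0r.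
Qed.

Lemma wnorm_sum (I : Type) (s : seq I) (F : I -> @fps R) (C : I -> R) :
  (forall i, wnorm_le (F i) (C i)) ->
  wnorm_le (\sum_(i <- s) F i) (\sum_(i <- s) C i).
Proof.
move=> FC; elim: s => [|i s IH]; last by rewrite !big_cons; exact: wnormD.
rewrite !big_nil => K; rewrite big1// => k _; rewrite fps_coef0 normr0 mul0r//.
Qed.

End weighted_norm.

(** * Evaluation of formal series inside the radius *)

Section evaluation.
Context {R : realType} (r t : R).
Hypotheses (t0 : 0 <= t) (tr : t < r).
Implicit Types u v : @fps R.

Let r0 : 0 < r. Proof. exact: le_lt_trans tr. Qed.
Let q := t / r.
Let q0 : 0 <= q. Proof. by rewrite divr_ge0// ltW. Qed.
Let q1 : q < 1. Proof. by rewrite ltr_pdivrMr// mul1r. Qed.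

Definition fps_term u : R^nat := fun k => u k * t ^+ k.
Definition fps_eval u : R := limn (series (fps_term u)).

Let normed_partial u C K : wnorm_le r u C -> \sum_(0 <= k < K) `|fps_term u k| <= C.
Proof.
move=> uC; rewrite big_mkord; apply: le_trans (uC K); apply: ler_sum => k _.
rewrite normrM ler_wpM2l// normrX ger0_norm// lerXn2r ?nnegrE// ltW//.
Qed.

Lemma fps_eval_cvg u C : wnorm_le r u C ->
  series (fps_term u) @ \oo --> fps_eval u.
Proof.
move=> uC; apply: normed_cvg; apply: nondecreasing_is_cvgn.
  by apply/nondecreasing_seqP => K; rewrite /= /series /= big_nat_recr//= lerDl.
by exists C => _ [K _ <-]; exact: normed_partial.
Qed.

(** For k >= m, t^k = (t/r)^k r^k is at most (t/r)^m r^k. Vanishing to high order thus yields a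
    small value. *)
Lemma fps_eval_tail u C m : wnorm_le r u C ->
  (forall k, (k < m)%N -> u k = 0) -> `|fps_eval u| <= q ^+ m * C.
Proof.
move=> uC um; have uc := fps_eval_cvg uC.
have -> : `|fps_eval u| = limn (fun K => `|series (fps_term u) K|).
  by apply/esym/cvg_lim => //; exact: cvg_norm.
apply: limr_le; first by apply: is_cvg_norm; exact: cvgP uc.
near=> K; rewrite /series /= (le_trans (ler_norm_sum _ _ _))//.
rewrite big_mkord; apply: (@le_trans _ _ (q ^+ m * \sum_(k < K) `|u k| * r ^+ k)).
  rewrite mulr_sumr ler_sum// => k _; have [km|mk] := ltnP k m.
    by rewrite /fps_term um// mul0r normr0 mul0r mulr0.
  rewrite normrM mulrCA ler_wpM2l// normrX (ger0_norm t0).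
  have -> : t ^+ k = q ^+ k * r ^+ k by rewrite -exprMn divfK// gt_eqF.
  rewrite ler_wpM2r ?exprn_ge0 ?(ltW r0)// ler_wiXn2l// ltW//.
by rewrite ler_wpM2l// exprn_ge0.
Unshelve. all: end_near. Qed.

Lemma fps_evalD u v C D : wnorm_le r u C -> wnorm_le r v D ->
  fps_eval (u + v) = fps_eval u + fps_eval v.
Proof.
move=> uC vD; apply/cvg_lim => //.
rewrite (_ : series _ = series (fps_term u) + series (fps_term v)).
  by apply: cvgD; [exact: fps_eval_cvg uC|exact: fps_eval_cvg vD].
rewrite -seriesD; congr series; apply/funext => k.
by rewrite /fps_term fps_coefD mulrDl.
Qed.

Lemma fps_evalN u C : wnorm_le r u C -> fps_eval (- u) = - fps_eval u.
Proof.
move=> uC; apply/cvg_lim => //.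
rewrite (_ : series _ = - series (fps_term u)).
  by apply: cvgN; exact: fps_eval_cvg uC.
rewrite -seriesN; congr series; apply/funext => k.
by rewrite /fps_term fps_coefN mulNr.
Qed.

Definition fps_poly (P : {poly R}) : @fps R := fun k => P`_k.

Lemma fps_polyM P Q : fps_poly (P * Q) = fps_poly P * fps_poly Q.
Proof. by apply/funext => k; rewrite /fps_poly coefM. Qed.

Lemma fps_eval_poly P : fps_eval (fps_poly P) = P.[t].
Proof.
apply/cvg_lim => //; apply: cvg_near_cst; near=> K.
have PK : (size P <= K)%N by near: K; exact: nbhs_infty_ge.
by rewrite (horner_coef_wide _ PK) /series /= big_mkord.
Unshelve. all: end_near. Qed.

Let trunc K u : {poly R} := \poly_(i < K) u i.

Let wnorm_trunc K u C : wnorm_le r u C -> wnorm_le r (fps_poly (trunc K u)) C.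
Proof.
move=> uC L; apply: le_trans (uC L); apply: ler_sum => k _.
rewrite /fps_poly coef_poly; case: ifP => // _.
by rewrite normr0 mul0r mulr_ge0// exprn_ge0// ltW.
Qed.

(** Evaluation is multiplicative on polynomials. The difference between [u * v] and the product of
    the truncations vanishes below degree [K], so [fps_eval_tail] sends it to 0. *)
Lemma fps_evalM u v C D : wnorm_le r u C -> wnorm_le r v D ->
  fps_eval (u * v) = fps_eval u * fps_eval v.
Proof.
move=> uC vD; have uvCD := wnormM r0 uC vD.
have lim1 : (trunc K u).[t] * (trunc K v).[t] @[K --> \oo] --> fps_eval u * fps_eval v.
  have truncE w K : (trunc K w).[t] = series (fps_term w) K.
    by rewrite horner_poly /series /= big_mkord.
  under eq_fun do rewrite !truncE.
  by apply: cvgM; [exact: fps_eval_cvg uC|exact: fps_eval_cvg vD].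
rewrite -(cvg_lim _ lim1)//; apply/esym/cvg_lim => //.
apply/cvgrPdist_le => e e0; near=> K.
rewrite -hornerM -fps_eval_poly fps_polyM.
have n1 := wnormM r0 (wnorm_trunc K uC) (wnorm_trunc K vD).
rewrite -(fps_evalN n1) -(fps_evalD uvCD (wnormN n1)).
rewrite (le_trans (fps_eval_tail (m := K) (wnormD r0 uvCD (wnormN n1)) _))//.
  move=> k kK; rewrite fps_coefD fps_coefN !fps_coefM; apply/eqP.
  rewrite subr_eq0; apply/eqP; apply: eq_bigr => i _; rewrite /fps_poly !coef_poly.
  by rewrite (leq_ltn_trans (leq_ord i) kK) (leq_ltn_trans (leq_subr _ _) kK).
near: K.
have : q ^+ K * (C * D + C * D) @[K --> \oo] --> (0 : R).
  rewrite -(mul0r (C * D + C * D)); apply: cvgMl.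
  by apply: cvg_expr; rewrite ger0_norm.
move/cvgrPdist_le => /(_ e e0); apply: filterS => K.
rewrite sub0r normrN; apply: le_trans; exact: ler_norm.
Unshelve. all: end_near. Qed.

Lemma fps_eval_X : fps_eval fpsX = t.
Proof.
rewrite -[RHS]hornerX -fps_eval_poly; congr fps_eval; apply/funext => k.
by rewrite /fps_poly coefX.
Qed.

Lemma fps_evalC c : fps_eval (fpsC c) = c.
Proof.
rewrite -[RHS](hornerC c t) -fps_eval_poly; congr fps_eval; apply/funext => k.
by rewrite /fps_poly coefC; case: k.
Qed.

Lemma fps_evalXn u C m : wnorm_le r u C -> fps_eval (u ^+ m) = fps_eval u ^+ m.
Proof.
move=> uC; elim: m => [|m IH].
  rewrite !expr0 -[RHS](hornerC 1 t) -fps_eval_poly; congr fps_eval.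
  by apply/funext => k; rewrite /fps_poly coefC; case: k.
by rewrite !exprS (fps_evalM uC (wnormXn r0 m uC)) IH.
Qed.

Lemma fps_eval_sum (I : Type) (s : seq I) (F : I -> @fps R) (C : I -> R) :
  (forall i, wnorm_le r (F i) (C i)) ->
  fps_eval (\sum_(i <- s) F i) = \sum_(i <- s) fps_eval (F i).
Proof.
move=> FC; elim: s => [|i s IH].
  rewrite !big_nil -[RHS](horner0 t) -fps_eval_poly; congr fps_eval.
  by apply/funext => k; rewrite /fps_poly coef0.
by rewrite !big_cons (fps_evalD (FC i) (wnorm_sum r0 s FC)) IH.
Qed.

End evaluation.

(** * Inversion of the ratio series *)

Section ratio_series_inversion.
Context {R : realType} (n : nat).
Hypothesis n0 : (0 < n)%N.

Let y : @fps R := acoef R n.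

Let nk0 k : (n + 2 * k)%:R != 0 :> R.
Proof. by rewrite pnatr_eq0 -lt0n addn_gt0 n0. Qed.

(* The Riccati equation of [A_n], in the variable t = kappa^2. *)
Lemma acoef_riccati :
  euler y *+ 2 + fpsC n%:R * y = 1 - fpsX * (y * y).
Proof.
apply/funext => k; rewrite fps_coefD fps_coefMn fps_coefCM fps_coefD fps_coefN /euler.
have -> : k%:R * y k *+ 2 + n%:R * y k = (n + 2 * k)%:R * y k.
  by rewrite natrD natrM -mulr_natl; ring.
case: k => [|k].
  rewrite muln0 addn0 fps_coefXM0 subr0 /y acoef0 divff// pnatr_eq0 -lt0n//.
rewrite fps_coefXM fps_coef1 sub0r /y acoefE// mulrA mulrCA divff// mulr1 mulN1r.
by rewrite big_mkord fps_coefM; congr (- _); apply: eq_bigr => i _; rewrite subn1.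
Qed.

(* [1 / y], where [A_n (kappa) = kappa y (kappa^2)]. *)
Definition vcoef : R^nat := cov_rec (fun k v =>
  if k is 0%N then n%:R
  else ((k == 1%N)%:R - \sum_(1 <= i < k) v i * v (k - i)%N) / (n + 2 * k)%:R).

Let v : @fps R := vcoef.

Lemma vcoefS k : vcoef k.+1 =
  ((k == 0%N)%:R - \sum_(1 <= i < k.+1) vcoef i * vcoef (k.+1 - i)%N) /
  (n + 2 * k.+1)%:R.
Proof.
rewrite /vcoef cov_recE // => -[//|j] u w uw; congr ((_ - _) / _).
apply: eq_big_nat => i /andP[i1 ij]; rewrite !uw//.
by rewrite ltn_subrL i1.
Qed.

(** The equation obtained from [acoef_riccati] by setting y = 1 / v and multiplying by v^2; solved
    for the coefficient of index k, it is the recursion of [vcoef]. *)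
Lemma vcoef_riccati : v * v = fpsX + fpsC n%:R * v - euler v *+ 2.
Proof.
have v0 : v 0%N = n%:R by [].
apply/funext => k; rewrite fps_coefD fps_coefN fps_coefMn fps_coefD fps_coefCM /euler.
case: k => [|k].
  by rewrite fps_coefM0 v0 mul0r mul0rn subr0 add0r.
rewrite fps_coefM big_ord_recl subn0 big_ord_recr /= subSS subnn.
have -> : \sum_(i < k) v (lift ord0 (widen_ord (leqnSn k) i)) *
    v (k.+1 - lift ord0 (widen_ord (leqnSn k) i))%N =
    \sum_(1 <= i < k.+1) vcoef i * vcoef (k.+1 - i)%N.
  by rewrite big_add1 /= big_mkord.
have := vcoefS k => /(congr1 (fun x => x * (n + 2 * k.+1)%:R)).
rewrite divfK// -[vcoef k.+1]/(v k.+1) => E.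
rewrite v0 /fpsX eqSS -[(k == 0%N)%:R](subrK (\sum_(1 <= i < k.+1) vcoef i * vcoef (k.+1 - i)%N)) -E.
rewrite natrD natrM /bump /= add1n; ring.
Qed.

(** The two Riccati equations give 2 euler w = -(v + t y) w for w = y v - 1. Moving the constant
    term n of v to the left makes the factor 2k + n, never 0, so w = 0. *)
Lemma acoef_vcoef : y * v = 1.
Proof.
pose w := y * v - 1.
have rw : euler w *+ 2 = - ((v + fpsX * y) * w).
  rewrite /w eulerD eulerN euler1 eulerM.
  have e1 : euler y *+ 2 = 1 - fpsX * (y * y) - fpsC n%:R * y.
    by rewrite -acoef_riccati; ring.
  have e2 : euler v *+ 2 = fpsX + fpsC n%:R * v - v * v.
    by rewrite vcoef_riccati; ring.
  transitivity (euler y *+ 2 * v + y * (euler v *+ 2)).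
    by rewrite oppr0 addr0 mulrnDl mulrnAl mulrnAr.
  rewrite e1 e2; ring.
have v0 : v 0%N = n%:R by [].
suff : w = 0 by move/eqP; rewrite subr_eq0 => /eqP.
apply: (@fps_linear_uniq _ (fun k => (n + 2 * k)%:R) (fpsC n%:R - (v + fpsX * y))).
- move=> k; have := congr1 (fun u : fps => u k) rw.
  rewrite fps_coefMn /euler mulrBl fps_coefD !fps_coefN fps_coefCM => <-.
  by rewrite natrD natrM -mulr_natl; ring.
- by rewrite fps_coefD fps_coefN fps_coefD fps_coefXM0 v0 addr0 subrr.
- by move=> k /eqP; rewrite (negbTE (nk0 k)).
Qed.

Lemma acoef_le1 k : `|acoef R n k| <= 1.
Proof.
have [m] := ubnP k; elim: m k => // m IH [|k] km.
  by rewrite acoef0 ger0_norm// invf_le1 ?ltr0n// ler1n.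
rewrite acoefE// mulN1r mulNr normrN normrM normfV normr_nat.
rewrite ler_pdivrMl ?mulr1; last by rewrite ltr0n addn_gt0 n0.
rewrite (le_trans (ler_norm_sum _ _ _))// (@le_trans _ _ k.+1%:R)//; last first.
  by rewrite ler_nat; lia.
rewrite [leRHS](_ : _ = \sum_(0 <= i < k.+1) 1); last first.
  by rewrite sumr_const_nat subn0.
rewrite !big_nat ler_sum// => i ik.
by rewrite normrM mulr_ile1// IH//; lia.
Qed.

(** The sum in [vcoefS] avoids both extreme indices, hence the large value [vcoef 0 = n]; its k
    products and the extra term stay below the denominator. *)
Lemma vcoef_le1 k : `|vcoef k.+1| <= 1.
Proof.
have [m] := ubnP k; elim: m k => // m IH k km.
rewrite vcoefS normrM normfV normr_nat.
rewrite ler_pdivrMr ?mul1r; last by rewrite ltr0n addn_gt0 n0.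
rewrite (le_trans (ler_normB _ _))// (@le_trans _ _ (1 + k%:R))//; last first.
  by rewrite addrC natr1 ler_nat; lia.
rewrite lerD//; first by case: (k == 0%N); rewrite ?normr1 ?normr0.
rewrite (le_trans (ler_norm_sum _ _ _))//.
rewrite [leRHS](_ : _ = \sum_(1 <= i < k.+1) 1); last first.
  by rewrite sumr_const_nat subn1.
rewrite !big_nat ler_sum// => i ik.
have [j ij] : exists j, i = j.+1 by exists i.-1; lia.
have [j' ij'] : exists j, (k.+1 - i = j.+1)%N by exists (k - i)%N; lia.
by rewrite normrM ij' ij mulr_ile1// IH//; lia.
Qed.

Lemma half_sum K : \sum_(k < K) (2^-1 : R) ^+ k <= 2.
Proof.
elim: K => [|K IH]; first by rewrite big_ord0.
by rewrite big_ord_recl expr0; under eq_bigr do rewrite exprS; rewrite -mulr_sumr; lra.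
Qed.

Let h0 : 0 < 2^-1 :> R. Proof. by []. Qed.

(** Coefficients bounded by 1 are summed against a geometric series; the radius 1/2 is kept from
    here on. *)
Lemma acoef_wnorm : wnorm_le 2^-1 y 2.
Proof.
move=> K; apply: le_trans (half_sum K); apply: ler_sum => k _.
by rewrite -[leRHS]mul1r ler_wpM2r// acoef_le1.
Qed.

Lemma vcoef_wnorm : wnorm_le 2^-1 v n.+1%:R.
Proof.
case=> [|K]; first by rewrite big_ord0.
rewrite big_ord_recl expr0 mulr1 -(natr1 n) lerD//; first by rewrite normr_nat.
have := half_sum K.+1; rewrite big_ord_recl expr0 => s.
apply: (@le_trans _ _ (\sum_(i < K) 2^-1 ^+ lift ord0 i)); last by lra.
by apply: ler_sum => i _; rewrite -[leRHS]mul1r ler_wpM2r// vcoef_le1.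
Qed.

(* [A_n ^ 2] as a series in t *)
Let S : @fps R := fpsX * (y * y).

Lemma ratio_series_even : (ratio_series R n : fps) = fpsX * fps_even y.
Proof.
apply/funext => -[|k]; first by rewrite fps_coefXM0.
rewrite fps_coefXM /ratio_series /fps_even /=.
by case: ifPn => [ok|/negbNE ok]; rewrite ?(negbTE ok) ?ok//= uphalf_half (negbTE ok).
Qed.

(** Translates the coefficients in kappa that define [ccoef] into coefficients in t = kappa^2. *)
Lemma cauchy_exp_ratio j l :
  cauchy_exp (ratio_series R n) (2 * j) (2 * l) = (S ^+ j) l.
Proof.
rewrite cauchy_expE -[RHS]fps_even2 fps_evenXn; congr (_ (2 * l)%N).
have -> : fps_even S = (ratio_series R n : @fps R) ^+ 2.
  by rewrite /S !fps_evenM fps_evenX ratio_series_even; ring.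
by rewrite exprM.
Qed.

Lemma Sexp_diag l : (S ^+ l) l = b1 R n ^+ l.
Proof.
rewrite /S [_ ^+ l]exprMn; have := fps_coefXnM l ((y * y) ^+ l) 0.
rewrite addn0 => ->; by rewrite fps_coefX0 fps_coefM0 /b1 expr2.
Qed.

Lemma Sexp_lt j l : (l < j)%N -> (S ^+ j) l = 0.
Proof. by move=> lj; rewrite /S exprMn fps_coefXnM_lt. Qed.

Let b1_neq0 : b1 R n != 0.
Proof. by rewrite /b1 expf_neq0// acoef0 invr_neq0// pnatr_eq0 -lt0n. Qed.

Let c := ccoef R n.

(** The recursion of [ccoef] solved for its last term, whose factor is [b1 ^+ l]. Since S^j starts
    in degree j, the sum is the whole coefficient of index l of the composition with S. *)
Lemma ccoef_inverse l : (1 <= l)%N ->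
  \sum_(1 <= j < l.+1) c j * (S ^+ j) l = (l == 1%N)%:R.
Proof.
case: l => [//|[|l]] _.
  by rewrite big_nat1 /c ccoef1 Sexp_diag expr1 mulVf.
rewrite big_nat_recr//= Sexp_diag /c [X in _ + X * _]ccoefE//.
under [X in _ + - _ * X * _]eq_bigr do rewrite cauchy_exp_ratio.
by field; rewrite expf_neq0.
Qed.

Let ident L : @fps R := \sum_(1 <= j < L.+1) fpsC (c j) * S ^+ j - fpsX.

Lemma ident_low L k : (k <= L)%N -> ident L k = 0.
Proof.
move=> kL; rewrite /ident fps_coefD fps_coefN fps_coef_sum.
under eq_bigr do rewrite fps_coefCM.
case: k kL => [|k] kL.
  rewrite /fpsX subr0 big_nat big1// => j /andP[j1 _].
  by rewrite Sexp_lt ?mulr0.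
rewrite (big_cat_nat _ (n := k.+2))//= ccoef_inverse// [X in _ + X - _]big_nat big1.
  by rewrite addr0 /fpsX subrr.
by move=> j /andP[kj _]; rewrite Sexp_lt ?mulr0.
Qed.

Let gh : (y * y) * (v * v) = 1.
Proof. by rewrite mulrACA acoef_vcoef mulr1. Qed.

(** Differentiating y^2 v^2 = 1 gives v^4 euler(y^2) = - euler(v^2), so the series is -
    euler(v^(2m)) / m, and [euler] multiplies coefficient m by m. *)
Let euler_vv m : (0 < m)%N -> ((v * v) ^+ m.+1 * euler (y * y)) m = - ((v * v) ^+ m) m.
Proof.
case: m => // m _.
have hg : (v * v) * (v * v) * euler (y * y) = - euler (v * v).
  have := congr1 (fun u => euler u) gh; rewrite eulerM euler1 => E.
  transitivity ((v * v) * (euler (y * y) * (v * v) + y * y * euler (v * v)) -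
    (y * y) * (v * v) * euler (v * v)); first by ring.
  by rewrite E gh mulr0 add0r mul1r.
rewrite 2!exprSr -2!mulrA [X in _ * X]mulrA hg mulrN fps_coefN; congr (- _).
have := congr1 (fun u : fps => u m.+1) (euler_exp (v * v) m.+1).
rewrite fps_coefMn -[RHS]mulr_natl => E; apply/esym.
have m0 : m.+1%:R != 0 :> R by rewrite pnatr_eq0.
by apply: (mulfI m0); rewrite -exprSr; exact: E.
Qed.

(** As v^2 = t / S, this coefficient is the residue of S^(-m-1) dS: it is 1 for m = 0, and 0
    otherwise because the form is exact. *)
Let lagrange_term m j :
  ((v * v) ^+ (m + j.+1) * (S ^+ j * euler S)) (m + j.+1)%N = (m == 0%N)%:R.
Proof.
have eS : euler S = fpsX * (y * y + euler (y * y)).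
  by rewrite /S eulerM eulerX mulrDr.
have -> : (v * v) ^+ (m + j.+1) * (S ^+ j * euler S) =
    fpsX ^+ j.+1 * ((v * v) ^+ m * ((y * y) * (v * v)) + (v * v) ^+ m.+1 * euler (y * y)).
  rewrite eS {1}/S [(fpsX * _) ^+ j]exprMn addnS -addSn exprD.
  transitivity (fpsX ^+ j.+1 * (v * v) ^+ m.+1 * ((y * y) * (v * v)) ^+ j *
     (y * y + euler (y * y))); first by rewrite [((y * y) * (v * v)) ^+ j]exprMn [fpsX ^+ j.+1]exprS; ring.
  by rewrite {1}gh expr1n [(v * v) ^+ m.+1]exprS; ring.
rewrite gh mulr1 addnC fps_coefXnM fps_coefD.
case: m => [|m]; last by rewrite euler_vv// subrr.
by rewrite expr0 expr1 fps_coefM0 /euler mul0r mulr0 addr0.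
Qed.

(* Lagrange inversion for [S = fpsX * y ^+ 2], where [v * v] is the inverse of
   [y ^+ 2]. *)
Lemma ccoef_lagrange l : l.+1%:R * c l.+1 = ((v * v) ^+ l.+1) l.
Proof.
(* [ident l.+1] has no terms up to degree [l.+1], and neither has its Euler derivative. By
   [lagrange_term] only the summand j = l + 1 survives in the expansion of this coefficient. *)
have : ((v * v) ^+ l.+1 * euler (ident l.+1)) l.+1 = 0.
  rewrite fps_coefM big1// => i _; rewrite /euler ident_low ?mulr0//.
  by rewrite leq_subr.
rewrite /ident eulerD eulerN eulerX euler_sum mulrBr fps_coefD fps_coefN.
rewrite [_ * fpsX]mulrC fps_coefXM => /eqP; rewrite subr_eq0 => /eqP <-.
rewrite mulr_sumr fps_coef_sum big_add1 /= big_nat_recr//= big_nat big1.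
  rewrite add0r eulerM eulerC mul0r add0r euler_exp /=.
  rewrite mulrCA fps_coefCM mulrnAr fps_coefMn.
  have := lagrange_term 0 l; rewrite add0n => ->.
  by rewrite eqxx mulrC.
move=> j /andP[_ jl].
rewrite eulerM eulerC mul0r add0r euler_exp /= mulrCA fps_coefCM mulrnAr fps_coefMn.
have -> : l.+1 = ((l - j) + j.+1)%N by lia.
by rewrite lagrange_term subn_eq0 leqNgt jl mul0rn mulr0.
Qed.

(** The norm bound (n + 1)^2 of v^2 at radius 1/2, times 2 for the division by that radius in the
    Cauchy estimate. *)
Let Q : R := 2 * (n.+1%:R * n.+1%:R).

Lemma ccoef_le l : (0 < l)%N -> `|c l| <= Q ^+ l.
Proof.
case: l => // l _.
have := wnorm_coef h0 l (wnormXn h0 l.+1 (wnormM h0 vcoef_wnorm vcoef_wnorm)).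
rewrite -ccoef_lagrange normrM normr_nat exprVn ler_pdivrMr ?exprn_gt0// => lc.
have : `|c l.+1| <= l.+1%:R * `|c l.+1| by rewrite ler_peMl// ler1n.
move/le_trans; apply; apply: (le_trans lc).
rewrite /Q [leRHS]exprMn mulrC ler_wpM2r ?exprn_ge0 ?mulr_ge0//.
by rewrite ler_weXn2l// ler1n.
Qed.

Let Q2 : 2 <= Q.
Proof. by rewrite /Q ler_peMr// -natrM ler1n. Qed.

Lemma S_wnorm : wnorm_le 2^-1 S 2.
Proof.
have : wnorm_le 2^-1 S (2^-1 * (2 * 2)).
  exact: (wnormM h0 (wnormX h0) (wnormM h0 acoef_wnorm acoef_wnorm)).
by rewrite mulKf.
Qed.

Let ident_term_wnorm j :
  wnorm_le 2^-1 (fpsC (c j) * S ^+ j) (`|c j| * 2 ^+ j).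
Proof. exact (wnormM h0 (@wnormC R 2^-1 (c j)) (wnormXn h0 j S_wnorm)). Qed.

(** [S] has norm at most 2, so term j is at most (2Q)^j; a geometric sum of ratio at least 2 is at
    most twice its last term, and the third copy absorbs the norm of [fpsX]. *)
Lemma ident_wnorm L : wnorm_le 2^-1 (ident L) (3 * (2 * Q) ^+ L).
Proof.
have Lsum : \sum_(1 <= j < L.+1) `|c j| * 2 ^+ j <= 2 * (2 * Q) ^+ L.
  elim: L => [|L IH]; first by rewrite big_geq// expr0 mulr1.
  rewrite big_nat_recr//=.
  have cL : `|c L.+1| * 2 ^+ L.+1 <= (2 * Q) ^+ L.+1.
    by rewrite exprMn mulrC ler_wpM2l ?exprn_ge0//; exact: ccoef_le.
  apply: (le_trans (lerD IH cL)); rewrite exprS.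
  have : 0 <= (2 * Q) ^+ L by rewrite exprn_ge0// mulr_ge0// (le_trans _ Q2).
  by move: Q2; nra.
move=> K; apply: (le_trans (wnormD h0 (wnorm_sum h0 _ ident_term_wnorm)
  (wnormN (wnormX h0)) K)).
have : 1 <= (2 * Q) ^+ L by rewrite exprn_ege1//; move: Q2; lra.
by move: Lsum; lra.
Qed.

Lemma fps_evalS (t : R) : 0 <= t -> t < 2^-1 ->
  fps_eval t S = t * fps_eval t y ^+ 2.
Proof.
move=> t0 t12.
rewrite (fps_evalM t0 t12 (wnormX h0) (wnormM h0 acoef_wnorm acoef_wnorm)).
by rewrite (fps_evalM t0 t12 acoef_wnorm acoef_wnorm) (fps_eval_X t) expr2.
Qed.

Lemma ccoef_inverse_cvg (t : R) : 0 <= t -> 4 * Q * t < 1 ->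
  \sum_(1 <= l < L.+1) c l * fps_eval t S ^+ l @[L --> \oo] --> t.
Proof.
move=> t0 Qt; have t12 : t < 2^-1 by move: Q2; nra.
have evalE L : \sum_(1 <= l < L.+1) c l * fps_eval t S ^+ l - t =
    fps_eval t (ident L).
  rewrite /ident (fps_evalD t0 t12 (wnorm_sum h0 _ ident_term_wnorm)
    (wnormN (wnormX h0))) (fps_evalN t0 t12 (wnormX h0)) (fps_eval_X t).
  rewrite (fps_eval_sum t0 t12 _ ident_term_wnorm); congr (_ - _).
  apply: eq_bigr => j _.
  rewrite (fps_evalM t0 t12 (@wnormC R 2^-1 (c j)) (wnormXn h0 j S_wnorm)).
  by rewrite (fps_evalC t) (fps_evalXn t0 t12 _ S_wnorm).
have lim0 : 3 * (4 * Q * t) ^+ L @[L --> \oo] --> (0 : R).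
  rewrite -(mulr0 3); apply: cvgMr; apply: cvg_expr.
  by rewrite ger0_norm// !mulr_ge0// (le_trans _ Q2).
apply/cvgrPdist_le => e e0; near=> L.
rewrite distrC evalE (le_trans (fps_eval_tail t0 t12 (ident_wnorm L)
   (m := L) (fun k kL => ident_low (ltnW kL))))//.
(* The gain t / r = 2t per degree meets the growth 2Q of the norm. *)
rewrite invrK mulrCA -exprMn (_ : t * 2 * (2 * Q) = 4 * Q * t); last by ring.
apply: le_trans (_ : `|0 - 3 * (4 * Q * t) ^+ L| <= e).
  by rewrite sub0r normrN ler_norm.
by near: L; move/cvgrPdist_le : lim0; apply.
Unshelve. all: end_near. Qed.

End ratio_series_inversion.

(** * The Bessel quotient as a power series *)

Section bessel_ratio_series.
Context {R : realType} (n : nat).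
Hypothesis n2 : (2 <= n)%N.

Let n0 : (0 < n)%N. Proof. exact: ltnW. Qed.
Let y : @fps R := acoef R n.
Let B : @fps R := bessel_coef n.

(** Bessel's equation in t = kappa^2, which is [bessel_coefS] multiplied out. *)
Let bessel_ode :
  euler (euler B) *+ 4 = fpsX * B - fpsC n%:R * euler B *+ 2 + euler B *+ 4.
Proof.
apply/funext => -[|k].
  rewrite !(fps_coefD, fps_coefN, fps_coefMn) fps_coefXM0 fps_coefCM /euler.
  by rewrite !mul0r mulr0; ring.
rewrite !(fps_coefD, fps_coefN, fps_coefMn) fps_coefXM fps_coefCM /euler.
rewrite /B -(bessel_coefS n2 k) (_ : (2 * k).+2 = (2 * k.+1)%N); last by lia.
rewrite natrD !natrM -(natr1 k); ring.
Qed.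

(* The difference of the two sides satisfies a homogeneous first-order equation,
   by [acoef_riccati]. *)
Lemma bessel_coef_euler : euler B *+ 2 = fpsX * (y * B).
Proof.
apply/eqP; rewrite -subr_eq0; apply/eqP; set z : fps := _ - _.
have rz : euler z *+ 2 = (fpsC 2 - fpsC n%:R - fpsX * y) * z.
  have C2 : fpsC 2 = 1 *+ 2 :> @fps R.
    by apply/funext => -[|k]; rewrite fps_coefMn fps_coef1 //= mul0rn.
  have ry : euler y *+ 2 = 1 - fpsX * (y * y) - fpsC n%:R * y.
    by rewrite -(acoef_riccati n0) -/y; ring.
  have e2 u : euler (u *+ 2) = euler u *+ 2 :> @fps R by rewrite !mulr2n eulerD.
  rewrite C2 /z eulerD eulerN e2 !eulerM eulerX.
  transitivity (euler (euler B) *+ 4 - fpsX * (y * B) *+ 2 -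
    fpsX * (euler y *+ 2) * B - fpsX * y * (euler B *+ 2)); first by ring.
  by rewrite bessel_ode ry; ring.
apply: (@fps_linear_uniq _ (fun k => (n + 2 * k)%:R - 2) (- (fpsX * y))).
- move=> k; have := congr1 (fun u : fps => u k) rz.
  have -> : (fpsC 2 - fpsC n%:R - fpsX * y) * z =
    fpsC 2 * z - fpsC n%:R * z + - (fpsX * y) * z by ring.
  rewrite fps_coefMn !fps_coefD fps_coefN !fps_coefCM /euler => E.
  rewrite -[RHS](addKr (2 * z k - n%:R * z k)) -E natrD natrM; ring.
- by rewrite fps_coefN fps_coefXM0 oppr0.
(* The factor n + 2k - 2 can vanish only at k = 0, when n = 2; there z has no constant term. *)
- case=> [_|k /eqP]; last by rewrite subr_eq0 eqr_nat; lia.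
  by rewrite /z fps_coefD fps_coefN fps_coefMn fps_coefXM0 /euler mul0r mul0rn subrr.
Qed.

Let h0 : 0 < 2^-1 :> R. Proof. by []. Qed.

Let B_wnorm : wnorm_le 2^-1 B (B 0%N * 2).
Proof.
move=> K; rewrite (le_trans _ (ler_wpM2l _ (half_sum K)))//; last first.
  exact/ltW/(bessel_coef_gt0 n2).
rewrite mulr_sumr ler_sum// => k _; rewrite ler_wpM2r//.
rewrite ger0_norm; last exact/ltW/(bessel_coef_gt0 n2).
rewrite (le_trans (bessel_coef_fact n2 k))// ler_pdivrMr ?ltr0n ?fact_gt0//.
by rewrite ler_peMr ?ler1n ?fact_gt0//; exact/ltW/(bessel_coef_gt0 n2).
Qed.

Lemma bessel_ratio_eval (kappa : R) : 0 < kappa -> kappa ^+ 2 < 2^-1 ->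
  bessel_ratio n kappa = kappa * fps_eval (kappa ^+ 2) y.
Proof.
move=> k0 k2; have t0 := sqr_ge0 kappa.
have yB := wnormM h0 (acoef_wnorm n0) B_wnorm.
(* Coefficient m of B' is coefficient m + 1 of [euler B], so this is [bessel_coef_euler] divided by
   2t. *)
have dE : (fun m => m.+1%:R * bessel_coef n m.+1) = fpsC 2^-1 * (y * B) :> @fps R.
  apply/funext => m; rewrite fps_coefCM.
  have := congr1 (fun u : fps => u m.+1) bessel_coef_euler.
  by rewrite fps_coefXM fps_coefMn /euler => <-; rewrite /B; field.
have -> : bessel_ratio n kappa =
    2 * kappa * fps_eval (kappa ^+ 2) (fpsC 2^-1 * (y * B)) / bessel_sum n (kappa ^+ 2).
  by rewrite (bessel_ratioE n2)// -dE.
rewrite (fps_evalM t0 k2 (@wnormC R 2^-1 2^-1) yB).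
rewrite (fps_evalM t0 k2 (acoef_wnorm n0) B_wnorm) (fps_evalC (kappa ^+ 2)).
rewrite -[bessel_sum n _]/(fps_eval (kappa ^+ 2) B).
have : fps_eval (kappa ^+ 2) B != 0.
  exact/lt0r_neq0/(bessel_sum_gt0 n2 t0).
by move=> ?; field.
Qed.

Let Q : R := 4 * (2 * (n.+1%:R * n.+1%:R)).

(** This [Q] includes the factor 4 of the condition in [ccoef_inverse_cvg], so the radius is 1 / (8
    (n + 1)^2). *)
Definition inversion_radius : R := Q^-1.

Let Q8 : 8 <= Q.
Proof.
have : 1 <= n.+1%:R * n.+1%:R :> R by rewrite -natrM ler1n.
by rewrite /Q; lra.
Qed.

Lemma inversion_radius_gt0 : 0 < inversion_radius.
Proof. by rewrite invr_gt0 (lt_le_trans _ Q8). Qed.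

Let radius_lt : inversion_radius < 2^-1.
Proof. by rewrite ltf_pV2 ?posrE//; move: Q8; lra. Qed.

(** The ratio series has coefficients bounded by 1 and the radius is below 1, so the series
    converges at that very point, which belongs to the set whose supremum is taken. *)
Lemma inversion_radius_le : (inversion_radius%:E <= ratio_radius R n)%E.
Proof.
apply: ereal_sup_ubound; exists inversion_radius => /=; last first.
  by rewrite gtr0_norm// inversion_radius_gt0.
apply: normed_cvg.
apply: (@series_le_cvg _ _ (fun k => inversion_radius ^+ k)).
- by move=> k /=.
- by move=> k; rewrite /= exprn_ge0// ltW// inversion_radius_gt0.
- move=> k; rewrite /= normrM normrX (gtr0_norm inversion_radius_gt0).
  apply: ler_piMl; first by rewrite exprn_ge0 ?ltW ?inversion_radius_gt0.
  by rewrite /ratio_series; case: ifP => _; rewrite ?normr0 ?(acoef_le1 n0).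
- have r1 : `|inversion_radius| < 1.
    by rewrite gtr0_norm ?inversion_radius_gt0 ?(lt_trans radius_lt) ?invf_lt1 ?ltr1n.
  rewrite (_ : (fun k => _) = geometric 1 inversion_radius).
    exact: is_cvg_geometric_series.
  by apply/funext => k; rewrite /geometric /= mul1r.
Qed.

Lemma sum_ccoef_ratio_cvg (kappa : R) : 0 < kappa < inversion_radius ->
  \sum_(1 <= l < L.+1) ccoef R n l * bessel_ratio n kappa ^+ (2 * l)
    @[L --> \oo] --> kappa ^+ 2.
Proof.
move=> /andP[k0 kr].
have k2 : kappa ^+ 2 < inversion_radius.
  by rewrite (le_lt_trans _ kr)// expr2 ler_piMr ?ltW// (lt_trans kr)//
    (lt_trans radius_lt)// invf_lt1 ?ltr1n.
have k22 := lt_trans k2 radius_lt.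
have E : bessel_ratio n kappa ^+ 2 =
    fps_eval (kappa ^+ 2) (fpsX * (y * y)).
  have := fps_evalS n0 (sqr_ge0 kappa) k22; rewrite -/y => ->.
  by rewrite (bessel_ratio_eval k0 k22) exprMn.
under eq_fun do under eq_bigr do rewrite exprM E.
apply: (ccoef_inverse_cvg n0); first exact: sqr_ge0.
by rewrite mulrC -/Q -ltr_pdivlMr ?mul1r// (lt_le_trans _ Q8).
Qed.

End bessel_ratio_series.

Theorem corollary4p4 (R : realType) (n : nat) (hn : (2 <= n)%N) :
  (forall (M N : nat), (1 <= M)%N -> (2 * M <= N)%N ->
   forall (mu : n.-tuple R) (kappa : R), unit_sphere mu -> 0 < kappa ->
   forall (d : measure_display) (T : measurableType d) (P : probability T R)
     (X : 'I_N -> {RV P >-> n.-tuple R}), iid_fvml X mu kappa ->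
   ('E_P[fun w => zeta_hat M (fun i => X i w)])%E = (zeta n M kappa)%:E)
  /\
  exists rho : R, [/\ 0 < rho, (rho%:E <= ratio_radius R n)%E &
    forall kappa : R, 0 < kappa < rho ->
    [/\ (\sum_(1 <= l < L) ccoef R n l * bessel_ratio n kappa ^+ (2 * l))
          @[L --> \oo] --> kappa ^+ 2,
        zeta n M kappa @[M --> \oo] --> kappa ^+ 2 &
        forall (M N : nat), (1 <= M)%N -> (2 * M <= N)%N ->
        forall mu : n.-tuple R, unit_sphere mu ->
        forall (d : measure_display) (T : measurableType d)
          (P : probability T R) (X : 'I_N -> {RV P >-> n.-tuple R}),
        iid_fvml X mu kappa ->
        ('E_P[fun w => zeta_hat M (fun i => X i w)] - (kappa ^+ 2)%:E)%E =
        (- \big[+%R/0]_(M.+1 <= l <oo)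
             (ccoef R n l * bessel_ratio n kappa ^+ (2 * l)))%:E]].
Proof.
split=> [M N _ MN mu kappa mu1 k0 d T P X iidX|].
  exact: (zeta_hat_unbiased hn mu1 k0 iidX MN).
exists (inversion_radius n); split.
- exact: inversion_radius_gt0.
- exact: inversion_radius_le.
move=> kappa k0r; have zetac := sum_ccoef_ratio_cvg hn k0r.
have /andP[k0 _] := k0r; split.
(* This sum stops before [L], while [zeta] includes its last index: the two sequences differ by a
   shift of one. *)
- by rewrite -cvg_shiftS.
- exact: zetac.
move=> M N _ MN mu mu1 d T P X iidX.
rewrite (zeta_hat_unbiased hn mu1 k0 iidX MN) -EFinB; congr EFin.
rewrite -[LHS]opprB; congr (- _); apply/esym/cvg_lim => //.
(* After the shift, the partial sum of the tail is the difference of [zeta] at [L + M] and at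
   [M]. *)
rewrite -(cvg_shiftn M.+1).
rewrite (_ : (fun L => _) = (fun L => zeta n (L + M) kappa - zeta n M kappa)).
  by apply: cvgB; [rewrite -(cvg_shiftn M) in zetac; exact: zetac|exact: cvg_cst].
apply/funext => L; rewrite /zeta addnS.
rewrite [X in _ = X - _](big_cat_nat _ (n := M.+1))//= ?ltnS ?leq_addl//.
by rewrite [X in _ = X - _]addrC addrK.
Qed.
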